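(* Let $m_1>0$, $m_2\leq0$ with $m_1\geq|m_2|$, and consider the Euler problem with two fixed centers $e$ and $m$ of masses $m_1$ and $m_2$ respectively. If the energy satisfies $c<-m_1-m_2$, then the bounded component around the fixed center $e$ of the regularized energy hypersurface arises as the boundary of a convex toric domain.
   Context: **Euler problem.** The Hamiltonian is $H_0(q,p)=\frac12|p|^2-U_0(q)$ with centers $e=(-\frac12,0)$, $m=(\frac12,0)$ and $$U_0(q)=\frac{m_1}{\sqrt{(q_1+\frac12)^2+q_2^2}}+\frac{m_2}{\sqrt{(q_1-\frac12)^2+q_2^2}} .$$ **Regularization.** Use elliptic coordinates $(\mu,\nu)\in\mathbb{R}\times S^1$, $S^1=\mathbb{R}/2\pi\mathbb{Z}$, with $q_1=\frac12\cosh\mu\cos\nu$, $q_2=\frac12\sinh\mu\sin\nu$ (so $e$ corresponds to $(\mu,\nu)=(0,\pi)$ and $m$ to $(0,0)$), together with the conjugate momenta $(p_\mu,p_\nu)$. Put $M_1=m_1+m_2$, $M_2=m_1-m_2$. The function $\frac14(\cosh^2\mu-\cos^2\nu)(H_0-c)$ extends smoothly to $K_{c,0}=K^1_{c,0}+K^2_{c,0}:T^*(\mathbb{R}\times S^1)\to\mathbb{R}$, where $$K^1_{c,0}=\tfrac12p_\mu^2-\tfrac c4(\cosh^2\mu-1)-\tfrac{M_1}{2}\cosh\mu,\qquad K^2_{c,0}=\tfrac12p_\nu^2+\tfrac c4(\cos^2\nu-1)+\tfrac{M_2}{2}\cos\nu .$$ The regularized energy hypersurface is $\overline{\Sigma}_{c,0}=K_{c,0}^{-1}(0)\subset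 T^*(\mathbb{R}\times S^1)$; its bounded component around $e$ is the bounded connected component $\overline{\Sigma}^e_{c,0}$ meeting the fibre over $(\mu,\nu)=(0,\pi)$. **Toric domains.** For a domain $\Omega\subset\mathbb{R}^n_{\geq0}$ let $X_\Omega=\{z\in\mathbb{C}^n:(\pi|z_1|^2,\dots,\pi|z_n|^2)\in\Omega\}$ (here $n=2$), with the standard symplectic form. Let $\hat\Omega=\{\mu\in\mathbb{R}^n:(|\mu_1|,\dots,|\mu_n|)\in\Omega\}$. A convex toric domain is a toric domain $X_\Omega$ such that $\hat\Omega$ is compact and convex. **Convention.** $\overline{\Sigma}^e_{c,0}$ ''arises as the boundary of $X_\Omega$'' if the compact connected component of $\{K_{c,0}\le0\}$ it bounds, with the canonical symplectic form of $T^*(\mathbb{R}\times S^1)$, is symplectomorphic to $X_\Omega$ (so that $\overline{\Sigma}^e_{c,0}$ corresponds to $\partial X_\Omega$). *)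

(* Defs.v *)
From HB Require Import structures.
From mathcomp Require Import all_boot all_order all_algebra.
From mathcomp Require Import all_classical all_reals all_analysis.
From mathcomp Require Import ring lra.
Set Implicit Arguments.
Unset Strict Implicit.
Unset Printing Implicit Defensive.
Import Order.TTheory GRing.Theory Num.Theory.
Import numFieldNormedType.Exports.
Local Open Scope classical_set_scope.
Local Open Scope ring_scope.

Definition cosh {R : realType} (x : R) : R := (expR x + expR (- x)) / 2.
Definition sinh {R : realType} (x : R) : R := (expR x - expR (- x)) / 2.

Definition boundary {T : topologicalType} (A : set T) : set T :=
  closure A `\` A°.

Definition is_component {T : topologicalType} (A C : set T) : Prop :=
  exists2 x, A x & C = connected_component A x.

Definition euler_U0 {R : realType} (m1 m2 q1 q2 : R) : R :=
  m1 / Num.sqrt ((q1 + 2^-1) ^+ 2 + q2 ^+ 2)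
  + m2 / Num.sqrt ((q1 - 2^-1) ^+ 2 + q2 ^+ 2).

Definition euler_H0 {R : realType} (m1 m2 q1 q2 p1 p2 : R) : R :=
  2^-1 * (p1 ^+ 2 + p2 ^+ 2) - euler_U0 m1 m2 q1 q2.

Lemma cosh2_sinh2 {R : realType} (x : R) : cosh x ^+ 2 - sinh x ^+ 2 = 1.
Proof.
have h : expR x * expR (- x) = 1 by rewrite expRN divff // gt_eqF // expR_gt0.
have -> : 1 = expR x * expR (- x) by rewrite h.
by rewrite /cosh /sinh; field.
Qed.

Lemma cosh_ge1 {R : realType} (x : R) : 1 <= cosh x.
Proof. by have := expR_ge1Dx x; have := expR_ge1Dx (- x); rewrite /cosh; lra. Qed.

Definition angle_equiv (R : realType) (x y : R) : bool :=
  (x - y) / (2 * pi) \is a Num.int.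

Lemma angle_equiv_refl R : reflexive (@angle_equiv R).
Proof. by move=> x; rewrite /angle_equiv subrr mul0r. Qed.

Lemma angle_equiv_sym R : symmetric (@angle_equiv R).
Proof. by move=> x y; rewrite /angle_equiv -opprB mulNr rpredN. Qed.

Lemma angle_equiv_trans R : transitive (@angle_equiv R).
Proof.
move=> y x z xy yz; rewrite /angle_equiv.
have -> : x - z = (x - y) + (y - z) by ring.
by rewrite mulrDl rpredD.
Qed.

Canonical angle_equivRel (R : realType) :=
  EquivRel (@angle_equiv R) (@angle_equiv_refl R) (@angle_equiv_sym R)
    (@angle_equiv_trans R).

Local Open Scope quotient_scope.

Definition circle (R : realType) : Type :=
  quotient_topology {eq_quot (angle_equivRel R)}.

HB.instance Definition _ (R : realType) := Topological.on (circle R).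
HB.instance Definition _ (R : realType) := Quotient.on (circle R).

Definition angle {R : realType} (x : R) : circle R := \pi_(circle R) x.

(* Independent of the representative, see [circle_cosE]. *)
Definition circle_cos {R : realType} (a : circle R) : R := cos (repr a).

Lemma circle_cosE {R : realType} (x : R) : circle_cos (angle x) = cos x.
Proof.
have cosDnat (z : R) (n : nat) : cos (z + pi *+ 2 *+ n) = cos z.
  exact: (periodicn (@cosD2pi R)).
have cosDint (y : R) (k : int) : cos (y + k%:~R * (2 * pi)) = cos y.
  rewrite mulr_natl; case: k => n.
    by rewrite -pmulrn mulr_natl cosDnat.
  by rewrite NegzE mulrNz -pmulrn mulNr mulr_natl -[LHS](cosDnat _ n.+1) subrK.
rewrite /circle_cos.
have /eqmodP/intrP[k Hk] :
  (repr (angle x) = x %[mod {eq_quot angle_equivRel R}])%qT by exact: reprK.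
have pi2 : 2 * pi != 0 :> R by rewrite mulf_neq0 // gt_eqF // pi_gt0.
by rewrite -[repr _](subrK x) addrC -[_ - x](divfK pi2) Hk cosDint.
Qed.

(* T^*(R x S^1), with points written ((mu, nu), (p_mu, p_nu)). *)
Definition phase (R : realType) : Type := ((R * circle R) * (R * R))%type.

HB.instance Definition _ (R : realType) := Topological.on (phase R).

Definition regK1 {R : realType} (m1 m2 c mu pmu : R) : R :=
  2^-1 * pmu ^+ 2 - c / 4 * (cosh mu ^+ 2 - 1) - (m1 + m2) / 2 * cosh mu.

Definition regK2 {R : realType} (m1 m2 c : R) (nu : circle R) (pnu : R) : R :=
  2^-1 * pnu ^+ 2 + c / 4 * (circle_cos nu ^+ 2 - 1)
  + (m1 - m2) / 2 * circle_cos nu.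

Definition regK {R : realType} (m1 m2 c : R) (z : phase R) : R :=
  regK1 m1 m2 c z.1.1 z.2.1 + regK2 m1 m2 c z.1.2 z.2.2.

(* In elliptic coordinates, with conjugate momenta p . dq/dmu and p . dq/dnu,
   the regularized Hamiltonian is the rescaled Euler Hamiltonian away from the
   two centers (which are the points where cosh^2 mu = cos^2 nu). *)
Lemma regularization {R : realType} (m1 m2 c mu nu p1 p2 : R) :
  let q1 := 2^-1 * (cosh mu * cos nu) in
  let q2 := 2^-1 * (sinh mu * sin nu) in
  let pmu := 2^-1 * (p1 * (sinh mu * cos nu) + p2 * (cosh mu * sin nu)) in
  let pnu := 2^-1 * (p2 * (sinh mu * cos nu) - p1 * (cosh mu * sin nu)) in
  cosh mu ^+ 2 != cos nu ^+ 2 ->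
  4^-1 * (cosh mu ^+ 2 - cos nu ^+ 2) * (euler_H0 m1 m2 q1 q2 p1 p2 - c)
  = regK m1 m2 c ((mu, angle nu), (pmu, pnu)).
Proof.
move=> q1 q2 pmu pnu; rewrite -subr_eq0 subr_sqr mulf_eq0 negb_or => /andP[n1 n2].
have ch1 := cosh_ge1 mu; have c1 := cos_le1 nu; have c2 := cos_geN1 nu.
have hs := sin2cos2 nu.
have hch : sinh mu ^+ 2 = cosh mu ^+ 2 - 1.
  by rewrite -(cosh2_sinh2 mu) opprB addrC subrK.
have e1 : Num.sqrt ((q1 + 2^-1) ^+ 2 + q2 ^+ 2) = 2^-1 * (cosh mu + cos nu).
  have -> : (q1 + 2^-1) ^+ 2 + q2 ^+ 2 = (2^-1 * (cosh mu + cos nu)) ^+ 2.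
    have -> : q2 ^+ 2 = 4^-1 * (sinh mu ^+ 2 * sin nu ^+ 2) by rewrite /q2; field.
    by rewrite hs hch /q1; field.
  by rewrite sqrtr_sqr ger0_norm //; lra.
have e2 : Num.sqrt ((q1 - 2^-1) ^+ 2 + q2 ^+ 2) = 2^-1 * (cosh mu - cos nu).
  have -> : (q1 - 2^-1) ^+ 2 + q2 ^+ 2 = (2^-1 * (cosh mu - cos nu)) ^+ 2.
    have -> : q2 ^+ 2 = 4^-1 * (sinh mu ^+ 2 * sin nu ^+ 2) by rewrite /q2; field.
    by rewrite hs hch /q1; field.
  by rewrite sqrtr_sqr ger0_norm //; lra.
have ep : pmu ^+ 2 + pnu ^+ 2 =
    4^-1 * (p1 ^+ 2 + p2 ^+ 2) * (cosh mu ^+ 2 - cos nu ^+ 2).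
  transitivity (4^-1 * (p1 ^+ 2 + p2 ^+ 2) *
    (sinh mu ^+ 2 * cos nu ^+ 2 + cosh mu ^+ 2 * sin nu ^+ 2)).
    by rewrite /pmu /pnu; field.
  by rewrite hs hch; ring.
transitivity (2^-1 * (pmu ^+ 2 + pnu ^+ 2) - c / 4 * (cosh mu ^+ 2 - 1)
  - (m1 + m2) / 2 * cosh mu + c / 4 * (cos nu ^+ 2 - 1)
  + (m1 - m2) / 2 * cos nu); last by rewrite /regK /regK1 /regK2 /= circle_cosE; ring.
rewrite ep /euler_H0 /euler_U0 e1 e2; field.
by rewrite n1 n2.
Qed.

(* S^1 being compact, only the coordinates mu, p_mu, p_nu matter. *)
Definition phase_bounded {R : realType} (A : set (phase R)) : Prop :=
  exists M : R, forall z, A z ->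
    [/\ `|z.1.1| <= M, `|z.2.1| <= M & `|z.2.2| <= M].

(* The fibre over the center of mass m1, located at q = (-1/2, 0). *)
Definition fibre_e {R : realType} : set (phase R) :=
  [set z | z.1 = (0, angle pi)].

Definition energy_surface {R : realType} (m1 m2 c : R) : set (phase R) :=
  [set z | regK m1 m2 c z = 0].

Definition sublevel {R : realType} (m1 m2 c : R) : set (phase R) :=
  [set z | regK m1 m2 c z <= 0].

Definition bounded_component_at_e {R : realType} (m1 m2 c : R)
    (S : set (phase R)) : Prop :=
  [/\ is_component (energy_surface m1 m2 c) S,
      phase_bounded S & S `&` fibre_e !=set0].

(* R^(n + n) has coordinates (x_1, ..., x_n, y_1, ..., y_n); it stands for C^n
   with z_i = x_i + sqrt(-1) y_i, and for the universal cover of T^*(R x S^1)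
   (n = 2) with positions x_i and conjugate momenta y_i. *)
Definition xcoord {R : realType} n (u : 'rV[R]_(n + n)) (i : 'I_n) : R :=
  u 0 (lshift n i).
Definition ycoord {R : realType} n (u : 'rV[R]_(n + n)) (i : 'I_n) : R :=
  u 0 (rshift n i).

(* sum_i dx_i /\ dy_i *)
Definition omega {R : realType} n (u v : 'rV[R]_(n + n)) : R :=
  \sum_(i < n) (xcoord u i * ycoord v i - ycoord u i * xcoord v i).

(* U is meant to be open, since derivatives are taken in the ambient space. *)
Fixpoint Ck {R : realType} {V W : normedModType R} (k : nat) (U : set V)
    (f : V -> W) : Prop :=
  match k with
  | 0 => forall x, U x -> {for x, continuous f}
  | k'.+1 => (forall x, U x -> differentiable f x) /\
             (forall v, Ck k' U ('D_v f))
  end.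

Definition smooth_on {R : realType} {V W : normedModType R} (U : set V)
    (f : V -> W) : Prop :=
  forall k, Ck k U f.

Definition phase_cover {R : realType} (u : 'rV[R]_(2 + 2)) : phase R :=
  ((xcoord u 0, angle (xcoord u 1)), (ycoord u 0, ycoord u 1)).

(* [phase_cover] is a local diffeomorphism defining the smooth structure of the
   phase space and pulling its canonical symplectic form back to [omega]: maps
   out of the phase space are tested after precomposition with [phase_cover],
   maps into it through local lifts. *)
Definition smooth_from_phase {R : realType} (U : set (phase R))
    (f : phase R -> 'rV[R]_(2 + 2)) : Prop :=
  smooth_on (phase_cover @^-1` U) (f \o phase_cover).

Definition smooth_to_phase {R : realType} (V : set 'rV[R]_(2 + 2))
    (g : 'rV[R]_(2 + 2) -> phase R) : Prop :=
  forall x, V x -> exists W h,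
    [/\ open W, W x, smooth_on W h
      & forall y, W y -> g y = phase_cover (h y)].

(* Smoothness on a set that is not open means the existence of a smooth
   extension to an open neighbourhood. At points of A that are limits of
   interior points, the differential of f does not depend on the extension. *)
Definition symplectomorphism {R : realType} (A : set (phase R))
    (B : set 'rV[R]_(2 + 2)) (f : phase R -> 'rV[R]_(2 + 2)) : Prop :=
  [/\ set_bij A B f,
      exists U, [/\ open U, A `<=` U & smooth_from_phase U f],
      exists g V, [/\ open V, B `<=` V, smooth_to_phase V g
                    & forall z, A z -> g (f z) = z]
    & forall x, A (phase_cover x) -> forall u v,
        omega ('d (f \o phase_cover) x u) ('d (f \o phase_cover) x v) = omega u v].

(* A nonempty connected subset of the orthant without lower-dimensional parts;
   it may be relatively open in the orthant, or closed. *)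
Definition orthant_domain {R : realType} n (Omega : set 'rV[R]_n) : Prop :=
  [/\ Omega `<=` [set x | forall i, 0 <= x 0 i], Omega !=set0,
      connected Omega & Omega `<=` closure Omega°].

Definition toric_domain {R : realType} n (Omega : set 'rV[R]_n) :
    set 'rV[R]_(n + n) :=
  [set z | Omega (\row_i (pi * (xcoord z i ^+ 2 + ycoord z i ^+ 2)))].

Definition hat {R : realType} n (Omega : set 'rV[R]_n) : set 'rV[R]_n :=
  [set x | Omega (\row_i `|x 0 i|)].

Definition convex_toric_domain {R : realType} n (X : set 'rV[R]_(n + n)) : Prop :=
  exists Omega : set 'rV[R]_n,
    [/\ orthant_domain Omega, X = toric_domain Omega,
        compact (hat Omega) & @convex_set R 'rV[R]_n (hat Omega)].

Definition arises_as_boundary {R : realType} (m1 m2 c : R)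
    (S : set (phase R)) (X : set 'rV[R]_(2 + 2)) : Prop :=
  exists D, [/\ is_component (sublevel m1 m2 c) D, compact D, boundary D = S
    & exists2 f, symplectomorphism D X f & f @` S = boundary X].

(* Main.v *)
Require Import Defs.
From HB Require Import structures.
From mathcomp Require Import all_boot all_order all_algebra.
From mathcomp Require Import all_classical all_reals all_analysis.
From mathcomp Require Import ring lra.
Import Order.TTheory GRing.Theory Num.Theory.
Import numFieldNormedType.Exports.
Local Open Scope classical_set_scope.
Local Open Scope ring_scope.
Set Implicit Arguments.
Unset Strict Implicit.
Unset Printing Implicit Defensive.

(** The regularized Hamiltonian is separated. With a = - c / 4, w = cosh mu - 1 and
    w = 1 + cos nu respectively, its two parts are p ^ 2 / 2 + w * (b + sg * a * w),
    sg = 1 for mu and sg = - 1 for nu, up to constants, and near e both are single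
    wells with bottom w = 0. The proof makes this into explicit action coordinates.

    Local picture. The coordinate X with X ^ 2 / 2 equal to the potential turns each
    part into (X ^ 2 + p ^ 2) / 2, and the symplectic form into rt (X ^ 2) dX dp for
    a positive density rt. In such a plane the discs centered at 0 are invariant,
    and their areas have half the period as derivative with respect to the squared
    radius. Stretching radii to preserve areas and turning circles to make time an
    angle gives a symplectic map to the standard plane that is smooth at the origin
    (act_norm, act_symplectic); no action-angle theorem is used. The product of two
    such maps takes the component of the sublevel set at e onto the toric domain
    over the set of (x1, x2) with x1 <= A1 (e1), x2 <= A2 (e2) for some energies
    e1, e2 >= 0 with e1 + e2 <= m1, where A1, A2 are the areas as functions of the
    energies (phase_map_symplectomorphism). The inverse is smooth because
    the inverse of a symplectic differential is given by a polynomial formula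
    (inverse_smooth).

    Isolation. For c < - m1 - m2 the potential of nu exceeds m1 at some w < 2, that
    is before the other center (barrier). The level w is a wall which the sublevel
    set does not meet; it cuts out a compact ball, a component of the sublevel set,
    whose boundary sphere is the component of the energy surface
    (ball_component, sphere_component, boundary_ball_at_e).

    Convexity. The toric domain is convex as soon as its profile curve
    (A1 (e), A2 (m1 - e)) is concave, that is, as soon as the ratio
    T2 (m1 - e) / T1 (e) of the periods is nondecreasing in e
    (convex_toric_under). A substitution tan ph = k * tan th with varying k turns
    both periods into the same complete elliptic integral (period_elliptic).
    On the line e1 + e2 = m1 the two wells have the same separation constant q, and
    the periods are the functions ell_period sigma q for two parameters sigma with
    the one of nu at least the one of mu. Their logarithmic derivatives in q are
    compared by means of two monotone quantities built from the logarithmic slope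
    of the elliptic integral: one is a consequence of the Cauchy-Schwarz inequality,
    the other of the differential equation of elliptic integrals
    (ell_period_ratio). The condition m2 <= 0 is what orders the two parameters
    sigma and keeps the modulus of nu at most 1. *)

(** * Smooth maps between normed spaces *)

Section Frechet.
Context {R : realType}.

(** Remainders of parametric integrals and of inverse maps are estimated by
    inequalities of this kind; this is their link with differentiability. *)
Lemma differentiable_lin_approx (V W : normedModType R) (f : V -> W) (x : V)
    (L : {linear V -> W}) : continuous L ->
  (forall e, 0 < e -> \forall h \near (0 : V),
     `|f (x + h) - f x - L h| <= e * `|h|) ->
  differentiable f x /\ 'd f x = L :> (V -> W).
Proof.
move=> cL H.
have E : f \o shift x = cst (f x) + L +o_ (0 : V) id.
  apply/eqaddoP => e e0; near=> h.
  rewrite /= !fctE /= opprD addrA (addrC h x).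
  near: h; exact: H.
have dL := diff_unique cL E.
by split=> //; apply/diff_locallyP; rewrite dL; split.
Unshelve. all: by end_near. Qed.

Lemma lin_approx (V W : normedModType R) (f : V -> W) (x : V) :
  differentiable f x ->
  forall e, 0 < e -> \forall h \near (0 : V),
     `|f (x + h) - f x - 'd f x h| <= e * `|h|.
Proof.
move=> /diff_locallyP[_ /eqaddoP E] e e0.
have := E e e0; apply: filterS => h /=.
by rewrite !fctE /= opprD addrA (addrC h x).
Qed.

Lemma near_eq_differentiable (V W : normedModType R) (f g : V -> W) (x : V) :
  (\near x, f x = g x) -> differentiable f x -> differentiable g x.
Proof.
move=> fg df; have [] // : differentiable g x /\ 'd g x = 'd f x :> (V -> W).
apply: differentiable_lin_approx; first exact: diff_continuous.
move=> e e0.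
have fgx : f x = g x by exact: nbhs_singleton fg.
have {}fg := (nbhs0P _ x).1 fg.
near=> h.
by rewrite -fgx -(near fg h)//; near: h; exact: lin_approx.
Unshelve. all: by end_near. Qed.

End Frechet.

Section CkTheory.
Context {R : realType}.
Implicit Types V W : normedModType R.

(** Directional derivatives at a point only see the germ of the map, so on an
    open set the class depends on the values there; every rule below replaces a
    derivative by its closed formula through this lemma. *)
Lemma Ck_ext V W k (U : set V) (f g : V -> W) : open U ->
  (forall x, U x -> f x = g x) -> Ck k U f -> Ck k U g.
Proof.
move=> oU; elim: k f g => [|k IH] f g fg /=.
  move=> cf x Ux; suff : g @ x --> g x by [].
  rewrite -(fg _ Ux); apply: cvg_trans (cf x Ux); apply: near_eq_cvg.
  by apply: filterS fg _; exact: open_nbhs_nbhs.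
move=> [df Cf].
have nfg x : U x -> \near x, f x = g x.
  by move=> Ux; apply: filterS fg _; exact: open_nbhs_nbhs.
split=> [x Ux|v]; first exact: near_eq_differentiable (nfg x Ux) (df x Ux).
by apply: IH (Cf v) => x Ux; apply: near_eq_derive; exact: nfg.
Qed.

Lemma Ck_sub V W k (U U' : set V) (f : V -> W) : U' `<=` U ->
  Ck k U f -> Ck k U' f.
Proof.
move=> sU; elim: k f => [|k IH] f /=.
  by move=> H x /sU; exact: H.
by move=> [df Cf]; split=> [x /sU|v]; [exact: df|exact: IH].
Qed.

Lemma Ck_lower V W k (U : set V) (f : V -> W) : Ck k.+1 U f -> Ck k U f.
Proof.
elim: k f => [|k IH] f /=.
  by move=> [df _] x Ux; apply: differentiable_continuous; exact: df.
by move=> [df Cf]; split=> // v; apply: IH; exact: Cf.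
Qed.

Lemma Ck_cst V W k (U : set V) (w : W) : Ck k U (fun=> w).
Proof.
elim: k w => [|k IH] w /=; first by move=> x _; exact: cst_continuous.
split=> [x _|v]; first exact: differentiable_cst.
rewrite (_ : 'D_v _ = fun=> 0); first exact: IH.
by apply/funext => x; rewrite derive_cst.
Qed.

Lemma CkD V W k (U : set V) (f g : V -> W) : open U ->
  Ck k U f -> Ck k U g -> Ck k U (fun x => f x + g x).
Proof.
move=> oU; elim: k f g => [|k IH] f g /=.
  by move=> cf cg x Ux; apply: continuousD; [exact: cf|exact: cg].
move=> [df Cf] [dg Cg]; split=> [x Ux|v].
  by apply: differentiableD; [exact: df|exact: dg].
apply: Ck_ext (IH _ _ (Cf v) (Cg v)) => // x Ux.
by rewrite deriveD//; apply/diff_derivable; [exact: df|exact: dg].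
Qed.

Lemma CkM V k (U : set V) (f g : V -> R) : open U ->
  Ck k U f -> Ck k U g -> Ck k U (fun x => f x * g x).
Proof.
move=> oU; elim: k f g => [|k IH] f g.
  by move=> cf cg x Ux; apply: continuousM; [exact: cf|exact: cg].
move=> Cf Cg; have Cf' := Ck_lower Cf; have Cg' := Ck_lower Cg.
move: Cf Cg => /= [df Cf] [dg Cg]; split=> [x Ux|v].
  by apply: differentiableM; [exact: df|exact: dg].
have C1 := CkD oU (IH _ _ Cf' (Cg v)) (IH _ _ Cg' (Cf v)).
apply: Ck_ext C1 => // x Ux.
by rewrite deriveM//; apply/diff_derivable; [exact: df|exact: dg].
Qed.

Lemma Ck_scale V W k (U : set V) (f : V -> R) (w : W) : open U ->
  Ck k U f -> Ck k U (fun x => f x *: w).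
Proof.
move=> oU; elim: k f => [|k IH] f.
  by move=> cf x Ux; apply: continuousZr_tmp; exact: cf.
move=> [df Cf]; split=> [x Ux|v]; first by apply: differentiableZl; exact: df.
apply: Ck_ext (IH _ (Cf v)) => // x Ux.
have dfx := df x Ux.
by rewrite !deriveE ?diffZl//; exact: differentiableZl.
Qed.

Lemma Ck_sum V W k (U : set V) n (f : 'I_n -> V -> W) : open U ->
  (forall i, Ck k U (f i)) -> Ck k U (fun x => \sum_i f i x).
Proof.
move=> oU; elim: n f => [|n IH] f Cf.
  by under eq_fun do rewrite big_ord0; exact: Ck_cst.
under eq_fun do rewrite big_ord_recl.
by apply: CkD => //; apply: IH.
Qed.

Lemma Ck_row V k (U : set V) n (f : V -> 'rV[R]_n) : open U ->
  (forall i, Ck k U (fun x => f x 0 i)) -> Ck k U f.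
Proof.
move=> oU Cf.
rewrite (_ : f = fun x => \sum_i f x 0 i *: delta_mx 0 i); last first.
  by apply/funext => x; exact: row_sum_delta.
by apply: Ck_sum => // i; exact: Ck_scale.
Qed.

Lemma derive_comp_row V n (F : 'rV[R]_n -> R) (g : V -> 'rV[R]_n) x v :
  differentiable g x -> differentiable F (g x) ->
  'D_v (F \o g) x = \sum_i ('D_v g x) 0 i * 'D_(delta_mx 0 i) F (g x).
Proof.
move=> dg dF; have dc := differentiable_comp dg dF.
rewrite (deriveE v dc) (diff_comp dg dF) /= -(deriveE v dg).
rewrite {1}(row_sum_delta ('D_v g x)) raddf_sum.
apply: eq_bigr => i _; rewrite (deriveE _ dF).
exact: (linearZ_LR ('d F (g x)) (('D_v g x) 0 i) (delta_mx 0 i)).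
Qed.

Lemma derive_coord V n (g : V -> 'rV[R]_n) x v i :
  differentiable g x -> ('D_v g x) 0 i = 'D_v (fun y => g y 0 i) x.
Proof.
move=> dg; rewrite derive_mx ?mxE//; exact: diff_derivable.
Qed.

Lemma Ck_coord V k (U : set V) n (f : V -> 'rV[R]_n) i : open U ->
  Ck k U f -> Ck k U (fun x => f x 0 i).
Proof.
move=> oU; elim: k f => [|k IH] f.
  move=> cf x Ux; apply: (@continuous_comp _ _ _ f (fun M => M 0 i)).
    exact: cf.
  exact: coord_continuous.
move=> [df Cf]; split=> [x Ux|v].
  apply: (@differentiable_comp _ _ _ _ f (fun M => M 0 i)); first exact: df.
  exact: differentiable_coord.
by apply: Ck_ext (IH _ (Cf v)) => // x Ux; rewrite derive_coord//; exact: df.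
Qed.

(** By induction on k: a directional derivative of the composite is a sum of
    products of derivatives of the entries of g with partial derivatives of F
    composed with g, and only the regularity k of g is needed for the latter. *)
Lemma Ck_comp_row V k n (U : set V) (U' : set 'rV[R]_n) (F : 'rV[R]_n -> R)
    (g : V -> 'rV[R]_n) : open U -> (forall x, U x -> U' (g x)) ->
  Ck k U' F -> Ck k U g -> Ck k U (F \o g).
Proof.
move=> oU gU; elim: k F => [|k IH] F.
  by move=> CF Cg x Ux; apply: continuous_comp; [exact: Cg|apply/CF/gU].
move=> CF Cg; have Cg' := Ck_lower Cg.
move: CF Cg => [dF CF] [dg Cg]; split=> [x Ux|v].
  by apply: differentiable_comp; [exact: dg|apply/dF/gU].
apply: (@Ck_ext _ _ _ _
  (fun x => \sum_i ('D_v g x) 0 i * 'D_(delta_mx 0 i) F (g x))) => //.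
  by move=> x Ux; rewrite derive_comp_row//; [exact: dg|apply/dF/gU].
apply: Ck_sum => // i; apply: CkM => //; first by apply: Ck_coord; [|exact: Cg].
exact: IH (CF (delta_mx 0 i)) Cg'.
Qed.

Lemma derive_comp_scalar V (F : R -> R) (g : V -> R) x v :
  differentiable g x -> differentiable F (g x) ->
  'D_v (fun y => F (g y)) x = 'D_v g x * 'D_1 F (g x).
Proof.
move=> dg dF.
have dc := differentiable_comp dg dF.
have -> : 'D_1 F (g x) = 'd F (g x) 1 by rewrite deriveE.
have -> : 'D_v (fun y => F (g y)) x = 'd (F \o g) x v.
  exact: (deriveE v dc).
have -> : 'D_v g x = 'd g x v by exact: (deriveE v dg).
have -> : 'd (F \o g) x v = 'd F (g x) ('d g x v).
  by have -> := diff_comp dg dF.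
rewrite -[X in 'd F _ X = _]mulr1.
exact: (linearZ_LR ('d F (g x)) ('d g x v) 1).
Qed.

Lemma Ck_comp V k (U : set V) (U' : set R) (F : R -> R) (g : V -> R) :
  open U -> (forall x, U x -> U' (g x)) ->
  Ck k U' F -> Ck k U g -> Ck k U (fun x => F (g x)).
Proof.
move=> oU gU; elim: k F => [|k IH] F.
  move=> CF Cg x Ux; apply: (@continuous_comp _ _ _ g F); first exact: Cg.
  by apply/CF/gU.
move=> CF Cg; have Cg' := Ck_lower Cg.
move: CF Cg => [dF CF] [dg Cg]; split=> [x Ux|v].
  by apply: (@differentiable_comp _ _ _ _ g F); [exact: dg|apply/dF/gU].
apply: (@Ck_ext _ _ _ _ (fun x => 'D_v g x * 'D_1 F (g x))) => //.
  by move=> x Ux; rewrite (derive_comp_scalar v (dg _ Ux) (dF _ (gU _ Ux))).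
by apply: CkM => //; [exact: Cg|exact: IH (CF 1) Cg'].
Qed.

End CkTheory.

(** * Calculus on a segment *)

Section OneVariable.
Context {R : realType}.
Implicit Types (f g F : R -> R) (a b k s t x y : R).

Lemma is_derive_continuous f (x df : R) : is_derive x 1 f df ->
  {for x, continuous f}.
Proof. by move=> [/derivable1_diffP d _]; exact: differentiable_continuous. Qed.

(** Continuity is two-sided at the end points too, so that compositions need no
    relative topology. *)
Definition cont_on (a b : R) f := forall s, a <= s <= b -> {for s, continuous f}.

Lemma cont_on_within a b f : cont_on a b f -> {within `[a, b], continuous f}.
Proof.
move=> cf; apply/continuous_in_subspaceT => s.
by rewrite inE /= in_itv/=; exact: cf.
Qed.

Lemma mean_value a b f (df : R -> R) : a <= b ->
  (forall s : R, a <= s <= b -> is_derive s 1 f (df s)) ->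
  exists2 s, a <= s <= b & f b - f a = df s * (b - a).
Proof.
move=> ab d; have [s|s|s] := @MVT_segment R f df a b ab.
- by rewrite in_itv/= => /andP[/ltW h /ltW h']; apply: d; rewrite h.
- by apply: cont_on_within => t /d; exact: is_derive_continuous.
- by rewrite in_itv/=; exists s.
Qed.

Lemma nondecr_of_deriv a b f (df : R -> R) : a <= b ->
  (forall s : R, a <= s <= b -> is_derive s 1 f (df s)) ->
  (forall s : R, a <= s <= b -> 0 <= df s) -> f a <= f b.
Proof.
move=> ab d d0; have [s sab e] := mean_value ab d.
by rewrite -subr_ge0 e mulr_ge0 ?subr_ge0//; exact: d0.
Qed.

Lemma incr_of_deriv a b f (df : R -> R) : a < b ->
  (forall s : R, a <= s <= b -> is_derive s 1 f (df s)) ->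
  (forall s : R, a <= s <= b -> 0 < df s) -> f a < f b.
Proof.
move=> ab d d0; have [s sab e] := mean_value (ltW ab) d.
by rewrite -subr_gt0 e mulr_gt0 ?subr_gt0//; exact: d0.
Qed.

Definition segint (a b : R) f : R := \int[lebesgue_measure]_(s in `[a, b]) f s.

Lemma cont_on_integrable a b f : cont_on a b f ->
  lebesgue_measure.-integrable `[a, b] (EFin \o f).
Proof.
move=> cf; apply: continuous_compact_integrable; first exact: segment_compact.
exact: cont_on_within.
Qed.

Lemma eq_segint a b f g : (forall s : R, a <= s <= b -> f s = g s) -> segint a b f = segint a b g.
Proof.
by move=> fg; apply: eq_Rintegral => s; rewrite inE /= in_itv/=; exact: fg.
Qed.

Lemma segintZ a b f k : cont_on a b f -> segint a b (fun s => k * f s) = k * segint a b f.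
Proof. by move=> cf; rewrite /segint RintegralZl//; exact: cont_on_integrable. Qed.

Lemma segintD a b f g : cont_on a b f -> cont_on a b g ->
  segint a b (fun s => f s + g s) = segint a b f + segint a b g.
Proof. by move=> cf cg; rewrite /segint RintegralD//; apply: cont_on_integrable. Qed.

Lemma segintB a b f g : cont_on a b f -> cont_on a b g ->
  segint a b (fun s => f s - g s) = segint a b f - segint a b g.
Proof. by move=> cf cg; rewrite /segint RintegralB//; apply: cont_on_integrable. Qed.

Lemma le_segint a b f g : cont_on a b f -> cont_on a b g ->
  (forall s : R, a <= s <= b -> f s <= g s) -> segint a b f <= segint a b g.
Proof.
by move=> cf cg fg; apply: le_Rintegral => //; apply: cont_on_integrable.
Qed.

Lemma segint_cst a b k : a <= b -> segint a b (fun=> k) = k * (b - a).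
Proof.
move=> ab; rewrite /segint Rintegral_cst//= lebesgue_measure_itv/= lte_fin.
case: ltP => // ba; have -> : a = b by apply/le_anti; rewrite ab.
by rewrite subrr.
Qed.

Lemma norm_segint_le a b f k : a <= b -> cont_on a b f ->
  (forall s : R, a <= s <= b -> `|f s| <= k) -> `|segint a b f| <= k * (b - a).
Proof.
move=> ab cf fk; rewrite -segint_cst//.
apply: le_trans (le_normr_Rintegral _ _) _ => //.
  exact: cont_on_integrable.
apply: le_segint => //; last by move=> s _; exact: cst_continuous.
move=> s /cf cs; apply: continuous_comp cs _; exact: norm_continuous.
Qed.

Lemma segint_ge0 a b f : (forall s : R, a <= s <= b -> 0 <= f s) -> 0 <= segint a b f.
Proof.
by move=> f0; apply: Rintegral_ge0 => s /=; rewrite in_itv/=; exact: f0.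
Qed.

Lemma segint_gt0 a b f : a < b -> cont_on a b f ->
  (forall s : R, a <= s <= b -> 0 < f s) -> 0 < segint a b f.
Proof.
move=> ab cf f0; have [s] := EVT_min (ltW ab) (cont_on_within cf).
rewrite in_itv/= => sab H; apply: (@lt_le_trans _ _ (segint a b (fun=> f s))).
  by rewrite segint_cst ?(ltW ab)// mulr_gt0 ?subr_gt0// f0.
by apply: le_segint => // ? _; exact: cst_continuous.
Qed.

Lemma segint_FTC a b F f : a < b -> cont_on a b f ->
  (forall s : R, a <= s <= b -> is_derive s 1 F (f s)) -> segint a b f = F b - F a.
Proof.
move=> ab cf dF; rewrite /segint /Rintegral (@continuous_FTC2 R f F)//.
- exact: cont_on_within.
- have cF s : a <= s <= b -> F @ s --> F s.
    by move=> /dF /is_derive_continuous.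
  split=> [s||].
  + by rewrite in_itv/= => /andP[/ltW h /ltW h']; have [] := dF s; rewrite ?h.
  + by apply: cvg_at_right_filter; apply: cF; rewrite lexx ltW.
  + by apply: cvg_at_left_filter; apply: cF; rewrite lexx ltW.
- move=> s; rewrite in_itv/= => /andP[/ltW h /ltW h'].
  by rewrite derive1E; have [|_ ->] := dF s; rewrite ?h.
Qed.

End OneVariable.

(** * Derivatives and smoothness of elementary functions *)

Section DerivCombinators.
Context {R : realType} {V : normedModType R}.
Implicit Types (f g : V -> R) (x v : V) (a b : R).

(** These rules are stated on pointwise expressions, so that derivatives of
    long formulas can be assembled by application. *)
Lemma is_deriveD_fun f g x v a b : is_derive x v f a -> is_derive x v g b ->
  is_derive x v (fun y => f y + g y) (a + b).
Proof. exact: is_deriveD. Qed.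

Lemma is_deriveB_fun f g x v a b : is_derive x v f a -> is_derive x v g b ->
  is_derive x v (fun y => f y - g y) (a - b).
Proof. exact: is_deriveB. Qed.

Lemma is_deriveM_fun f g x v a b : is_derive x v f a -> is_derive x v g b ->
  is_derive x v (fun y => f y * g y) (f x * b + g x * a).
Proof. exact: is_deriveM. Qed.

Lemma is_deriveZ_fun f x v a k : is_derive x v f a ->
  is_derive x v (fun y => k * f y) (k * a).
Proof.
move=> df; apply: is_derive_eq (is_deriveM_fun (is_derive_cst k x v) df) _.
by rewrite mulr0 addr0.
Qed.

Lemma is_deriveV_fun f x v a : is_derive x v f a -> f x != 0 ->
  is_derive x v (fun y => (f y)^-1) (- a / (f x) ^+ 2).
Proof.
move=> [df <-] f0; split; first exact: derivableV.
by rewrite deriveV// scaleNr mulNr mulrC.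
Qed.

End DerivCombinators.

Lemma is_derive_comp_fun {R : realType} (f g : R -> R) (x a b : R) :
  is_derive (g x) 1 f a -> is_derive x 1 g b ->
  is_derive x 1 (fun y => f (g y)) (a * b).
Proof. exact: is_derive1_comp. Qed.

Section SmoothScalars.
Context {R : realType}.
Implicit Types (x v df : R).

Lemma derivable_differentiable (f : R -> R) x df : is_derive x 1 f df ->
  differentiable f x.
Proof. by move=> [/derivable1_diffP]. Qed.

Lemma derive_scale_dir (f : R -> R) x v : differentiable f x ->
  'D_v f x = v * 'D_1 f x.
Proof.
move=> df; have := @derive_comp_scalar R R f id x v _ df.
by rewrite derive_id; apply; exact: ex_diff.
Qed.

(** On the line every directional derivative is a multiple of one derivative. *)
Lemma Ck_of_deriv k (U : set R) (f df : R -> R) : open U ->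
  (forall x : R, U x -> is_derive x 1 f (df x)) -> Ck k U df -> Ck k.+1 U f.
Proof.
move=> oU d Cdf; have dif x : U x -> differentiable f x.
  by move=> /d /derivable_differentiable.
split=> // v; apply: (@Ck_ext _ _ _ _ _ (fun x => v * df x)) => //.
  by move=> x Ux; rewrite (derive_scale_dir _ (dif _ Ux)); case: (d x Ux) => _ <-.
by apply: CkM => //; exact: Ck_cst.
Qed.

Lemma Ck0_of_deriv (U : set R) (f df : R -> R) : 
  (forall x : R, U x -> is_derive x 1 f (df x)) -> Ck 0 U f.
Proof. by move=> d x /d /is_derive_continuous. Qed.

Lemma smooth_inv : smooth_on [set x : R | x != 0] (fun x => x^-1).
Proof.
have oU : open [set x : R | x != 0].
  rewrite (_ : mkset _ = ~` [set 0]); last first.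
    by apply/seteqP; split=> x /= /eqP.
  exact/closed_openC/closed_eq.
have d x : [set x : R | x != 0] x ->
    is_derive x 1 (fun x => x^-1) (- (x^-1 * x^-1)).
  move=> /= x0; apply: is_derive_eq; first exact: (@is_deriveV R id x 1 1).
  by rewrite scaleNr [_ *: 1]mulr1 expr2 invfM.
elim=> [|k IH]; first exact: Ck0_of_deriv d.
apply: Ck_of_deriv d _ => //.
rewrite (_ : (fun x => _) = fun x : R => -1 * (x^-1 * x^-1)); last first.
  by apply/funext => x; rewrite mulN1r.
by apply: CkM => //; [exact: Ck_cst|exact: CkM].
Qed.

Lemma smooth_sqrt : smooth_on [set x : R | 0 < x] Num.sqrt.
Proof.
have oU : open [set x : R | 0 < x] by exact: open_gt.
have d x : [set x : R | 0 < x] x -> is_derive x 1 Num.sqrt (2 * Num.sqrt x)^-1.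
  by move=> /= x0; exact: is_derive1_sqrt.
elim=> [|k IH]; first exact: Ck0_of_deriv d.
apply: Ck_of_deriv d _ => //.
apply: (@Ck_comp _ _ _ _ [set x : R | x != 0] (fun x => x^-1) (fun x => 2 * Num.sqrt x)) => //.
- by move=> x /= x0; rewrite gt_eqF// mulr_gt0// sqrtr_gt0.
- exact: smooth_inv.
- by apply: CkM => //; exact: Ck_cst.
Qed.

Lemma Ck_cos_sin k : Ck k setT (@cos R) /\ Ck k setT (@sin R).
Proof.
elim: k => [|k [IHc IHs]].
  by split=> x _; [exact: continuous_cos|exact: continuous_sin].
split.
- apply: (@Ck_of_deriv _ _ _ (fun x => - sin x) openT (fun x _ => is_derive_cos x)).
  rewrite (_ : (fun x => _) = fun x : R => -1 * sin x); last first.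
    by apply/funext => x; rewrite mulN1r.
  exact: CkM openT (Ck_cst _ _ _) IHs.
- exact: (@Ck_of_deriv _ _ _ cos openT (fun x _ => is_derive_sin x)).
Qed.

Lemma smooth_expR : smooth_on setT (@expR R).
Proof.
elim=> [|k IH]; first by move=> x _; exact: continuous_expR.
exact: (@Ck_of_deriv _ _ _ expR openT (fun x _ => is_derive_expR x)).
Qed.

End SmoothScalars.

(** * Differentiation under the integral sign *)

Section LinApprox.
Context {R : realType}.

Lemma differentiable_of_linear (V : normedModType R) (f L : V -> R) (x : V) C :
  (forall k u v, L (k *: u + v) = k * L u + L v) ->
  (forall h, `|L h| <= C * `|h|) ->
  (forall e, 0 < e -> \forall h \near (0 : V),
     `|f (x + h) - f x - L h| <= e * `|h|) ->
  differentiable f x /\ forall v, 'D_v f x = L v.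
Proof.
move=> linL bL H.
have lL : linear L by move=> k u v; exact: linL.
pose L' : {linear V -> R} := HB.pack L (GRing.isLinear.Build _ _ _ _ L lL).
have cL : continuous L'.
  apply/bounded_linear_continuous/linear_boundedP.
  have : \forall r \near +oo, C <= r by apply: nbhs_pinfty_ge; exact: num_real.
  apply: filterS => r Cr h; apply: le_trans (bL h) _.
  by rewrite ler_wpM2r.
have [df dL] := @differentiable_lin_approx R V R f x L' cL H.
by split=> // v; rewrite deriveE// dL.
Qed.

Lemma mean_value_sym (f df : R -> R) (x y : R) :
  (forall s, (x <= s <= y) || (y <= s <= x) -> is_derive s 1 f (df s)) ->
  exists2 s, (x <= s <= y) || (y <= s <= x) & f y - f x = df s * (y - x).
Proof.
case: (leP x y) => xy d.
  have [|s sxy e] := @mean_value _ x y f df xy; last by exists s; rewrite ?sxy.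
  by move=> s sxy; apply: d; rewrite sxy.
have [|s sxy e] := @mean_value _ y x f df (ltW xy).
  by move=> s sxy; apply: d; rewrite sxy orbT.
exists s; first by rewrite sxy orbT.
by rewrite -opprB e -mulrN opprB.
Qed.

Lemma smooth_is_derive (V : normedModType R) (U : set V) (f : V -> R) x v :
  smooth_on U f -> U x -> is_derive x v f ('D_v f x).
Proof.
move=> sf Ux; apply: derivableP; apply: diff_derivable.
by have [d _] := sf 1; exact: d.
Qed.

Lemma smooth_D (V W : normedModType R) (U : set V) (f : V -> W) v :
  smooth_on U f -> smooth_on U ('D_v f).
Proof. by move=> sf k; have [_] := sf k.+1; exact. Qed.

Lemma smooth_cont (V W : normedModType R) (U : set V) (f : V -> W) x :
  smooth_on U f -> U x -> {for x, continuous f}.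
Proof. by move=> sf Ux; exact: (sf 0%N). Qed.

Lemma between_dist (y h s : R) : (y <= s <= y + h) || (y + h <= s <= y) ->
  `|s - y| <= `|h|.
Proof.
rewrite ler_norml; have := ler_norm h; have := ler_norm (- h).
by rewrite normrN => ? ? /orP[] /andP[? ?]; apply/andP; split; lra.
Qed.

Lemma between_between (y h s t : R) : (y <= s <= y + h) || (y + h <= s <= y) ->
  (y <= t <= s) || (s <= t <= y) -> (y <= t <= y + h) || (y + h <= t <= y).
Proof.
case/orP=> /andP[s1y s2y] /orP[] /andP[t1y t2y].
- by apply/orP; left; lra.
- by apply/orP; left; lra.
- by apply/orP; right; lra.
- by apply/orP; right; lra.
Qed.

Lemma norm_remainder_le (A B h K : R) : `|A| <= K -> `|B| <= `|h| ->
  `|A * B * h| <= K * `|h| ^+ 2.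
Proof.
move=> AK Bh; rewrite !normrM expr2 mulrA; apply: ler_wpM2r => //.
exact: ler_pM.
Qed.

(** A slightly larger segment is still contained in the open set J, and the
    second derivative is bounded on it; applying the mean value theorem twice
    bounds the remainder by a constant that does not depend on the base point. *)
Lemma uniform_taylor (J : set R) (phi : R -> R) (p q : R) :
  open J -> p <= q -> (forall t, p <= t <= q -> J t) -> smooth_on J phi ->
  exists2 eta, 0 < eta & exists2 M, 0 <= M &
    forall y h, p <= y <= q -> `|h| <= eta ->
    `|phi (y + h) - phi y - h * 'D_1 phi y| <= M * `|h| ^+ 2.
Proof.
move=> oJ pq pqJ sphi.
have Jnear t : J t -> exists2 d, 0 < d & forall u, `|t - u| < d -> J u.
  move=> Jt; have /nbhs_ballP[d d0 H] := open_nbhs_nbhs (conj oJ Jt).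
  by exists d => // u tu; apply: H.
have [d1 d10 H1] : exists2 d : R, 0 < d & forall u, `|p - u| < d -> J u.
  by apply/Jnear/pqJ; rewrite lexx.
have [d2 d20 H2] : exists2 d : R, 0 < d & forall u, `|q - u| < d -> J u.
  by apply/Jnear/pqJ; rewrite lexx andbT.
pose eta := Num.min d1 d2 / 2.
have eta0 : 0 < eta by rewrite divr_gt0// lt_min d10.
have etad1 : eta < d1 by rewrite ltr_pdivrMr// gt_min; lra.
have etad2 : eta < d2 by rewrite ltr_pdivrMr// gt_min; lra.
have JJ t : p - eta <= t <= q + eta -> J t.
  move=> tt; case: (ltP t p) => tp.
    by apply: H1; rewrite ltr_distlC; lra.
  case: (ltP q t) => qt; first by apply: H2; rewrite ltr_distlC; lra.
  by apply: pqJ; rewrite tp qt.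
pose phi1 : R -> R := 'D_1 phi; pose phi2 : R -> R := 'D_1 phi1.
have s1 : smooth_on J phi1 by exact: smooth_D.
have s2 : smooth_on J phi2 by exact: smooth_D.
have cphi2 : cont_on (p - eta) (q + eta) (fun t => `|phi2 t|).
  move=> t /JJ Jt; apply: continuous_comp; last exact: norm_continuous.
  exact: smooth_cont s2 Jt.
have le1 : p - eta <= q + eta by lra.
have [c _ Hc] := EVT_max le1 (cont_on_within cphi2).
exists eta => //; exists `|phi2 c| => // y h ypq heta.
have hh : - eta <= h <= eta by rewrite -ler_norml.
have b1 s : (y <= s <= y + h) || (y + h <= s <= y) -> p - eta <= s <= q + eta.
  by case/orP => /andP[? ?]; lra.
have [s sy e1] := @mean_value_sym phi phi1 y (y + h)
  (fun s sy => smooth_is_derive (1 : R) sphi (JJ _ (b1 s sy))).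
have b2 t := @between_between y h s t sy.
have [t ty e2] := @mean_value_sym phi1 phi2 y s
  (fun t ty => smooth_is_derive (1 : R) s1 (JJ _ (b1 t (b2 t ty)))).
have -> : phi (y + h) - phi y - h * 'D_1 phi y = phi2 t * (s - y) * h.
  by rewrite e1 -e2 /phi1; ring.
have tc : `|phi2 t| <= `|phi2 c| by apply: Hc; rewrite in_itv/=; exact/b1/b2.
have sh := between_dist sy.
exact: norm_remainder_le.
Qed.

End LinApprox.

Section ParametricIntegral.
Context {R : realType} {V : normedModType R}.
Variables (a b : R) (U : set V) (J : set R) (l m : R -> V -> R) (C : R).
Hypotheses (ab : a < b) (oU : open U) (oJ : open J).
Hypothesis lD : forall s x h, l s (x + h) = l s x + m s h.
Hypothesis mlin : forall s k u v, m s (k *: u + v) = k * m s u + m s v.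
Hypothesis C0 : 0 <= C.
Hypothesis mbnd : forall s h, a <= s <= b -> `|m s h| <= C * `|h|.
Hypothesis mcont : forall h, cont_on a b (m ^~ h).
Hypothesis lcont : forall x, cont_on a b (l ^~ x).
Hypothesis lJ : forall s x, a <= s <= b -> U x -> J (l s x).
Hypothesis Jitv : is_interval J.

(** The parameter enters through l s, affine with linear part m s. The class of
    such integrals is closed under differentiation: the derivative in the
    direction v multiplies the weight c by m s v and replaces phi by its
    derivative. Dilations and rotated linear forms are the instances needed. *)
Definition parint (c phi : R -> R) (x : V) := segint a b (fun s => c s * phi (l s x)).

Lemma parint_cont (c phi : R -> R) x : cont_on a b c -> smooth_on J phi -> U x ->
  cont_on a b (fun s => c s * phi (l s x)).
Proof.
move=> cc sphi Ux s sab; apply: continuousM; first exact: cc.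
apply: (@continuous_comp _ _ _ (l ^~ x) phi); first exact: lcont.
exact: (smooth_cont sphi (lJ sab Ux)).
Qed.

Lemma cont_onM (f g : R -> R) : cont_on a b f -> cont_on a b g ->
  cont_on a b (fun s => f s * g s).
Proof. by move=> cf cg s sab; apply: continuousM; [exact: cf|exact: cg]. Qed.

Lemma cont_onD (f g : R -> R) : cont_on a b f -> cont_on a b g ->
  cont_on a b (fun s => f s + g s).
Proof. by move=> cf cg s sab; apply: continuousD; [exact: cf|exact: cg]. Qed.

Lemma cont_onB (f g : R -> R) : cont_on a b f -> cont_on a b g ->
  cont_on a b (fun s => f s - g s).
Proof. by move=> cf cg s sab; apply: continuousB; [exact: cf|exact: cg]. Qed.

(** The image of the segment under l is a segment of J because J is an
    interval; the uniform Taylor estimate on it integrates to a quadratic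
    remainder. *)
Lemma parint_diff (c phi : R -> R) x : cont_on a b c -> smooth_on J phi -> U x ->
  differentiable (parint c phi) x /\
  forall v, 'D_v (parint c phi) x = parint (fun s => c s * m s v) ('D_1 phi) x.
Proof.
move=> cc sphi Ux.
have s1 : smooth_on J ('D_1 phi) by exact: smooth_D.
have cm v : cont_on a b (fun s => c s * m s v) by exact: cont_onM.
have ncont f : cont_on a b f -> cont_on a b (fun s => `|f s|).
  move=> cf s /cf cs; apply: continuous_comp cs _; exact: norm_continuous.
have [sc _ Hc] := EVT_max (ltW ab) (cont_on_within (ncont _ cc)).
have cphi1 : cont_on a b (fun s => 'D_1 phi (l s x)).
  move=> s sab; apply: (@continuous_comp _ _ _ (l ^~ x) ('D_1 phi)).
    exact: lcont.
  exact: (smooth_cont s1 (lJ sab Ux)).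
have [sp _ Hp] := EVT_max (ltW ab) (cont_on_within (ncont _ cphi1)).
have [s0 + H0] := EVT_min (ltW ab) (cont_on_within (@lcont x)).
have [s3 + H3] := EVT_max (ltW ab) (cont_on_within (@lcont x)).
rewrite !in_itv/= => s3ab s0ab.
have [eta eta0 [M M0 HM]] : exists2 eta, 0 < eta & exists2 M, 0 <= M &
    forall y h, l s0 x <= y <= l s3 x -> `|h| <= eta ->
    `|phi (y + h) - phi y - h * 'D_1 phi y| <= M * `|h| ^+ 2.
  apply: (@uniform_taylor _ J) => //; first by apply: H3; rewrite in_itv.
  move=> t; apply: Jitv; exact: lJ.
apply: (@differentiable_of_linear _ _ _ _ _
    (`|c sc| * C * `|'D_1 phi (l sp x)| * (b - a))).
- move=> k u v; pose g w s := c s * m s w * 'D_1 phi (l s x).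
  have cg w : cont_on a b (g w) := parint_cont (cm w) s1 Ux.
  rewrite -[in RHS]segintZ; last exact: cg.
  rewrite -segintD; [|by move=> s sab; apply: (@continuousM _ _ (fun=> k));
    [exact: cst_continuous|exact: cg]|exact: cg].
  by apply: eq_segint => s _; rewrite mlin /g; ring.
- move=> h; rewrite /parint -mulrA -mulrA mulrAC mulrA mulrA mulrAC.
  rewrite (_ : _ * `|h| = `|c sc| * (C * `|h|) * `|'D_1 phi (l sp x)| * (b - a));
    last by ring.
  apply: norm_segint_le; [exact: ltW|exact: (parint_cont (cm h) s1 Ux)|] => s sab.
  rewrite normrM normrM; apply: ler_pM => //; last by apply: Hp; rewrite in_itv.
  by apply: ler_pM => //; [apply: Hc; rewrite in_itv|exact: mbnd].
- move=> e e0.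
  pose K := `|c sc| * M * C ^+ 2 * (b - a).
  have K0 : 0 <= K by rewrite !mulr_ge0// ?exprn_ge0// subr_ge0 ltW.
  have C1 : 0 < C + 1 by exact: ltr_wpDl.
  have K1 : 0 < K + 1 by exact: ltr_wpDl.
  have nU : \forall h \near (0 : V), U (x + h).
    exact: ((nbhs0P U x).1 (open_nbhs_nbhs (conj oU Ux))).
  have n1 : \forall h \near (0 : V), `|h| < eta / (C + 1).
    by apply: nbhs0_lt; rewrite divr_gt0.
  have n2 : \forall h \near (0 : V), `|h| < e / (K + 1).
    by apply: nbhs0_lt; rewrite divr_gt0.
  near=> h.
  have Uxh : U (x + h) by near: h.
  have h1 : `|h| < eta / (C + 1) by near: h.
  have h2 : `|h| < e / (K + 1) by near: h.
  have p1 := parint_cont cc sphi Uxh; have p2 := parint_cont cc sphi Ux.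
  have p3 := parint_cont (cm h) s1 Ux; have p4 := cont_onB p1 p2.
  rewrite /parint -(segintB p1 p2) -(segintB p4 p3).
  apply: (@le_trans _ _ (`|c sc| * (M * (C * `|h|) ^+ 2) * (b - a))).
    apply: norm_segint_le; [exact: ltW|exact: cont_onB p4 p3|].
    move=> s sab.
    rewrite (_ : _ - _ = c s * (phi (l s x + m s h) - phi (l s x) - m s h * 'D_1 phi (l s x))); last by rewrite lD; ring.
    rewrite normrM; apply: ler_pM => //; first by apply: Hc; rewrite in_itv.
    have mh := mbnd h sab.
    apply: le_trans (HM _ _ _ _) _.
    + by rewrite H0 ?H3// in_itv.
    + apply: le_trans mh _; move: h1; rewrite ltr_pdivlMr// => h1.
      by apply: ltW; apply: le_lt_trans h1; rewrite mulrC ler_wpM2l// lerDl.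
    + by rewrite ler_wpM2l// lerXn2r// ?nnegrE// mulr_ge0.
  rewrite (_ : _ * (b - a) = K * `|h| * `|h|); last by rewrite /K; ring.
  rewrite ler_wpM2r//; move: h2; rewrite ltr_pdivlMr// => h2.
  by apply: ltW; apply: le_lt_trans h2; rewrite mulrC ler_wpM2l// lerDl.
Unshelve. all: by end_near. Qed.

(** The derivative is an integral of the same kind, hence the induction. *)
Lemma parint_smooth (c phi : R -> R) : cont_on a b c -> smooth_on J phi ->
  smooth_on U (parint c phi).
Proof.
move=> cc sphi k; elim: k c phi cc sphi => [|k IH] c phi cc sphi.
  by move=> x Ux; apply: differentiable_continuous; exact: (parint_diff cc sphi Ux).1.
split=> [x Ux|v]; first exact: (parint_diff cc sphi Ux).1.
have H := IH (fun s => c s * m s v) ('D_1 phi) (cont_onM cc (@mcont v)) (smooth_D (1 : R) sphi).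
by apply: Ck_ext H => // x Ux; rewrite (parint_diff cc sphi Ux).2.
Qed.

End ParametricIntegral.

(** * Combination rules for smooth maps *)

Section SmoothOn.
Context {R : realType}.
Implicit Types V W : normedModType R.

Lemma smooth_ext V W (U : set V) (f g : V -> W) : open U ->
  (forall x, U x -> f x = g x) -> smooth_on U f -> smooth_on U g.
Proof. by move=> oU fg sf k; exact: Ck_ext (sf k). Qed.

Lemma smooth_sub V W (U U' : set V) (f : V -> W) : U' `<=` U ->
  smooth_on U f -> smooth_on U' f.
Proof. by move=> sU sf k; exact: Ck_sub (sf k). Qed.

Lemma smooth_cst V W (U : set V) (w : W) : smooth_on U (fun=> w).
Proof. by move=> k; exact: Ck_cst. Qed.

Lemma smoothD V W (U : set V) (f g : V -> W) : open U ->
  smooth_on U f -> smooth_on U g -> smooth_on U (fun x => f x + g x).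
Proof. by move=> oU sf sg k; exact: CkD. Qed.

Lemma smoothM V (U : set V) (f g : V -> R) : open U ->
  smooth_on U f -> smooth_on U g -> smooth_on U (fun x => f x * g x).
Proof. by move=> oU sf sg k; exact: CkM. Qed.

Lemma smoothN V (U : set V) (f : V -> R) : open U ->
  smooth_on U f -> smooth_on U (fun x => - f x).
Proof.
move=> oU sf; apply: (@smooth_ext _ _ _ (fun x => -1 * f x)) => //.
  by move=> x _; rewrite mulN1r.
by apply: smoothM => //; exact: smooth_cst.
Qed.

Lemma smoothB V (U : set V) (f g : V -> R) : open U ->
  smooth_on U f -> smooth_on U g -> smooth_on U (fun x => f x - g x).
Proof. by move=> oU sf sg; apply: smoothD => //; exact: smoothN. Qed.

Lemma smoothX2 V (U : set V) (f : V -> R) : open U ->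
  smooth_on U f -> smooth_on U (fun x => f x ^+ 2).
Proof. by move=> oU sf; under eq_fun do rewrite expr2; exact: smoothM. Qed.

Lemma smooth_comp V (U : set V) (U' : set R) (F : R -> R) (g : V -> R) :
  open U -> (forall x, U x -> U' (g x)) ->
  smooth_on U' F -> smooth_on U g -> smooth_on U (fun x => F (g x)).
Proof. by move=> oU gU sF sg k; exact: Ck_comp (sF k) (sg k). Qed.

Lemma smooth_comp_row V n (U : set V) (U' : set 'rV[R]_n) (F : 'rV[R]_n -> R)
    (g : V -> 'rV[R]_n) : open U -> (forall x, U x -> U' (g x)) ->
  smooth_on U' F -> smooth_on U g -> smooth_on U (F \o g).
Proof. by move=> oU gU sF sg k; exact: Ck_comp_row (sF k) (sg k). Qed.

Lemma smooth_row V n (U : set V) (f : V -> 'rV[R]_n) : open U ->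
  (forall i, smooth_on U (fun x => f x 0 i)) -> smooth_on U f.
Proof. by move=> oU sf k; apply: Ck_row => // i; exact: sf. Qed.

Lemma smooth_id V (U : set V) : smooth_on U (fun x => x).
Proof.
case=> [x _|k]; first exact: cvg_id.
split=> [x _|v]; first exact: ex_diff.
rewrite (_ : 'D_v _ = fun=> v); first exact: Ck_cst.
by apply/funext => x; rewrite derive_id.
Qed.

Lemma smooth_coord n (U : set 'rV[R]_n) i : open U ->
  smooth_on U (fun z : 'rV[R]_n => z 0 i).
Proof. by move=> oU k; apply: (@Ck_coord _ _ _ _ _ id) => //; exact: smooth_id. Qed.

Lemma smoothV V (U : set V) (f : V -> R) : open U ->
  (forall x, U x -> f x != 0) -> smooth_on U f -> smooth_on U (fun x => (f x)^-1).
Proof.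
by move=> oU f0 sf; exact: (@smooth_comp _ _ _ (fun x => x^-1) f oU f0 (@smooth_inv R)).
Qed.

Lemma smooth_sqrt_comp V (U : set V) (f : V -> R) : open U ->
  (forall x, U x -> 0 < f x) -> smooth_on U f ->
  smooth_on U (fun x => Num.sqrt (f x)).
Proof.
by move=> oU f0 sf; exact: (@smooth_comp _ _ _ Num.sqrt f oU f0 (@smooth_sqrt R)).
Qed.

Lemma smooth_cos V (U : set V) (f : V -> R) : open U ->
  smooth_on U f -> smooth_on U (fun x => cos (f x)).
Proof.
move=> oU sf; apply: (@smooth_comp _ _ setT cos f) => // k.
by have [] := @Ck_cos_sin R k.
Qed.

Lemma smooth_sin V (U : set V) (f : V -> R) : open U ->
  smooth_on U f -> smooth_on U (fun x => sin (f x)).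
Proof.
move=> oU sf; apply: (@smooth_comp _ _ setT sin f) => // k.
by have [] := @Ck_cos_sin R k.
Qed.

End SmoothOn.

(** * Polar coordinates and angles *)
Section Primitive.
Context {R : realType}.

Lemma primitive (f : R -> R) (A B : R) : (forall s, {for s, continuous f}) ->
  exists G : R -> R, forall s, A < s < B -> is_derive s 1 G (f s).
Proof.
move=> cf; exists (fun s => segint A s f) => s /andP[As sB].
have [|//|//|d e] := @continuous_FTC1_closed R f A s B sB.
- by apply: cont_on_integrable => t _; exact: cf.
- by apply: DeriveDef; [exact: d|rewrite -derive1E; exact: e].
Qed.

Lemma polar (X p : R) : exists r t, [/\ 0 <= r, 0 <= t < 2 * pi,
  X = r * cos t & p = r * sin t].
Proof.
have pi0 := pi_gt0 R.
pose r := Num.sqrt (X ^+ 2 + p ^+ 2).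
have y0 : 0 <= X ^+ 2 + p ^+ 2 by rewrite addr_ge0 ?sqr_ge0.
have r2 : r ^+ 2 = X ^+ 2 + p ^+ 2 by rewrite sqr_sqrtr.
have r0 : 0 <= r by exact: sqrtr_ge0.
have [re|rn] := eqVneq r 0.
  exists 0, 0; rewrite !mul0r lexx; split=> //; first by lra.
    move: r2; rewrite re expr0n/= => /esym/eqP; rewrite paddr_eq0 ?sqr_ge0//.
    by rewrite sqrf_eq0 => /andP[/eqP].
  move: r2; rewrite re expr0n/= => /esym/eqP; rewrite paddr_eq0 ?sqr_ge0//.
  by rewrite !sqrf_eq0 => /andP[_ /eqP].
have rp : 0 < r by rewrite lt0r rn.
pose u := X / r.
have u2 : u ^+ 2 + (p / r) ^+ 2 = 1.
  by rewrite !expr_div_n -mulrDl -r2 divff// expf_neq0.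
have ub : -1 <= u <= 1.
  by rewrite -ler_norml -[leRHS]normr1 -ler_sqr ?nnegrE// !real_normK ?num_real// expr1n -u2 lerDl sqr_ge0.
have cu : cos (acos u) = u by apply: acosK; rewrite in_itv.
have su : sin (acos u) = `|p / r|.
  rewrite sin_acos//.
  by rewrite -u2 addrC addKr sqrtr_sqr.
have a0 : 0 <= acos u by apply: acos_ge0.
have api : acos u <= pi by apply: acos_lepi.
have [p0|p0] := leP 0 p.
  exists r, (acos u); split=> //; first by lra.
    by rewrite cu /u mulrC divfK.
  by rewrite su ger0_norm ?divr_ge0// mulrC divfK.
exists r, (2 * pi - acos u); split=> //.
- suff : acos u != 0 by rewrite neq_lt => /orP[]; lra.
  apply/eqP => a00; move: su; rewrite a00 sin0 => /esym/eqP.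
  by rewrite normr_eq0 mulf_eq0 invr_eq0 (negbTE rn) orbF lt_eqF.
- have -> : cos (2 * pi - acos u) = u.
    by rewrite -cosN opprB mulr_natl -[RHS]cu -(cosD2pi (acos u - _)) subrK.
  by rewrite /u mulrC divfK.
- have -> : sin (2 * pi - acos u) = p / r.
    rewrite -[LHS]opprK -sinN opprB mulr_natl -(sinD2pi (acos u - _)) subrK su.
    by rewrite ltr0_norm ?opprK// pmulr_llt0 ?invr_gt0.
  by rewrite mulrC divfK.
Qed.

Lemma cosDint (y : R) (k : int) : cos (y + k%:~R * (2 * pi)) = cos y.
Proof.
have cosDnat (z : R) (n : nat) : cos (z + pi *+ 2 *+ n) = cos z.
  exact: (periodicn (@cosD2pi R)).
rewrite mulr_natl; case: k => n; first by rewrite -pmulrn mulr_natl cosDnat.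
by rewrite NegzE mulrNz -pmulrn mulNr mulr_natl -[LHS](cosDnat _ n.+1) subrK.
Qed.

Lemma sinDint (y : R) (k : int) : sin (y + k%:~R * (2 * pi)) = sin y.
Proof.
have sinDnat (z : R) (n : nat) : sin (z + pi *+ 2 *+ n) = sin z.
  exact: (periodicn (@sinD2pi R)).
rewrite mulr_natl; case: k => n; first by rewrite -pmulrn mulr_natl sinDnat.
by rewrite NegzE mulrNz -pmulrn mulNr mulr_natl -[LHS](sinDnat _ n.+1) subrK.
Qed.

(** Every half-open interval of length 2 pi contains a representative of each
    angle. *)
Lemma angle_shift (th a : R) :
  exists k : int, a <= th + k%:~R * (2 * pi) < a + 2 * pi.
Proof.
have pg : 0 < 2 * pi :> R by rewrite mulr_gt0// pi_gt0.
exists (- Num.floor ((th - a) / (2 * pi))); rewrite mulrNz mulNr.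
have := floor_le ((th - a) / (2 * pi)).
have := lt_succ_floor ((th - a) / (2 * pi)).
rewrite ler_pdivlMr// ltr_pdivrMr// intrD mulrDl mul1r => h1 h2.
suff key (u v : R) : th - a < u + v -> u <= th - a -> a <= th - u < a + v.
  exact: key h1 h2.
by move=> ? ?; apply/andP; split; lra.
Qed.

Lemma cos_eq1_lt2pi (t : R) : 0 <= t < 2 * pi -> cos t = 1 -> t = 0.
Proof.
move=> /andP[t0 t2] ct.
have [//|tn] := eqVneq t 0.
have tp : 0 < t by rewrite lt0r tn.
have st : 0 < sin (t / 2) by apply: sin_gt0_pi; lra.
have := cosD (t / 2) (t / 2); rewrite -splitr ct.
have := cos2Dsin2 (t / 2); rewrite -!expr2 => e1 e2.
have : sin (t / 2) ^+ 2 = 0 by lra.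
by move=> /eqP; rewrite sqrf_eq0 gt_eqF.
Qed.

End Primitive.

(** * Discs in a plane whose density depends on one coordinate *)

Section Planar.
Context {R : realType}.
Variables (d y0 : R) (rt : R -> R).
Hypotheses (d0 : 0 < d) (y00 : 0 < y0).
Let J : set R := [set y | - d < y < y0].
Hypothesis srt : smooth_on J rt.
Hypothesis rt0 : forall y, J y -> 0 < rt y.

Let oJ : open J.
Proof. by rewrite (_ : J = `]-d, y0[%classic)//; exact: itv_open. Qed.

Let Jitv : is_interval J.
Proof.
move=> x y /= /andP[? ?] /andP[? ?] z /andP[? ?].
by apply/andP; split; lra.
Qed.

Let pi2 : 0 < 2 * pi :> R. Proof. by rewrite mulr_gt0// pi_gt0. Qed.

Lemma J_shrink (t y : R) : 0 <= t <= 1 -> J y -> J (y * t).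
Proof.
move=> /andP[t0 t1] /andP[y1 y2]; apply/andP; have [yp|yn] := leP 0 y.
  split; first by apply: (@lt_le_trans _ _ 0); rewrite ?oppr_lt0// mulr_ge0.
  by apply: le_lt_trans y2; rewrite ler_piMr.
split; first by apply: lt_le_trans y1 _; rewrite ler_niMr// ltW.
by apply: le_lt_trans y00; rewrite nmulr_rle0.
Qed.

Lemma J_ge0 (y : R) : 0 <= y -> y < y0 -> J y.
Proof.
by move=> yp yy; apply/andP; split=> //; apply: lt_le_trans yp; rewrite oppr_lt0.
Qed.

Lemma cos2_itv (s : R) : 0 <= cos s ^+ 2 <= 1.
Proof.
by rewrite sqr_ge0/=; have := sin2cos2 s; have := sqr_ge0 (sin s); lra.
Qed.

(** For the area form rt (X ^ 2) dX dp, the Hamiltonian (X ^ 2 + p ^ 2) / 2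
    rotates circles, and the integral of the density along the circle of squared
    radius y is the time of one turn. *)
Definition period (y : R) : R :=
  parint 0 (2 * pi) (fun s y : R => y * cos s ^+ 2) (fun=> 1) rt y.

Let cont_cos2 (y : R) : cont_on 0 (2 * pi) (fun s => y * cos s ^+ 2).
Proof.
move=> s _; apply: continuousM; first exact: cst_continuous.
by apply: (@continuousM _ _ cos cos); exact: continuous_cos.
Qed.

Let Jcos (s y : R) : J y -> J (y * cos s ^+ 2).
Proof. by apply: J_shrink; exact: cos2_itv. Qed.

Lemma smooth_period : smooth_on J period.
Proof.
apply: (@parint_smooth _ _ 0 (2 * pi) J J _ (fun s y : R => y * cos s ^+ 2) 1) => //.
- by move=> s x h; rewrite mulrDl.
- by move=> s k u v; rewrite mulrDl -mulrA.
- move=> s h _; have /andP[_ cs] := cos2_itv s.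
  by rewrite normrM mulrC ler_wpM2r// ger0_norm ?sqr_ge0.
- by move=> s x _; exact: Jcos.
- by move=> s _; exact: cst_continuous.
Qed.

Lemma period_gt0 (y : R) : J y -> 0 < period y.
Proof.
move=> Jy; apply: segint_gt0 => //.
- apply: cont_onM; first by move=> ? _; exact: cst_continuous.
  move=> s sab; apply: (@continuous_comp _ _ _ (fun s => y * cos s ^+ 2) rt).
    exact: cont_cos2.
  exact: (smooth_cont srt (Jcos s Jy)).
- by move=> s _; rewrite mul1r; apply/rt0/Jcos.
Qed.

(** The average of the period over [0, y] divided by 2 pi. Written in this
    form, and not as a quotient by y, it is smooth across y = 0, and so is its
    square root. *)
Definition stretch2 (y : R) : R :=
  (2 * pi)^-1 * parint 0 1 (fun s y : R => y * s) (fun=> 1) period y.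

Let cont_ys (y : R) a b : cont_on a b (fun s => y * s).
Proof.
by move=> s _; apply: continuousM; [exact: cst_continuous|exact: cvg_id].
Qed.

Lemma smooth_stretch2 : smooth_on J stretch2.
Proof.
apply: smoothM => //; first exact: smooth_cst.
apply: (@parint_smooth _ _ 0 1 J J (fun s y : R => y * s) (fun s y : R => y * s) 1) => //.
- by move=> s x h; rewrite mulrDl.
- by move=> s k u v; rewrite mulrDl -mulrA.
- move=> s h /andP[s0 s1]; rewrite normrM mulrC ler_wpM2r// ger0_norm//.
- by move=> s x sab; exact: J_shrink.
- by move=> s _; exact: cst_continuous.
- exact: smooth_period.
Qed.

Lemma stretch2_gt0 (y : R) : J y -> 0 < stretch2 y.
Proof.
move=> Jy; rewrite mulr_gt0 ?invr_gt0//; apply: segint_gt0 => //.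
- apply: cont_onM; first by move=> ? _; exact: cst_continuous.
  move=> s sab; apply: (@continuous_comp _ _ _ (fun s => y * s) period).
    exact: (@cont_ys y 0 1).
  exact: (smooth_cont smooth_period (J_shrink sab Jy)).
- by move=> s sab; rewrite mul1r; apply/period_gt0/J_shrink.
Qed.

(** In polar coordinates the disc of squared radius y has area pi times this
    number: half the integral of the period over [0, y]. *)
Definition area (y : R) : R := y * stretch2 y.

(** The product of y by an average over [0, y] is an integral with upper bound
    y. The proof integrates the derivative of s * period (y * s) over [0, 1]. *)
Lemma area_deriv (y : R) : J y -> is_derive y 1 area (period y / (2 * pi)).
Proof.
move=> Jy.
have sp := smooth_period.
have cont1 : cont_on 0 1 (fun=> 1 : R) by move=> ? _; exact: cst_continuous.
have [df Df] : differentiable (parint 0 1 (fun s y : R => y * s) (fun=> 1) period) y /\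
   forall v, 'D_v (parint 0 1 (fun s y : R => y * s) (fun=> 1) period) y =
     parint 0 1 (fun s y : R => y * s) (fun s => 1 * (v * s)) ('D_1 period) y.
  apply: (@parint_diff _ _ 0 1 J J (fun s y : R => y * s) (fun s y : R => y * s) 1) => //.
  - by move=> s x h; rewrite mulrDl.
  - by move=> s k u v; rewrite mulrDl -mulrA.
  - by move=> s h /andP[s0 s1]; rewrite normrM mulrC ler_wpM2r// ger0_norm.
  - by move=> s x sab; exact: J_shrink.
have d1 : is_derive y 1 (parint 0 1 (fun s y : R => y * s) (fun=> 1) period)
    (parint 0 1 (fun s y : R => y * s) (fun s => 1 * (1 * s)) ('D_1 period) y).
  by apply: DeriveDef; [exact: diff_derivable|exact: Df].
have d2 := is_deriveM_fun (is_derive_id y 1) (is_deriveZ_fun (2 * pi)^-1 d1).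
apply: is_derive_eq d2 _.
have JJ s : 0 <= s <= 1 -> J (y * s) by move=> s01; exact: J_shrink.
have dp (s : R) : 0 <= s <= 1 ->
    is_derive s 1 (fun s => s * period (y * s))
      (s * ('D_1 period (y * s) * y) + period (y * s) * 1).
  move=> s01.
  have d3 : is_derive s 1 (fun s => y * s) y.
    apply: is_derive_eq (is_deriveZ_fun y (is_derive_id s 1)) _.
    by rewrite mulr1.
  have d4 := smooth_is_derive (1 : R) sp (JJ _ s01).
  exact: (is_deriveM_fun (is_derive_id s 1) (is_derive_comp_fun d4 d3)).
have cp : cont_on 0 1 (fun s => period (y * s)).
  move=> s sab; apply: (@continuous_comp _ _ _ (fun s => y * s) period).
    exact: (@cont_ys y 0 1).
  exact: (smooth_cont sp (JJ _ sab)).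
have cp1 : cont_on 0 1 (fun s => 'D_1 period (y * s)).
  move=> s sab; apply: (@continuous_comp _ _ _ (fun s => y * s) ('D_1 period)).
    exact: (@cont_ys y 0 1).
  exact: (smooth_cont (smooth_D (1 : R) sp) (JJ _ sab)).
have cs : cont_on 0 1 (fun s : R => s) by move=> s _; exact: cvg_id.
have cy : cont_on 0 1 (fun s : R => y) by move=> s _; exact: cst_continuous.
have cA := cont_onM cs (cont_onM cp1 cy); have cB := cont_onM cp cont1.
have E := segint_FTC (ltr01) (cont_onD cA cB) dp.
rewrite segintD// in E.
have -> : parint 0 1 (fun s y : R => y * s) (fun=> 1) period y
   = segint 0 1 (fun s => period (y * s) * 1).
  by apply: eq_segint => s _; rewrite mulrC.
have E2 : y * parint 0 1 (fun s y : R => y * s) (fun s => 1 * (1 * s)) ('D_1 period) y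
   = segint 0 1 (fun s => s * ('D_1 period (y * s) * y)).
  rewrite /parint -segintZ; first by apply: eq_segint => s _; ring.
  exact: (cont_onM (cont_onM cont1 (cont_onM cont1 cs)) cp1).
rewrite !mul1r mul0r subr0 mulr1 in E.
by rewrite mulrCA E2 mulr1 -mulrDr E mulrC.
Qed.

Lemma area0 : area 0 = 0. Proof. by rewrite /area mul0r. Qed.

Lemma area_lt (x y : R) : - d < x -> x < y -> y < y0 -> area x < area y.
Proof.
move=> dx xy yy; apply: (@incr_of_deriv _ x y _ (fun t => period t / (2 * pi))) => //.
- by move=> t /andP[? ?]; apply: area_deriv; rewrite /J/=; apply/andP; split; lra.
- move=> t /andP[? ?]; rewrite divr_gt0//; apply: period_gt0.
  by rewrite /J/=; apply/andP; split; lra.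
Qed.

Lemma area_inj (x y : R) : - d < x < y0 -> - d < y < y0 -> area x = area y -> x = y.
Proof.
move=> /andP[x1 x2] /andP[y1 y2] e; have [xy|yx|//] := ltgtP x y.
- by have := area_lt x1 xy y2; rewrite e ltxx.
- by have := area_lt y1 yx x2; rewrite e ltxx.
Qed.

Lemma area_surj (y A : R) : 0 <= y < y0 -> 0 <= A <= area y ->
  exists2 x, 0 <= x <= y & area x = A.
Proof.
move=> /andP[yp yy] /andP[A0 A1]; have [||x] := @IVT R area 0 y A yp.
- apply: cont_on_within => t /andP[? ?]; apply: is_derive_continuous.
  by apply: area_deriv; apply: J_ge0 => //; exact: le_lt_trans yy.
- by rewrite area0 ge_min A0/= le_max A1 orbT.
- by rewrite in_itv/= => xx <-; exists x.
Qed.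

Lemma is_derive_comp_scalar (V : normedModType R) (F : R -> R) (g : V -> R) x v a b :
  is_derive (g x) 1 F a -> differentiable g x -> is_derive x v g b ->
  is_derive x v (fun y => F (g y)) (b * a).
Proof.
move=> dF dg [_ <-]; have dF' := derivable_differentiable dF.
apply: DeriveDef; last by rewrite derive_comp_scalar//; case: dF => _ <-.
apply: diff_derivable; exact: (differentiable_comp dg dF').
Qed.

Lemma derive_comp_dir (V W : normedModType R) (F : W -> R) (g : V -> W) x v :
  differentiable g x -> differentiable F (g x) ->
  'D_v (F \o g) x = 'D_('D_v g x) F (g x).
Proof.
move=> dg dF; have dc := differentiable_comp dg dF.
by rewrite (deriveE v dc) (diff_comp dg dF) /= -(deriveE v dg) -(deriveE _ dF).
Qed.

Lemma smooth_differentiable (V W : normedModType R) (U : set V) (f : V -> W) x :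
  smooth_on U f -> U x -> differentiable f x.
Proof. by move=> sf; have [H _] := sf 1%N; exact: H. Qed.

Definition row2 (X p : R) : 'rV[R]_2 := \row_i (if i == 0 then X else p).

Lemma row2_0 X p : row2 X p 0 0 = X. Proof. by rewrite mxE. Qed.
Lemma row2_1 X p : row2 X p 0 1 = p. Proof. by rewrite mxE. Qed.

Lemma row2E (z : 'rV[R]_2) : z = row2 (z 0 0) (z 0 1).
Proof.
apply/rowP => i; rewrite mxE; case: (unliftP 0 i) => [j|] ->//=.
by rewrite (ord1 j); congr (z 0 _); apply/val_inj.
Qed.

Lemma coord_le_norm n (z : 'rV[R]_n) i : `|z 0 i| <= `|z|.
Proof.
rewrite [leRHS]/Num.Def.normr/= mx_normrE.
exact: (le_bigmax _ (fun ij => `|z ij.1 ij.2|) (0, i)).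
Qed.

Let U2 : set 'rV[R]_2 := [set z | z 0 0 ^+ 2 + z 0 1 ^+ 2 < y0].
Let JX : set R := [set x | x ^+ 2 < y0].

Let sqnorm_cont : continuous (fun z : 'rV[R]_2 => z 0 0 ^+ 2 + z 0 1 ^+ 2).
Proof.
have s : smooth_on [set: 'rV[R]_2] (fun z => z 0 0 ^+ 2 + z 0 1 ^+ 2).
  have oT : open [set: 'rV[R]_2] by exact: openT.
  by apply: smoothD => //; apply: smoothX2 => //; exact: smooth_coord.
by move=> z; exact: (smooth_cont s).
Qed.

Let oU2 : open U2.
Proof.
apply: (@open_comp _ _ (fun z : 'rV[R]_2 => z 0 0 ^+ 2 + z 0 1 ^+ 2) [set y | y < y0]).
  by move=> z _; exact: sqnorm_cont.
exact: open_lt.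
Qed.

Let oJX : open JX.
Proof.
apply: (@open_comp _ _ (fun x : R => x ^+ 2) [set y | y < y0]).
  by move=> x _; exact: exprn_continuous.
exact: open_lt.
Qed.

Let JXitv : is_interval JX.
Proof.
move=> x y /= hx hy z /andP[xz zy]; rewrite /JX /=.
have [z0|z0] := leP 0 z.
  by apply: le_lt_trans hy; rewrite lerXn2r// ?nnegrE// (le_trans z0).
apply: le_lt_trans hx; rewrite -sqrrN -(sqrrN x).
by rewrite lerXn2r// ?nnegrE; lra.
Qed.

Definition dens (X : R) : R := rt (X ^+ 2).

Let JX_J X : JX X -> J (X ^+ 2).
Proof. by move=> h; apply: J_ge0 => //; exact: sqr_ge0. Qed.

Let sdens : smooth_on JX dens.
Proof.
apply: (@smooth_comp _ _ _ J) => //.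
by apply: smoothX2 => //; exact: smooth_id.
Qed.

Let lin (s : R) (z : 'rV[R]_2) : R := z 0 0 * cos s - z 0 1 * sin s.

Let lin_sq s z : lin s z ^+ 2 <= z 0 0 ^+ 2 + z 0 1 ^+ 2.
Proof.
have -> : z 0 0 ^+ 2 + z 0 1 ^+ 2 =
    lin s z ^+ 2 + (z 0 0 * sin s + z 0 1 * cos s) ^+ 2.
  transitivity ((z 0 0 ^+ 2 + z 0 1 ^+ 2) * (cos s ^+ 2 + sin s ^+ 2)).
    by rewrite cos2Dsin2 mulr1.
  by rewrite /lin; ring.
by rewrite lerDl sqr_ge0.
Qed.

Let lin_JX s z : U2 z -> JX (lin s z).
Proof. by move=> Uz; exact: le_lt_trans (lin_sq s z) Uz. Qed.

Let lin_cont z a b : cont_on a b (lin ^~ z).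
Proof.
move=> s _; apply: continuousB; apply: continuousM; try exact: cst_continuous.
  exact: continuous_cos.
exact: continuous_sin.
Qed.

Let lin_bnd s h : `|lin s h| <= 2 * `|h|.
Proof.
have h0 := coord_le_norm h 0; have h1 := coord_le_norm h 1.
apply: le_trans (ler_normB _ _) _; rewrite !normrM mulr_natl mulr2n.
apply: lerD; rewrite -[leRHS]mulr1; apply: ler_pM => //.
  by rewrite ler_norml cos_geN1 cos_le1.
by rewrite ler_norml sin_geN1 sin_le1.
Qed.

Let linD s (x h : 'rV[R]_2) : lin s (x + h) = lin s x + lin s h.
Proof. by rewrite /lin !mxE; ring. Qed.

Let linlin s k (u v : 'rV[R]_2) : lin s (k *: u + v) = k * lin s u + lin s v.
Proof. by rewrite /lin !mxE; ring. Qed.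

(** The first moment of the density along the orbit of z under rotations.
    Moving z along its circle shifts the integrand, and integrating by parts
    gives the derivative in this direction in terms of the density at z. *)
Definition twist (z : 'rV[R]_2) : R := parint 0 (2 * pi) lin id dens z.
Let mean (z : 'rV[R]_2) : R := parint 0 (2 * pi) lin (fun=> 1) dens z.

Let cont_id a b : cont_on a b (fun s : R => s).
Proof. by move=> s _; exact: cvg_id. Qed.

(* Averages over the circle do not depend on the starting angle t: the
   derivative of G (u + 2 pi) - G u vanishes for a primitive G of a function of
   period 2 pi. *)
Let lin_mean (r t : R) : 0 <= t < 2 * pi -> r ^+ 2 < y0 ->
  mean (row2 (r * cos t) (r * sin t)) = period (r ^+ 2).
Proof.
move=> /andP[t0 t2] ry.
pose h (s : R) : R := dens (r * cos s).
have hc s : {for s, continuous h}.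
  apply: (@continuous_comp _ _ _ (fun s => r * cos s) dens).
    by apply: continuousM; [exact: cst_continuous|exact: continuous_cos].
  apply: (smooth_cont sdens); apply: le_lt_trans ry.
  have /andP[_ c1] := cos2_itv s.
  by rewrite exprMn -[leRHS]mulr1 ler_wpM2l// sqr_ge0.
have [G HG] := @primitive R h (-1) (4 * pi + 1) hc.
have HG' (s : R) : 0 <= s <= 4 * pi -> is_derive s 1 G (h s).
  by move=> /andP[? ?]; apply: HG; apply/andP; split; lra.
have E (u : R) : 0 <= u <= 2 * pi ->
    segint 0 (2 * pi) (fun s => h (s + u)) = G (2 * pi + u) - G u.
  move=> /andP[u0 u2].
  have cu : cont_on 0 (2 * pi) (fun s => h (s + u)).
    move=> s _; apply: (@continuous_comp _ _ _ (fun s => s + u) h).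
      by apply: continuousD; [exact: cvg_id|exact: cst_continuous].
    exact: hc.
  have du (s : R) : 0 <= s <= 2 * pi -> is_derive s 1 (fun s => G (s + u)) (h (s + u)).
    move=> /andP[s0 s2].
    have d1 : is_derive s 1 (fun s => s + u) 1.
      have := is_deriveD_fun (is_derive_id s 1) (is_derive_cst u s 1).
      by rewrite addr0.
    have d2 : is_derive (s + u) 1 G (h (s + u)).
      by apply: HG'; apply/andP; split; lra.
    apply: is_derive_eq (@is_derive_comp_fun _ G (fun s => s + u) _ _ _ d2 d1) _.
    by rewrite mulr1.
  by rewrite (segint_FTC pi2 cu du) add0r.
have dg (u : R) : 0 <= u <= t -> is_derive u 1 (fun u => G (u + 2 * pi) - G u) 0.
  move=> /andP[u0 ut].
  have d1 : is_derive u 1 (fun s => s + 2 * pi) 1.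
    have := is_deriveD_fun (is_derive_id u 1) (is_derive_cst (2 * pi) u 1).
    by rewrite addr0.
  have d2 : is_derive (u + 2 * pi) 1 G (h (u + 2 * pi)).
    by apply: HG'; apply/andP; split; lra.
  have d3 : is_derive u 1 G (h u) by apply: HG'; apply/andP; split; lra.
  apply: is_derive_eq (is_deriveB_fun (@is_derive_comp_fun _ G (fun s => s + 2 * pi) _ _ _ d2 d1) d3) _.
  by rewrite mulr1 /h mulr_natl cosD2pi subrr.
have [s _] := mean_value t0 dg; rewrite mul0r => /eqP.
rewrite subr_eq0 add0r ![_ + 2 * pi]addrC => /eqP e.
rewrite /mean /parint.
transitivity (segint 0 (2 * pi) (fun s => h (s + t))).
  by apply: eq_segint => s' _; rewrite mul1r /h /lin row2_0 row2_1 cosD; congr dens; ring.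
rewrite E ?t0 ?ltW// e -[X in G X - _]addr0 -E ?lexx ?ltW//.
by apply: eq_segint => s' _; rewrite addr0 mul1r /h /dens exprMn.
Qed.

Let mean_period z : U2 z -> mean z = period (z 0 0 ^+ 2 + z 0 1 ^+ 2).
Proof.
move=> Uz; have [r [t [r0 t2 e0 e1]]] := polar (z 0 0) (z 0 1).
have er : z 0 0 ^+ 2 + z 0 1 ^+ 2 = r ^+ 2.
  by rewrite e0 e1 !exprMn -mulrDr cos2Dsin2 mulr1.
by rewrite er (row2E z) e0 e1 lin_mean// -er.
Qed.

Let smooth_twist : smooth_on U2 twist.
Proof.
apply: (@parint_smooth _ _ 0 (2 * pi) U2 JX lin lin 2) => //.
- by move=> s x _; exact: lin_JX.
Qed.

Let sqn_J z : U2 z -> J (z 0 0 ^+ 2 + z 0 1 ^+ 2).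
Proof. by move=> Uz; apply: J_ge0 => //; rewrite addr_ge0 ?sqr_ge0. Qed.

Let smooth_sqn : smooth_on U2 (fun z => z 0 0 ^+ 2 + z 0 1 ^+ 2).
Proof. by apply: smoothD => //; apply: smoothX2 => //; exact: smooth_coord. Qed.

Let smooth_periodn : smooth_on U2 (fun z => period (z 0 0 ^+ 2 + z 0 1 ^+ 2)).
Proof. exact: (smooth_comp oU2 sqn_J smooth_period smooth_sqn). Qed.

(** The angle by which z has to be turned further so that the total angle is
    2 pi times the elapsed fraction of the period; this integral formula is
    smooth at the origin. *)
Definition corr (z : 'rV[R]_2) : R :=
  twist z * (period (z 0 0 ^+ 2 + z 0 1 ^+ 2))^-1 - pi.

Let periodn_neq0 z : U2 z -> period (z 0 0 ^+ 2 + z 0 1 ^+ 2) != 0.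
Proof. by move=> Uz; rewrite gt_eqF// period_gt0//; exact: sqn_J. Qed.

Lemma smooth_corr : smooth_on U2 corr.
Proof.
apply: smoothB => //; last exact: smooth_cst.
by apply: smoothM => //; apply: smoothV.
Qed.

Let twist_rot z : U2 z ->
  'D_(row2 (- z 0 1) (z 0 0)) twist z =
  2 * pi * dens (z 0 0) - period (z 0 0 ^+ 2 + z 0 1 ^+ 2).
Proof.
move=> Uz.
have [_ ->] : differentiable twist z /\ forall v, 'D_v twist z =
    parint 0 (2 * pi) lin (fun s => s * lin s v) ('D_1 dens) z.
  apply: (@parint_diff _ _ 0 (2 * pi) U2 JX lin lin 2) => //.
  by move=> s x _; exact: lin_JX.
rewrite -mean_period//; apply/eqP; rewrite -subr_eq opprK; apply/eqP.
pose v := row2 (- z 0 1) (z 0 0).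
have c1 : cont_on 0 (2 * pi) (fun s => 'D_1 dens (lin s z)).
  move=> s sab; apply: (@continuous_comp _ _ _ (lin ^~ z) ('D_1 dens)).
    exact: (@lin_cont z 0 (2 * pi)).
  by apply: (smooth_cont (smooth_D (1 : R) sdens)); exact: lin_JX.
have c2 : cont_on 0 (2 * pi) (fun s => dens (lin s z)).
  move=> s sab; apply: (@continuous_comp _ _ _ (lin ^~ z) dens).
    exact: (@lin_cont z 0 (2 * pi)).
  by apply: (smooth_cont sdens); exact: lin_JX.
have c3 : cont_on 0 (2 * pi) (fun=> 1 : R) by move=> ? _; exact: cst_continuous.
have cA := cont_onM (cont_onM (@cont_id 0 (2 * pi)) (@lin_cont v 0 (2 * pi))) c1.
rewrite /mean /parint -segintD//; last exact: (cont_onM c3 c2).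
have ds (s : R) : 0 <= s <= 2 * pi -> is_derive s 1 (fun s => s * dens (lin s z))
    (s * lin s v * 'D_1 dens (lin s z) + 1 * dens (lin s z)).
  move=> _.
  have d1 : is_derive s 1 (lin ^~ z) (lin s v).
    have := is_deriveB_fun (is_deriveZ_fun (z 0 0) (is_derive_cos s))
      (is_deriveZ_fun (z 0 1) (is_derive_sin s)).
    move/is_derive_eq; apply; rewrite /lin row2_0 row2_1; ring.
  have d2 := smooth_is_derive (1 : R) sdens (lin_JX s Uz).
  apply: is_derive_eq (is_deriveM_fun (is_derive_id s 1) (@is_derive_comp_fun _ dens (lin ^~ z) _ _ _ d2 d1)) _.
  by ring.
have cB := cont_onD cA (cont_onM c3 c2).
by rewrite (segint_FTC pi2 cB ds) mul0r subr0 /lin mulr_natl cos2pi sin2pi mulr1 mulr0 subr0.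
Qed.

(** The derivative of the elapsed fraction of the period along the rotation
    is the density divided by the period; the term - 1 is the rotation itself. *)
Lemma corr_rot z : U2 z ->
  'D_(row2 (- z 0 1) (z 0 0)) corr z =
  2 * pi * dens (z 0 0) / period (z 0 0 ^+ 2 + z 0 1 ^+ 2) - 1.
Proof.
move=> Uz; set v := row2 _ _; set y := z 0 0 ^+ 2 + z 0 1 ^+ 2.
have dX i : is_derive z v (fun z : 'rV[R]_2 => z 0 i) (v 0 i).
  apply: DeriveDef; first by apply: diff_derivable; exact: differentiable_coord.
  by rewrite -derive_coord ?derive_id//; exact: ex_diff.
have dX2 i : is_derive z v (fun z : 'rV[R]_2 => z 0 i ^+ 2) (2 * z 0 i * v 0 i).
  under eq_fun do rewrite expr2.
  by apply: is_derive_eq (is_deriveM_fun (dX i) (dX i)) _; ring.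
have dy : is_derive z v (fun z : 'rV[R]_2 => z 0 0 ^+ 2 + z 0 1 ^+ 2) 0.
  apply: is_derive_eq (is_deriveD_fun (dX2 0) (dX2 1)) _.
  by rewrite /v row2_0 row2_1; ring.
have dp : is_derive z v (fun z : 'rV[R]_2 => period (z 0 0 ^+ 2 + z 0 1 ^+ 2)) 0.
  have dT := smooth_is_derive (1 : R) smooth_period (sqn_J Uz).
  have dq := smooth_differentiable smooth_sqn Uz.
  have := @is_derive_comp_scalar _ period
    (fun z : 'rV[R]_2 => z 0 0 ^+ 2 + z 0 1 ^+ 2) z v _ _ dT dq dy.
  by rewrite mul0r.
have dpV := is_deriveV_fun dp (periodn_neq0 Uz).
have dtw := smooth_is_derive v smooth_twist Uz.
have [_ ->] := is_deriveB_fun (is_deriveM_fun dtw dpV) (is_derive_cst pi z v).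
rewrite /= -/y twist_rot// -/y; field.
exact: periodn_neq0.
Qed.

End Planar.

(** * Straightening the density *)

Lemma lift01 : lift ord0 ord0 = 1 :> 'I_2.
Proof. exact/val_inj. Qed.

Section PlanarMap.
Context {R : realType}.
Variables (d y0 : R) (rt : R -> R).
Hypotheses (d0 : 0 < d) (y00 : 0 < y0).
Let J : set R := [set y | - d < y < y0].
Hypothesis srt : smooth_on J rt.
Hypothesis rt0 : forall y, J y -> 0 < rt y.

Let U2 : set 'rV[R]_2 := [set z | z 0 0 ^+ 2 + z 0 1 ^+ 2 < y0].

Let radial (y : R) : R := Num.sqrt (stretch2 rt y).
Let angc (X p : R) : R := corr rt (row2 X p).

(** Radii are stretched so that discs keep their area, and each circle is turned
    by corr so that equal times become equal angles. The pair (actX, actP) then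
    transports the area form rt (X ^ 2) dX dp to the standard one. *)
Definition actX (X p : R) : R :=
  radial (X ^+ 2 + p ^+ 2) * (X * cos (angc X p) - p * sin (angc X p)).
Definition actP (X p : R) : R :=
  radial (X ^+ 2 + p ^+ 2) * (X * sin (angc X p) + p * cos (angc X p)).

Let radial_sq y : J y -> radial y ^+ 2 = stretch2 rt y.
Proof. by move=> Jy; rewrite sqr_sqrtr// ltW// (stretch2_gt0 d0 y00 srt rt0). Qed.

Let radial_gt0 y : J y -> 0 < radial y.
Proof. by move=> Jy; rewrite sqrtr_gt0 (stretch2_gt0 d0 y00 srt rt0). Qed.

Let J_sum (X p : R) : X ^+ 2 + p ^+ 2 < y0 -> J (X ^+ 2 + p ^+ 2).
Proof. by move=> h; apply: J_ge0 => //; rewrite addr_ge0 ?sqr_ge0. Qed.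

Lemma act_norm (X p : R) : X ^+ 2 + p ^+ 2 < y0 ->
  actX X p ^+ 2 + actP X p ^+ 2 = area rt (X ^+ 2 + p ^+ 2).
Proof.
move=> h; rewrite /area -radial_sq; last exact: J_sum.
rewrite /actX /actP; set k := radial _; set c := cos _; set s := sin _.
transitivity ((X ^+ 2 + p ^+ 2) * k ^+ 2 * (c ^+ 2 + s ^+ 2)); first by ring.
by rewrite /c /s cos2Dsin2 mulr1.
Qed.

Let turned (r t : R) : R := t + angc (r * cos t) (r * sin t).

Let sq_polar (r t : R) : (r * cos t) ^+ 2 + (r * sin t) ^+ 2 = r ^+ 2.
Proof. by rewrite !exprMn -mulrDr cos2Dsin2 mulr1. Qed.

Let act_polar (r t : R) :
  actX (r * cos t) (r * sin t) = r * radial (r ^+ 2) * cos (turned r t) /\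
  actP (r * cos t) (r * sin t) = r * radial (r ^+ 2) * sin (turned r t).
Proof. by rewrite /actX /actP sq_polar /turned cosD sinD; split; ring. Qed.

Let turned_deriv (r t : R) : r ^+ 2 < y0 ->
  is_derive t 1 (turned r) (2 * pi * dens rt (r * cos t) / period rt (r ^+ 2)).
Proof.
move=> ry.
pose g (t : R) := row2 (r * cos t) (r * sin t).
have Ug t' : U2 (g t') by rewrite /U2 /= row2_0 row2_1 sq_polar.
have oT : open [set: R] by exact: openT.
have sg : smooth_on [set: R] g.
  apply: smooth_row => // i.
  apply: (@smooth_ext _ _ _ _ (fun t => r * (if i == 0 then cos t else sin t))) => //.
    by move=> x _; rewrite mxE; case: eqP.
  apply: smoothM => //; first exact: smooth_cst.
  by case: (i == 0); [apply: smooth_cos|apply: smooth_sin] => //; exact: smooth_id.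
have dg := smooth_differentiable sg (I : [set: R] t).
have dc := smooth_differentiable (smooth_corr d0 y00 srt rt0) (Ug t).
have dgE : 'D_1 g t = row2 (- (g t) 0 1) ((g t) 0 0).
  apply/rowP => i; rewrite derive_coord// /g row2_0 row2_1 mxE.
  under eq_fun do rewrite mxE.
  case: eqP => _.
    have [_ ->] := is_deriveZ_fun r (is_derive_cos t); by rewrite mulrN.
  by have [_ ->] := is_deriveZ_fun r (is_derive_sin t).
have d1 : is_derive t 1 (corr rt \o g)
    (2 * pi * dens rt (r * cos t) / period rt (r ^+ 2) - 1).
  apply: DeriveDef; first by apply: diff_derivable; exact: differentiable_comp.
  rewrite (derive_comp_dir (1 : R) dg dc) dgE (corr_rot d0 y00 srt rt0 (Ug t)).
  by rewrite /g !row2_0 !row2_1 sq_polar.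
apply: is_derive_eq (is_deriveD_fun (is_derive_id t 1) d1) _; ring.
Qed.

Let turned_lt (r s t : R) : r ^+ 2 < y0 -> s < t -> turned r s < turned r t.
Proof.
move=> ry st; apply: (@incr_of_deriv _ s t _ _ st (fun u _ => turned_deriv u ry)).
move=> u _; have pg : 0 < pi :> R by exact: pi_gt0.
have Jr : J (r ^+ 2) by apply: J_ge0 => //; exact: sqr_ge0.
have Jx : J ((r * cos u) ^+ 2).
  apply: J_ge0 => //; first exact: sqr_ge0.
  by apply: le_lt_trans ry; rewrite -(sq_polar r u) lerDl sqr_ge0.
by rewrite divr_gt0 ?mulr_gt0//; [exact: rt0|exact: period_gt0 d0 y00 srt rt0 _ Jr].
Qed.

Let turned_period (r t : R) : turned r (t + 2 * pi) = turned r t + 2 * pi.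
Proof. by rewrite /turned mulr_natl cosD2pi sinD2pi addrAC. Qed.

(** The area determines the circle; on it the new angle is strictly increasing
    and grows by 2 pi during one turn. *)
Lemma act_inj (X p X' p' : R) : X ^+ 2 + p ^+ 2 < y0 -> X' ^+ 2 + p' ^+ 2 < y0 ->
  actX X p = actX X' p' -> actP X p = actP X' p' -> X = X' /\ p = p'.
Proof.
move=> h h' eX eP.
have eY : X ^+ 2 + p ^+ 2 = X' ^+ 2 + p' ^+ 2.
  apply: (area_inj d0 y00 srt rt0); [exact: J_sum..|].
  by rewrite -!act_norm// eX eP.
have [r [t [r0 t2 e0 e1]]] := polar X p.
have [r' [t' [r0' t2' e0' e1']]] := polar X' p'.
have er : r = r'.
  apply/eqP; rewrite -(@eqrXn2 _ 2)// -(sq_polar r t) -(sq_polar r' t').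
  by rewrite -e0 -e1 -e0' -e1' eY.
move: h h' eX eP eY => _ ; rewrite e0' e1' e0 e1 -er => h eX eP _.
have [rz|rn] := eqVneq r 0; first by rewrite rz !mul0r.
have ry : r ^+ 2 < y0 by rewrite -(sq_polar r t').
have Jr : J (r ^+ 2) by apply: J_ge0 => //; exact: sqr_ge0.
have kn : r * radial (r ^+ 2) != 0 by rewrite mulf_neq0// gt_eqF// radial_gt0.
have [p1 p2] := act_polar r t; have [p3 p4] := act_polar r t'.
have ec : cos (turned r t) = cos (turned r t').
  by apply: (mulfI kn); rewrite -p1 -p3.
have es : sin (turned r t) = sin (turned r t').
  by apply: (mulfI kn); rewrite -p2 -p4.
suff -> : t = t' by [].
wlog tt : t t' t2 t2' ec es {p1 p2 p3 p4 e0 e1 e0' e1' h eX eP} / t <= t'.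
  by move=> H; case: (leP t t') => [|/ltW] tt; [apply: H|apply/esym/H].
have [//|tn] := eqVneq t t'.
have lt : t < t' by rewrite lt_neqAle tn.
have l1 := turned_lt ry lt.
have l2 : turned r t' < turned r t + 2 * pi.
  rewrite -turned_period; apply: turned_lt => //.
  by case/andP: t2 => ? ?; case/andP: t2' => ? ?; lra.
have c1 : cos (turned r t' - turned r t) = 1.
  by rewrite cosB ec es -!expr2 cos2Dsin2.
have := cos_eq1_lt2pi _ c1; rewrite subr_ge0 (ltW l1) /= => /(_ _)/eqP.
rewrite ltrBlDl => /(_ l2); rewrite subr_eq0 => /eqP e.
by move: l1; rewrite e ltxx.
Qed.

(** The radius comes from the intermediate value theorem for the area, the
    angle from the intermediate value theorem for the new angle on the circle. *)
Lemma act_surj (A B y : R) : 0 <= y < y0 -> A ^+ 2 + B ^+ 2 <= area rt y ->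
  exists X p, [/\ X ^+ 2 + p ^+ 2 <= y, actX X p = A & actP X p = B].
Proof.
move=> yy AB.
have [x xy ex] : exists2 x : R, 0 <= x <= y & area rt x = A ^+ 2 + B ^+ 2.
  by apply: (area_surj d0 y00 srt yy); rewrite AB addr_ge0 ?sqr_ge0.
case/andP: xy => x0 xy; case/andP: yy => _ yy.
pose r := Num.sqrt x.
have r2 : r ^+ 2 = x by rewrite sqr_sqrtr.
have ry : r ^+ 2 < y0 by rewrite r2; exact: le_lt_trans yy.
have Jr : J (r ^+ 2) by apply: J_ge0 => //; exact: sqr_ge0.
have [rho [th [rho0 th2 eA eB]]] := polar A B.
have erho : rho = r * radial (r ^+ 2).
  have k0 := radial_gt0 Jr.
  apply/eqP; rewrite -(@eqrXn2 _ 2)//; last by rewrite mulr_ge0 ?sqrtr_ge0// ltW.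
  apply/eqP; transitivity (A ^+ 2 + B ^+ 2); first by rewrite eA eB sq_polar.
  by rewrite -ex exprMn (radial_sq Jr) r2.
have pg : 0 < 2 * pi :> R by rewrite mulr_gt0// pi_gt0.
have cl : cont_on 0 (2 * pi) (turned r).
  by move=> t _; exact: is_derive_continuous (turned_deriv t ry).
have [n thb] := angle_shift th (turned r 0).
set th' := th + _ in thb.
have [||t] := @IVT R (turned r) 0 (2 * pi) th' (ltW pg).
- exact: cont_on_within.
- have l2 : turned r (2 * pi) = turned r 0 + 2 * pi by rewrite -turned_period add0r.
  case/andP: thb => b1 b2.
  by rewrite l2 ge_min b1/= le_max (ltW b2) orbT.
move=> _ et.
exists (r * cos t), (r * sin t).
have [-> ->] := act_polar r t; rewrite sq_polar r2; split=> //.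
  by rewrite et cosDint -r2 -erho -eA.
by rewrite et sinDint -r2 -erho -eB.
Qed.

Variable V : normedModType R.
Variables (U : set V) (X p : V -> R).
Hypotheses (oU : open U) (sX : smooth_on U X) (sp : smooth_on U p).
Hypothesis XpU : forall u, U u -> X u ^+ 2 + p u ^+ 2 < y0.

Let sY : smooth_on U (fun u => X u ^+ 2 + p u ^+ 2).
Proof. by apply: smoothD => //; exact: smoothX2. Qed.

Let JY u : U u -> J (X u ^+ 2 + p u ^+ 2).
Proof. by move=> Uu; apply/J_sum/XpU. Qed.

Let sradial : smooth_on J radial.
Proof.
apply: smooth_sqrt_comp; last exact: (smooth_stretch2 d0 y00 srt).
  by rewrite (_ : J = `]-d, y0[%classic)//; exact: itv_open.
by move=> y Jy; exact: (stretch2_gt0 d0 y00 srt rt0).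
Qed.

Let sXp : smooth_on U (fun u => row2 (X u) (p u)).
Proof.
apply: smooth_row => // i; under eq_fun do rewrite mxE.
by case: (i == 0).
Qed.

Let sang : smooth_on U (fun u => angc (X u) (p u)).
Proof.
have gU u : U u -> U2 (row2 (X u) (p u)) by move=> Uu; rewrite /U2/= row2_0 row2_1; exact: XpU.
exact: (smooth_comp_row oU gU (smooth_corr d0 y00 srt rt0) sXp).
Qed.

Let srad : smooth_on U (fun u => radial (X u ^+ 2 + p u ^+ 2)).
Proof. exact: (smooth_comp oU JY sradial sY). Qed.

Lemma smooth_actX : smooth_on U (fun u => actX (X u) (p u)).
Proof.
exact: (smoothM oU srad (smoothB oU (smoothM oU sX (smooth_cos oU sang))
  (smoothM oU sp (smooth_sin oU sang)))).
Qed.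

Lemma smooth_actP : smooth_on U (fun u => actP (X u) (p u)).
Proof.
exact: (smoothM oU srad (smoothD oU (smoothM oU sX (smooth_sin oU sang))
  (smoothM oU sp (smooth_cos oU sang)))).
Qed.

(** In polar coordinates the Jacobian is the product of the derivative of half
    the new squared radius, which is period / (2 pi) per unit of half the old
    one, and of the derivative of the new angle, 2 pi * dens / period. The
    computation is done in Cartesian coordinates to include the origin. *)
Lemma act_symplectic u v w : U u ->
  'D_v (fun u => actX (X u) (p u)) u * 'D_w (fun u => actP (X u) (p u)) u -
  'D_w (fun u => actX (X u) (p u)) u * 'D_v (fun u => actP (X u) (p u)) u =
  dens rt (X u) * ('D_v X u * 'D_w p u - 'D_w X u * 'D_v p u).
Proof.
move=> Uu.
pose y := X u ^+ 2 + p u ^+ 2; pose psi := angc (X u) (p u).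
have Jy : J y by exact: JY.
pose z := row2 (X u) (p u).
have Uz : U2 z by rewrite /U2/= row2_0 row2_1; exact: XpU.
have dcorr := smooth_differentiable (smooth_corr d0 y00 srt rt0) Uz.
pose p0 := 'D_(delta_mx 0 0) (corr rt) z; pose p1 := 'D_(delta_mx 0 1) (corr rt) z.
have dpsi h : is_derive u h (fun u => angc (X u) (p u)) ('D_h X u * p0 + 'D_h p u * p1).
  have dg := smooth_differentiable sXp Uu.
  have dd := smooth_is_derive h sang Uu.
  apply: is_derive_eq dd _.
  rewrite (_ : (fun u => _) = corr rt \o (fun u => row2 (X u) (p u)))//.
  rewrite derive_comp_row// big_ord_recl big_ord1 lift01 !derive_coord//.
  congr (_ * _ + _ * _).
  - by congr ('D_h _ u); apply/funext => u'; rewrite mxE.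
  - by congr ('D_h _ u); apply/funext => u'; rewrite mxE.
have rot : X u * p1 - p u * p0 = 2 * pi * dens rt (X u) / period rt y - 1.
  have := corr_rot d0 y00 srt rt0 Uz; rewrite /z !row2_0 !row2_1 -/z -/y => <-.
  rewrite (deriveE _ dcorr) (row_sum_delta (row2 (- p u) (X u))) raddf_sum.
  rewrite big_ord_recl big_ord1 lift01 !mxE/=.
  rewrite (linearZ_LR ('d (corr rt) z)) (linearZ_LR ('d (corr rt) z)).
  rewrite /p0 /p1 !(deriveE _ dcorr) addrC -mulNr.
  by [].
pose k := radial y; pose s' := 'D_1 (stretch2 rt) y.
have k0 : 0 < k by exact: radial_gt0.
have ds : is_derive y 1 (stretch2 rt) s'.
  exact: smooth_is_derive (smooth_stretch2 d0 y00 srt) Jy.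
have dk : is_derive y 1 radial (s' / (2 * k)).
  have st0 := stretch2_gt0 d0 y00 srt rt0 Jy.
  apply: is_derive_eq (is_derive_comp_fun (is_derive1_sqrt st0) ds) _.
  by rewrite mulrC.
have rad : y * s' + k ^+ 2 = period rt y / (2 * pi).
  have [_ <-] := area_deriv d0 y00 srt Jy.
  have [_ e] := is_deriveM_fun (is_derive_id y 1) ds.
  rewrite radial_sq// -[stretch2 rt y]mulr1; exact/esym/e.
have dX h := smooth_is_derive h sX Uu; have dp h := smooth_is_derive h sp Uu.
have dY h : is_derive u h (fun u => X u ^+ 2 + p u ^+ 2)
    (2 * (X u * 'D_h X u + p u * 'D_h p u)).
  under eq_fun do rewrite !expr2.
  apply: is_derive_eq (is_deriveD_fun (is_deriveM_fun (dX h) (dX h))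
    (is_deriveM_fun (dp h) (dp h))) _; ring.
have dK h : is_derive u h (fun u => radial (X u ^+ 2 + p u ^+ 2))
    (2 * (X u * 'D_h X u + p u * 'D_h p u) * (s' / (2 * k))).
  exact: (@is_derive_comp_scalar _ _ radial (fun u => X u ^+ 2 + p u ^+ 2) u h _ _
    dk (smooth_differentiable sY Uu) (dY h)).
have dcos h : is_derive u h (fun u => cos (angc (X u) (p u)))
    (('D_h X u * p0 + 'D_h p u * p1) * - sin psi).
  exact: (@is_derive_comp_scalar _ _ cos (fun u => angc (X u) (p u)) u h _ _
    (is_derive_cos psi) (smooth_differentiable sang Uu) (dpsi h)).
have dsin h : is_derive u h (fun u => sin (angc (X u) (p u)))
    (('D_h X u * p0 + 'D_h p u * p1) * cos psi).
  exact: (@is_derive_comp_scalar _ _ sin (fun u => angc (X u) (p u)) u h _ _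
    (is_derive_sin psi) (smooth_differentiable sang Uu) (dpsi h)).
have dA h := is_deriveM_fun (dK h) (is_deriveB_fun
  (is_deriveM_fun (dX h) (dcos h)) (is_deriveM_fun (dp h) (dsin h))).
have dB h := is_deriveM_fun (dK h) (is_deriveD_fun
  (is_deriveM_fun (dX h) (dsin h)) (is_deriveM_fun (dp h) (dcos h))).
have [_ Av] := dA v; have [_ Aw] := dA w; have [_ Bv] := dB v; have [_ Bw] := dB w.
rewrite /actX /actP Av Aw Bv Bw -/y -/psi -/k.
have cs : cos psi ^+ 2 + sin psi ^+ 2 = 1 by exact: cos2Dsin2.
have T0 := period_gt0 d0 y00 srt rt0 Jy.
have pg : 0 < pi :> R by exact: pi_gt0.
have e1 : dens rt (X u) = (y * s' + k ^+ 2) * (1 + (X u * p1 - p u * p0)).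
  rewrite rad rot.
  suff key (D T P : R) : T != 0 -> P != 0 ->
      D = T / (2 * P) * (1 + (2 * P * D / T - 1)).
    by apply: key; rewrite gt_eqF.
  by move=> T1 P1; field; rewrite T1 P1.
rewrite e1 /y.
suff key (c s a b a' b' x q q0 q1 t l : R) : l != 0 -> c ^+ 2 + s ^+ 2 = 1 ->
  (l * (x * ((a * q0 + b * q1) * - s) + c * a -
        (q * ((a * q0 + b * q1) * c) + s * b)) +
   (x * c - q * s) * (2 * (x * a + q * b) * (t / (2 * l)))) *
  (l * (x * ((a' * q0 + b' * q1) * c) + s * a' +
        (q * ((a' * q0 + b' * q1) * - s) + c * b')) +
   (x * s + q * c) * (2 * (x * a' + q * b') * (t / (2 * l)))) -
  (l * (x * ((a' * q0 + b' * q1) * - s) + c * a' -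
        (q * ((a' * q0 + b' * q1) * c) + s * b')) +
   (x * c - q * s) * (2 * (x * a' + q * b') * (t / (2 * l)))) *
  (l * (x * ((a * q0 + b * q1) * c) + s * a +
        (q * ((a * q0 + b * q1) * - s) + c * b)) +
   (x * s + q * c) * (2 * (x * a + q * b) * (t / (2 * l)))) =
  ((x ^+ 2 + q ^+ 2) * t + l ^+ 2) *
     (1 + (x * q1 - q * q0)) * (a * b' - a' * b).
  by apply: key; rewrite ?gt_eqF.
move=> l0 cs1; transitivity ((c ^+ 2 + s ^+ 2) * (((x ^+ 2 + q ^+ 2) * t + l ^+ 2) *
     (1 + (x * q1 - q * q0)) * (a * b' - a' * b))); first by field.
by rewrite cs1 mul1r.
Qed.

End PlanarMap.

(** * Smooth inverses of symplectic maps *)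

Section SymplecticInverse.
Context {R : realType} {n : nat}.
Local Notation E := 'rV[R]_(n + n).

Let ex (i : 'I_n) : E := delta_mx 0 (lshift n i).
Let ey (i : 'I_n) : E := delta_mx 0 (rshift n i).

Lemma omega_bound (u v : E) : `|omega u v| <= 2 * n%:R * `|v| * `|u|.
Proof.
rewrite /omega; apply: le_trans (ler_norm_sum _ _ _) _.
apply: (@le_trans _ _ (\sum_(i < n) 2 * `|v| * `|u|)).
  apply: ler_sum => i _; apply: le_trans (ler_normB _ _) _.
  rewrite !normrM -mulrA mulr_natl mulr2n; apply: lerD; rewrite mulrC.
    by apply: ler_pM => //; exact: coord_le_norm.
  by rewrite mulrC [leRHS]mulrC; apply: ler_pM => //; exact: coord_le_norm.
by rewrite sumr_const card_ord -mulr_natr; lra.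
Qed.

Lemma omega_lin (k : R) (u v w : E) :
  omega (k *: u + v) w = k * omega u w + omega v w.
Proof.
rewrite /omega mulr_sumr -big_split; apply: eq_bigr => i _ /=.
by rewrite /xcoord /ycoord !mxE; ring.
Qed.

Lemma omega_ey (u : E) i : omega u (ey i) = xcoord u i.
Proof.
rewrite /omega (bigD1 i)//= big1 ?addr0 => [|j ji]; last first.
  rewrite /xcoord /ycoord !mxE eq_rshift eq_lrshift/= (negbTE ji).
  by rewrite !mulr0 subrr.
by rewrite /xcoord /ycoord !mxE !eqxx eq_lrshift/= mulr1 mulr0 subr0.
Qed.

Lemma omega_ex (u : E) i : omega u (ex i) = - ycoord u i.
Proof.
rewrite /omega (bigD1 i)//= big1 ?addr0 => [|j ji]; last first.
  rewrite /xcoord /ycoord !mxE eq_lshift eq_rlshift/= (negbTE ji).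
  by rewrite !mulr0 subrr.
by rewrite /xcoord /ycoord !mxE !eqxx eq_rlshift/= mulr1 mulr0 sub0r.
Qed.

Lemma mx_norm_le (u : E) (C : R) : 0 <= C -> (forall i, `|u 0 i| <= C) -> `|u| <= C.
Proof.
move=> C0 uC; rewrite [leLHS]/Num.Def.normr/= mx_normrE.
by apply: bigmax_le => // -[i j] _ /=; rewrite (ord1 i).
Qed.

Variables (Phi : E -> E) (L K V : set E) (H : E -> E).
Hypotheses (oL : open L) (sPhi : smooth_on L Phi).
Hypothesis symp : forall x, L x -> forall u v,
  omega ('D_u Phi x) ('D_v Phi x) = omega u v.
Hypotheses (KL : K `<=` L) (cK : compact K) (oV : open V).
Hypothesis injK : forall x y, K x -> K y -> Phi x = Phi y -> x = y.
Hypothesis HK : forall z, V z -> K (H z).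
Hypothesis PhiH : forall z, V z -> Phi (H z) = z.

Let cPhi x : L x -> {for x, continuous Phi}.
Proof. exact: smooth_cont sPhi. Qed.

(** Closed parts of the compact set K have compact, hence closed, images. *)
Lemma inverse_continuous z : V z -> {for z, continuous H}.
Proof.
move=> Vz N /= nN.
have [N' [oN' N'z sN]] : exists N', [/\ open N', N' (H z) & N' `<=` N].
  by move: nN; rewrite nbhsE => -[N' [? ?] ?]; exists N'.
pose K' := K `&` ~` N'.
have cK' : compact K'.
  by apply: compact_closedI => //; exact: open_closedC.
have cI : compact (Phi @` K').
  apply: continuous_compact => //; apply: continuous_in_subspaceT => x.
  by rewrite inE => -[/KL Lx _]; exact: cPhi.
have clI : closed (Phi @` K') by apply: compact_closed.
have nz : (V `&` ~` (Phi @` K')) z.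
  split=> // -[x [Kx N'x] e]; apply: N'x.
  by rewrite (injK Kx (HK Vz)) // PhiH.
have oI : open (V `&` ~` (Phi @` K')) by apply: openI => //; exact: closed_openC.
apply: filterS (open_nbhs_nbhs (conj oI nz)) => y [Vy ny].
apply: sN; apply: contrapT => nHy; apply: ny; exists (H y); last exact: PhiH.
by split=> //; exact: HK.
Qed.

(** The inverse of a symplectic matrix is its symplectic adjoint, so the
    inverse of the differential of Phi at x has polynomial entries in the
    derivatives of Phi at x. *)
Let B (x w : E) : E :=
  row_mx (\row_i omega w ('D_(ey i) Phi x)) (\row_i - omega w ('D_(ex i) Phi x)).

Let BA x v : L x -> B x ('D_v Phi x) = v.
Proof.
move=> Lx; apply/rowP => i; rewrite /B mxE; case: splitP => j ij.
  rewrite mxE symp// omega_ey /xcoord; congr (v 0 _); exact/val_inj.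
rewrite mxE symp// omega_ex opprK /ycoord; congr (v 0 _); exact/val_inj.
Qed.

Let B_lin x k u v : B x (k *: u + v) = k *: B x u + B x v.
Proof.
apply/rowP => i; rewrite /B !mxE; case: splitP => j _; rewrite !mxE omega_lin//.
by ring.
Qed.

Let B_bound x : exists2 C : R, 0 < C & forall w, `|B x w| <= C * `|w|.
Proof.
pose C := 1 + \sum_(i < n) (2 * n%:R * `|'D_(ey i) Phi x| +
                            2 * n%:R * `|'D_(ex i) Phi x|).
have t0 i : 0 <= 2 * n%:R * `|'D_(ey i) Phi x| + 2 * n%:R * `|'D_(ex i) Phi x|.
  by rewrite addr_ge0// !mulr_ge0.
have C0 : 0 < C by rewrite ltr_wpDr// sumr_ge0.
have Ci i : 2 * n%:R * `|'D_(ey i) Phi x| + 2 * n%:R * `|'D_(ex i) Phi x| <= C.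
  by rewrite /C (bigD1 i)//= addrCA lerDl addr_ge0// sumr_ge0.
exists C => // w; apply: mx_norm_le; first by rewrite mulr_ge0// ltW.
move=> i; rewrite /B mxE; case: splitP => j _; rewrite mxE ?normrN;
  apply: le_trans (omega_bound _ _) _; rewrite ler_wpM2r//;
  apply: le_trans (Ci j).
  by rewrite lerDl !mulr_ge0.
by rewrite lerDr !mulr_ge0.
Qed.

(** The symplectic adjoint is a left inverse of the differential, which
    bounds the increment w of H by the increment h of its argument; the
    linear approximation of Phi at H z then inverts. *)
Let HD z : V z -> forall e, 0 < e -> \forall h \near (0 : E),
  `|H (z + h) - H z - B (H z) h| <= e * `|h|.
Proof.
move=> Vz e e0.
have LH : L (H z) by exact/KL/HK.
have [C C0 HC] := B_bound (H z).
have dPhi := smooth_differentiable sPhi LH.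
pose eps := Num.min (1 / (2 * C)) (e / (2 * C ^+ 2)).
have eps0 : 0 < eps.
  by rewrite lt_min !divr_gt0// mulr_gt0// exprn_gt0.
have epsC : C * eps <= 1 / 2.
  apply: le_trans (_ : C * (1 / (2 * C)) <= _); first by rewrite ler_pM2l// ge_min lexx.
  rewrite (_ : C * (1 / (2 * C)) = 1 / 2)//; field.
  by rewrite gt_eqF.
have epsC2 : 2 * C ^+ 2 * eps <= e.
  apply: le_trans (_ : 2 * C ^+ 2 * (e / (2 * C ^+ 2)) <= _).
    by rewrite ler_pM2l ?mulr_gt0 ?exprn_gt0// ge_min lexx orbT.
  by rewrite mulrC divfK// gt_eqF// mulr_gt0// exprn_gt0.
have la := lin_approx dPhi eps0.
have cH : (fun h => H (z + h) - H z) @ (0 : E) --> (0 : E).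
  have czh : (fun h : E => z + h) @ (0 : E) --> z.
    rewrite -[X in _ --> X]addr0.
    by apply: (@cvgD _ E _ (nbhs (0 : E))); [exact: cvg_cst|exact: cvg_id].
  have cH0 : (fun h => H (z + h)) @ (0 : E) --> H z.
    apply: (@cvg_comp _ _ _ (fun h : E => z + h) H (nbhs (0 : E)) (nbhs z)).
      exact: czh.
    exact: inverse_continuous.
  rewrite -[X in _ --> X](subrr (H z)).
  apply: (@cvgB _ E _ (nbhs (0 : E)) _ (fun h => H (z + h)) (fun=> H z)).
    exact: cH0.
  exact: cvg_cst.
have la' : \forall h \near (0 : E), `|Phi (H z + (H (z + h) - H z)) - Phi (H z)
    - 'd Phi (H z) (H (z + h) - H z)| <= eps * `|H (z + h) - H z| := cH _ la.
have nV : \forall h \near (0 : E), V (z + h).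
  exact: ((nbhs0P V z).1 (open_nbhs_nbhs (conj oV Vz))).
near=> h.
have Vzh : V (z + h) by near: h.
pose w := H (z + h) - H z.
have lw : `|Phi (H z + w) - Phi (H z) - 'd Phi (H z) w| <= eps * `|w|.
  by rewrite /w; near: h.
have Hw : H z + w = H (z + h) by rewrite /w addrC subrK.
rewrite Hw (PhiH Vzh) (PhiH Vz) (addrC z h) addrK -(deriveE w dPhi) in lw.
set r := h - _ in lw.
have hE : h = 'D_w Phi (H z) + r by rewrite /r addrC subrK.
have Bh : B (H z) h = w + B (H z) r.
  rewrite hE -[X in X + r]scale1r B_lin scale1r BA//.
rewrite -/w Bh opprD (addrA w) subrr add0r normrN.
have Br : `|B (H z) r| <= C * eps * `|w|.
  apply: le_trans (HC r) _; by rewrite -mulrA ler_pM2l.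
have wh : `|w| <= 2 * C * `|h|.
  have : `|w| <= C * `|h| + C * eps * `|w|.
    have wE : w = B (H z) h - B (H z) r by rewrite Bh addrK.
    rewrite {1}wE; by apply: le_trans (ler_normB _ _) _; apply: lerD.
  have : C * eps * `|w| <= 1 / 2 * `|w| by rewrite ler_wpM2r.
  suff key (p q s : R) : p <= 1 / 2 * s -> s <= q + p -> s <= 2 * q.
    by move=> h1 h2; have := key _ _ _ h1 h2; rewrite mulrA.
  by move=> h1 h2; lra.
apply: le_trans Br _.
apply: (@le_trans _ _ (C * eps * (2 * C * `|h|))).
  by rewrite ler_wpM2l// mulr_ge0// ltW.
rewrite (_ : _ * _ = 2 * C ^+ 2 * eps * `|h|); last by ring.
by rewrite ler_wpM2r.
Unshelve. all: by end_near. Qed.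

Lemma inverse_deriv z : V z -> differentiable H z /\
  forall v, 'D_v H z = B (H z) v.
Proof.
move=> Vz; have [C C0 HC] := B_bound (H z).
have P i : differentiable (fun z => H z 0 i) z /\
    forall v, 'D_v (fun z => H z 0 i) z = (B (H z) v) 0 i.
  apply: (@differentiable_of_linear _ _ _ _ _ C).
  - by move=> k u v; rewrite B_lin !mxE.
  - by move=> h; apply: le_trans (coord_le_norm _ _) _.
  - move=> e e0; apply: filterS (HD Vz e0) => h; apply: le_trans.
    by apply: le_trans (coord_le_norm _ i); rewrite !mxE.
have dH : differentiable H z.
  rewrite (_ : H = fun x => \sum_i H x 0 i *: delta_mx 0 i); last first.
    by apply/funext => x; exact: row_sum_delta.
  rewrite -fct_sumE; apply: differentiable_sum => i; apply: differentiableZl; exact: (P i).1.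
split=> // v; apply/rowP => i; rewrite derive_coord//; exact: (P i).2.
Qed.

(** Bootstrapping: the derivative of H is a polynomial in the derivatives of Phi
    evaluated at H, hence as regular as H. *)
Theorem inverse_smooth : smooth_on V H.
Proof.
elim=> [|k IH]; first by move=> z; exact: inverse_continuous.
split=> [z /inverse_deriv[]//|v].
apply: (@Ck_ext _ _ _ _ _ (fun z => B (H z) v)) => //.
  by move=> z Vz; rewrite (inverse_deriv Vz).2.
have VL z : V z -> L (H z) by move=> Vz; exact/KL/HK.
have comp e j : Ck k V (fun z => ('D_e Phi (H z)) 0 j).
  apply: (@Ck_comp_row _ _ _ _ _ L (fun x => ('D_e Phi x) 0 j) H) => //.
  by apply: Ck_coord => //; exact: smooth_D.
have om e : Ck k V (fun z => omega v ('D_e Phi (H z))).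
  rewrite /omega; apply: Ck_sum => // i; apply: CkD => //.
    by apply: (CkM oV); [exact: Ck_cst|exact: comp].
  rewrite (_ : (fun z => _) = fun z => (- ycoord v i) * ('D_e Phi (H z)) 0 (lshift n i)).
    by apply: (CkM oV); [exact: Ck_cst|exact: comp].
  by apply/funext => z; rewrite mulNr.
apply: Ck_row => // i; rewrite /B.
case: (splitP i) => j ij.
  apply: (@Ck_ext _ _ _ _ _ (fun z => omega v ('D_(ey j) Phi (H z)))) => // z _.
  have -> : i = lshift n j by exact/val_inj.
  by rewrite row_mxEl mxE.
apply: (@Ck_ext _ _ _ _ _ (fun z => -1 * omega v ('D_(ex j) Phi (H z)))) => //.
  move=> z _; have -> : i = rshift n j by exact/val_inj.
  by rewrite row_mxEr mxE mulN1r.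
by apply: CkM => //; exact: Ck_cst.
Qed.

End SymplecticInverse.

(** * Elliptic integrals and ratios of periods *)

Section Elliptic.
Context {R : realType}.
Implicit Types (s z x k a b : R).

Let S (s : R) : R := sin (2 * s) ^+ 2.
Let modulus (s z : R) : R := z * S s + (2 - S s).
Let phi0 (r : R) : R := (Num.sqrt r)^-1.
Let phi1 (r : R) : R := (r * Num.sqrt r)^-1.
Let phi2 (r : R) : R := (r ^+ 2 * Num.sqrt r)^-1.

(** Up to normalization, a complete elliptic integral as a function of the
    modulus z; ell1 and ell2 are its first derivatives up to constants. *)
Definition ell0 (z : R) : R := parint 0 (2 * pi) modulus (fun=> 1) phi0 z.
Definition ell1 (z : R) : R := parint 0 (2 * pi) modulus S phi1 z.
Definition ell2 (z : R) : R := parint 0 (2 * pi) modulus (fun s => S s ^+ 2) phi2 z.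

Let pos : set R := [set x | 0 < x].
Let opos : open pos. Proof. exact: open_gt. Qed.

Let S01 s : 0 <= S s <= 1.
Proof.
by rewrite sqr_ge0/=; have := cos2Dsin2 (2 * s); have := sqr_ge0 (cos (2 * s)); rewrite /S; lra.
Qed.

Let mod_ge1 s z : 0 < z -> 1 <= modulus s z.
Proof.
move=> z0; have /andP[s0 s1] := S01 s; rewrite /modulus.
have h : 0 <= z * S s by rewrite mulr_ge0// ltW.
by lra.
Qed.

Let pi2 : 0 < 2 * pi :> R. Proof. by rewrite mulr_gt0// pi_gt0. Qed.

Let contS a b : cont_on a b S.
Proof.
move=> s _; have c : {for s, continuous (fun s : R => sin (2 * s))}.
  apply: (@continuous_comp _ _ _ (fun s => 2 * s) sin).
    by apply: continuousM; [exact: cst_continuous|exact: cvg_id].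
  exact: continuous_sin.
exact: (@continuousM _ _ (fun s => sin (2 * s)) (fun s => sin (2 * s)) s c c).
Qed.

Let d_sqrt (x : R) : 0 < x -> is_derive x 1 Num.sqrt (2 * Num.sqrt x)^-1.
Proof. by move=> x0; exact: is_derive1_sqrt. Qed.

Let d_phi0 x : pos x -> is_derive x 1 phi0 (- (1 / 2) * phi1 x).
Proof.
move=> x0; have sx : Num.sqrt x != 0 by rewrite gt_eqF// sqrtr_gt0.
apply: is_derive_eq (is_deriveV_fun (d_sqrt x0) sx) _.
have sq : Num.sqrt x ^+ 2 = x by rewrite sqr_sqrtr// ltW.
by rewrite /phi1 -{3}sq; field.
Qed.

Let d_phi1 x : pos x -> is_derive x 1 phi1 (- (3 / 2) * phi2 x).
Proof.
move=> x0; have sx : 0 < Num.sqrt x by rewrite sqrtr_gt0.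
have dd := is_deriveM_fun (is_derive_id x 1) (d_sqrt x0).
have nz : x * Num.sqrt x != 0 by rewrite mulf_neq0// gt_eqF.
apply: is_derive_eq (is_deriveV_fun dd nz) _.
have sq : Num.sqrt x ^+ 2 = x by rewrite sqr_sqrtr// ltW.
rewrite /phi2; set t := Num.sqrt x in sx sq *; rewrite -sq; field.
by rewrite gt_eqF.
Qed.

Let sid : smooth_on pos (fun x : R => x). Proof. exact: smooth_id. Qed.
Let ssq : smooth_on pos (@Num.sqrt R). Proof. exact: smooth_sqrt. Qed.

Let s_phi0 : smooth_on pos phi0.
Proof. by apply: smoothV => // x x0; rewrite gt_eqF// sqrtr_gt0. Qed.

Let s_phi1 : smooth_on pos phi1.
Proof.
apply: (smoothV opos _ (smoothM opos sid ssq)) => x x0.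
by rewrite mulf_neq0// gt_eqF// sqrtr_gt0.
Qed.

Let s_phi2 : smooth_on pos phi2.
Proof.
apply: (smoothV opos _ (smoothM opos (smoothX2 opos sid) ssq)) => x x0.
by rewrite mulf_neq0 ?expf_neq0// gt_eqF// sqrtr_gt0.
Qed.

Let contm s z : {for s, continuous (modulus ^~ z)}.
Proof.
have cS : {for s, continuous S} by apply: (@contS s s); rewrite lexx.
apply: continuousD; first by apply: continuousM; [exact: cst_continuous|].
by apply: continuousB; [exact: cst_continuous|].
Qed.

Let mod_pos s z : pos z -> pos (modulus s z).
Proof. by move=> z0; apply: lt_le_trans (mod_ge1 s z0). Qed.

Let par_ell (c phi : R -> R) z : cont_on 0 (2 * pi) c -> smooth_on pos phi ->
  pos z -> is_derive z 1 (parint 0 (2 * pi) modulus c phi)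
    (parint 0 (2 * pi) modulus (fun s => c s * S s) ('D_1 phi) z).
Proof.
move=> cc sphi z0.
have [df Df] : differentiable (parint 0 (2 * pi) modulus c phi) z /\ forall v,
    'D_v (parint 0 (2 * pi) modulus c phi) z =
    parint 0 (2 * pi) modulus (fun s => c s * (v * S s)) ('D_1 phi) z.
  apply: (@parint_diff _ _ 0 (2 * pi) pos pos modulus (fun s v => v * S s) 1) => //.
  - by move=> s x h; rewrite /modulus; ring.
  - by move=> s k u v; rewrite mulrDl -mulrA.
  - move=> s h _; have /andP[s0 s1] := S01 s.
    by rewrite normrM mulrC ler_wpM2r// ger0_norm.
  - move=> h s sab; apply: continuousM; first exact: cst_continuous.
    exact: (contS sab).
  - by move=> x s _; exact: contm.
  - by move=> s x _; exact: mod_pos.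
  - by move=> x y /= x0 y0 t /andP[xt ty]; exact: lt_le_trans xt.
apply: DeriveDef; first exact: diff_derivable.
by rewrite (Df (1 : R)); apply: eq_segint => s _; rewrite mul1r.
Qed.

Let contp (c phi : R -> R) z : cont_on 0 (2 * pi) c -> smooth_on pos phi -> pos z ->
  cont_on 0 (2 * pi) (fun s => c s * phi (modulus s z)).
Proof.
move=> cc sphi z0; apply: cont_onM => // s sab.
apply: (@continuous_comp _ _ _ (modulus ^~ z) phi); first exact: contm.
exact: (smooth_cont sphi (mod_pos s z0)).
Qed.

Let cont1 a b : cont_on a b (fun=> 1 : R).
Proof. by move=> ? _; exact: cst_continuous. Qed.

Let cont0 z : pos z -> cont_on 0 (2 * pi) (fun s => 1 * phi0 (modulus s z)).
Proof. by move=> z0; exact: (contp (@cont1 _ _) s_phi0 z0). Qed.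
Let contE1 z : pos z -> cont_on 0 (2 * pi) (fun s => S s * phi1 (modulus s z)).
Proof. by move=> z0; exact: (contp (@contS _ _) s_phi1 z0). Qed.
Let contS2 : cont_on 0 (2 * pi) (fun s => S s ^+ 2).
Proof. by under eq_fun do rewrite expr2; exact: (cont_onM (@contS _ _) (@contS _ _)). Qed.
Let contE2 z : pos z -> cont_on 0 (2 * pi) (fun s => S s ^+ 2 * phi2 (modulus s z)).
Proof. by move=> z0; exact: (contp contS2 s_phi2 z0). Qed.

Lemma ell0_deriv z : 0 < z -> is_derive z 1 ell0 (- (1 / 2) * ell1 z).
Proof.
move=> z0; apply: is_derive_eq (par_ell (@cont1 _ _) s_phi0 z0) _.
rewrite /ell1 /parint -segintZ; last exact: contE1.
apply: eq_segint => s _; have [_ ->] := d_phi0 (mod_pos s z0); ring.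
Qed.

Lemma ell1_deriv z : 0 < z -> is_derive z 1 ell1 (- (3 / 2) * ell2 z).
Proof.
move=> z0; apply: is_derive_eq (par_ell (@contS _ _) s_phi1 z0) _.
rewrite /ell2 /parint -segintZ; last exact: contE2.
apply: eq_segint => s _; have [_ ->] := d_phi1 (mod_pos s z0); ring.
Qed.

Let sqrt_pos s z : pos z -> 0 < Num.sqrt (modulus s z).
Proof. by move=> z0; rewrite sqrtr_gt0; exact: mod_pos. Qed.

Lemma ell0_gt0 z : 0 < z -> 0 < ell0 z.
Proof.
move=> z0; apply: segint_gt0 => //; first exact: cont0.
by move=> s _; rewrite mul1r invr_gt0; exact: sqrt_pos.
Qed.

Lemma ell1_ge0 z : 0 < z -> 0 <= ell1 z.
Proof.
move=> z0; apply: segint_ge0 => s _; have /andP[s0 _] := S01 s.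
by rewrite mulr_ge0// invr_ge0 mulr_ge0 ?sqrtr_ge0// ltW//; exact: mod_pos.
Qed.

Let contk k : cont_on 0 (2 * pi) (fun=> k : R).
Proof. by move=> ? _; exact: cst_continuous. Qed.

(** The modulus is at least z times the squared sine in the numerator. *)
Lemma ell1_le z : 0 < z -> z * ell1 z <= ell0 z.
Proof.
move=> z0; rewrite /ell1 /ell0 /parint -segintZ; last exact: contE1.
apply: le_segint => [||s _]; first exact: (cont_onM (@contk z) (@contE1 z z0)).
  exact: cont0.
have st := sqrt_pos s z0; have mt := mod_pos s z0; have /andP[s0 s1] := S01 s.
rewrite mul1r /phi1 /phi0.
have -> : z * (S s * (modulus s z * Num.sqrt (modulus s z))^-1) =
   z * S s / modulus s z * (Num.sqrt (modulus s z))^-1.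
  by field; rewrite !gt_eqF.
apply: ler_piMl; first by rewrite invr_ge0 ltW.
by rewrite ler_pdivrMr// mul1r /modulus; lra.
Qed.

Lemma ell2_le z : 0 < z <= 1 -> z * ell2 z <= 1 / 2 * ell1 z.
Proof.
move=> /andP[z0 z1]; rewrite /ell1 /ell2 /parint -!segintZ; [|exact: contE1|exact: contE2].
apply: le_segint => [||s _]; first exact: (cont_onM (@contk z) (@contE2 z z0)).
  exact: (cont_onM (@contk (1 / 2)) (@contE1 z z0)).
have st := sqrt_pos s z0; have mt := mod_pos s z0; have /andP[s0 s1] := S01 s.
rewrite /phi1 /phi2.
have -> : z * (S s ^+ 2 * (modulus s z ^+ 2 * Num.sqrt (modulus s z))^-1) =
   (z * S s / modulus s z) * (S s * (modulus s z * Num.sqrt (modulus s z))^-1).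
  by field; rewrite !gt_eqF.
apply: ler_wpM2r; first by rewrite mulr_ge0// invr_ge0 mulr_ge0// ltW.
rewrite ler_pdivrMr// /modulus; nra.
Qed.

(** The integrals ell0, ell1 and ell2 are the moments 0, 1 and 2 of
    sin (2 s) ^ 2 / modulus for a positive weight. *)
Lemma ell_cauchy_schwarz z : 0 < z -> ell1 z ^+ 2 <= ell0 z * ell2 z.
Proof.
move=> z0; have c0 := @cont0 z z0; have c1 := @contE1 z z0; have c2 := @contE2 z z0.
have E0 : segint 0 (2 * pi) (fun s => 1 * phi0 (modulus s z)) = ell0 z by [].
have E1 : segint 0 (2 * pi) (fun s => S s * phi1 (modulus s z)) = ell1 z by [].
have E2 : segint 0 (2 * pi) (fun s => S s ^+ 2 * phi2 (modulus s z)) = ell2 z by [].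
have E : segint 0 (2 * pi) (fun s =>
     ell1 z ^+ 2 * (1 * phi0 (modulus s z)) -
     (2 * ell0 z * ell1 z) * (S s * phi1 (modulus s z)) +
     ell0 z ^+ 2 * (S s ^+ 2 * phi2 (modulus s z))) =
   ell0 z * (ell0 z * ell2 z - ell1 z ^+ 2).
  have k0 := cont_onM (@contk (ell1 z ^+ 2)) c0.
  have k1 := cont_onM (@contk (2 * ell0 z * ell1 z)) c1.
  have k2 := cont_onM (@contk (ell0 z ^+ 2)) c2.
  rewrite (segintD (cont_onB k0 k1) k2) (segintB k0 k1) (segintZ _ c0) (segintZ _ c1) (segintZ _ c2).
  by rewrite E0 E1 E2; ring.
have : 0 <= ell0 z * (ell0 z * ell2 z - ell1 z ^+ 2).
  rewrite -E; apply: segint_ge0 => s _.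
  have st := sqrt_pos s z0; have mt := mod_pos s z0.
  rewrite (_ : _ + _ = (ell1 z - ell0 z * S s / modulus s z) ^+ 2 / Num.sqrt (modulus s z)).
    by rewrite divr_ge0 ?sqr_ge0// ltW.
  by rewrite /phi0 /phi1 /phi2; field; rewrite !gt_eqF.
by rewrite pmulr_rge0 ?ell0_gt0// subr_ge0.
Qed.

(** The linear differential equation of second order satisfied by complete
    elliptic integrals: the derivative of F integrates to 0 over a full turn. *)
Lemma ell_ode z : 0 < z ->
  ell0 z / 4 = z * ell1 z + 3 / 4 * (1 - z ^+ 2) * ell2 z.
Proof.
move=> z0; have c0 := @cont0 z z0; have c1 := @contE1 z z0; have c2 := @contE2 z z0.
have E0 : segint 0 (2 * pi) (fun s => 1 * phi0 (modulus s z)) = ell0 z by [].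
have E1 : segint 0 (2 * pi) (fun s => S s * phi1 (modulus s z)) = ell1 z by [].
have E2 : segint 0 (2 * pi) (fun s => S s ^+ 2 * phi2 (modulus s z)) = ell2 z by [].
pose F (s : R) : R := sin (2 * s) * cos (2 * s) * phi1 (modulus s z).
have d2 (s : R) : is_derive s 1 (fun s => 2 * s) 2.
  by apply: is_derive_eq (is_deriveZ_fun 2 (is_derive_id s 1)) _; rewrite mulr1.
have ds (s : R) : is_derive s 1 (fun s => sin (2 * s)) (cos (2 * s) * 2).
  exact: (@is_derive_comp_fun _ sin (fun s => 2 * s) _ _ _ (is_derive_sin _) (d2 s)).
have dc (s : R) : is_derive s 1 (fun s => cos (2 * s)) (- sin (2 * s) * 2).
  exact: (@is_derive_comp_fun _ cos (fun s => 2 * s) _ _ _ (is_derive_cos _) (d2 s)).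
have dS (s : R) : is_derive s 1 S (4 * (sin (2 * s) * cos (2 * s))).
  by rewrite /S; under eq_fun do rewrite expr2;
    apply: is_derive_eq (is_deriveM_fun (ds s) (ds s)) _; ring.
have dm (s : R) : is_derive s 1 (modulus ^~ z) (4 * (z - 1) * (sin (2 * s) * cos (2 * s))).
  apply: is_derive_eq (is_deriveD_fun (is_deriveZ_fun z (dS s))
    (is_deriveB_fun (is_derive_cst (2 : R) s 1) (dS s))) _; ring.
have dF (s : R) : 0 <= s <= 2 * pi -> is_derive s 1 F
   (1 * phi0 (modulus s z) - (4 * z) * (S s * phi1 (modulus s z))
    - (3 * (1 - z ^+ 2)) * (S s ^+ 2 * phi2 (modulus s z))).
  move=> _.
  have dp := @is_derive_comp_fun _ phi1 (modulus ^~ z) _ _ _ (d_phi1 (mod_pos s z0)) (dm s).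
  apply: is_derive_eq (is_deriveM_fun (is_deriveM_fun (ds s) (dc s)) dp) _.
  have st := sqrt_pos s z0; have mt := mod_pos s z0.
  rewrite /phi0 /phi1 /phi2 /S.
  have ev : cos (2 * s) ^+ 2 = 1 - sin (2 * s) ^+ 2.
    by rewrite sin2cos2; ring.
  have em : modulus s z = z * sin (2 * s) ^+ 2 + (2 - sin (2 * s) ^+ 2) by [].
  suff key (u v m t : R) : v ^+ 2 = 1 - u ^+ 2 -> m = z * u ^+ 2 + (2 - u ^+ 2) ->
      m != 0 -> t != 0 ->
      u * v * (- (3 / 2) * (m ^+ 2 * t)^-1 * (4 * (z - 1) * (u * v))) +
      (m * t)^-1 * (u * (- u * 2) + v * (v * 2)) =
      1 * t^-1 - 4 * z * (u ^+ 2 * (m * t)^-1) -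
      3 * (1 - z ^+ 2) * ((u ^+ 2) ^+ 2 * (m ^+ 2 * t)^-1).
    by apply: key; rewrite ?gt_eqF.
  move=> ev' em' m0 t0.
  transitivity ((2 * (v ^+ 2 - u ^+ 2) * m - 6 * (z - 1) * u ^+ 2 * v ^+ 2) /
     (m ^+ 2 * t)); first by field; rewrite m0 t0.
  transitivity ((m ^+ 2 - 4 * z * u ^+ 2 * m - 3 * (1 - z ^+ 2) * u ^+ 4) /
     (m ^+ 2 * t)); last by field; rewrite m0 t0.
  by congr (_ / _); rewrite ev' em'; ring.
have k1 := cont_onM (@contk (4 * z)) c1.
have k2 := cont_onM (@contk (3 * (1 - z ^+ 2))) c2.
have := segint_FTC pi2 (cont_onB (cont_onB c0 k1) k2) dF.
rewrite (segintB (cont_onB c0 k1) k2) (segintB c0 k1) (segintZ _ c1) (segintZ _ c2).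
rewrite E0 E1 E2.
have -> : F (2 * pi) = 0.
  rewrite /F; have -> : sin (2 * (2 * pi)) = 0 :> R.
    by rewrite (_ : 2 * (2 * pi) = 0 + (Posz 2)%:~R * (2 * pi)) ?sinDint ?sin0// add0r.
  by rewrite !mul0r.
have -> : F 0 = 0 by rewrite /F mulr0 sin0 !mul0r.
by move=> E; lra.
Qed.

(** Minus twice the derivative of ln ell0 with respect to ln z. *)
Definition slope z : R := z * ell1 z / ell0 z.

Lemma slope_bounds z : 0 < z -> 0 <= slope z <= 1.
Proof.
move=> z0; have p0 := ell0_gt0 z0.
apply/andP; split; last by rewrite ler_pdivrMr// mul1r ell1_le.
by rewrite divr_ge0 ?(ltW p0)// mulr_ge0 ?ell1_ge0// ltW.
Qed.

Lemma slope_deriv z : 0 < z -> is_derive z 1 slope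
  (ell1 z / ell0 z - 3 / 2 * z * (ell2 z / ell0 z) + 1 / 2 * z * (ell1 z / ell0 z) ^+ 2).
Proof.
move=> z0; have p0 := ell0_gt0 z0; have p0' : ell0 z != 0 by rewrite gt_eqF.
have d1 := is_deriveM_fun (is_derive_id z 1) (ell1_deriv z0).
apply: is_derive_eq (is_deriveM_fun d1 (is_deriveV_fun (ell0_deriv z0) p0')) _.
by rewrite /=; field.
Qed.

(** On (0, 1] the inequality z * ell2 <= ell1 / 2 makes all terms of the
    derivative combine to a nonnegative sum. *)
Lemma slope_nondecr x z : 0 < x -> x <= z -> z <= 1 -> slope x <= slope z.
Proof.
move=> x0 xz z1.
apply: (nondecr_of_deriv xz (fun s h => slope_deriv (lt_le_trans x0 (andP h).1))).
move=> s /andP[xs sz]; have s0 : 0 < s by exact: lt_le_trans xs.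
have p0 := ell0_gt0 s0.
have s01 : 0 < s <= 1 by rewrite s0 (le_trans sz).
have h : s * (ell2 s / ell0 s) <= 1 / 2 * (ell1 s / ell0 s).
  by rewrite !mulrA ler_pM2r ?invr_gt0// ell2_le.
have q0 : 0 <= ell1 s / ell0 s by rewrite divr_ge0 ?ell1_ge0// ltW.
have t0 : 0 <= s * (ell1 s / ell0 s) ^+ 2 by rewrite mulr_ge0 ?sqr_ge0// ltW.
suff key (p q : R) : s * q <= 1 / 2 * p -> 0 <= p -> 0 <= s * p ^+ 2 ->
    0 <= p - 3 / 2 * s * q + 1 / 2 * s * p ^+ 2 by exact: key.
rewrite -!mulrA; move: (s * q) (s * p ^+ 2) => A B *; lra.
Qed.

Let ell2_ge0 z : 0 < z -> 0 <= ell2 z.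
Proof.
move=> z0; apply: segint_ge0 => s _.
have st := sqrt_pos s z0; have mt := mod_pos s z0.
by rewrite mulr_ge0 ?sqr_ge0// invr_ge0 mulr_ge0 ?sqr_ge0// ltW.
Qed.

(** In the differential equation the coefficient of ell2 changes sign at 1,
    where the slope is 1 / 4. *)
Lemma slope_ge z : 1 <= z -> 1 / 4 <= slope z.
Proof.
move=> z1; have z0 : 0 < z by exact: lt_le_trans z1.
rewrite ler_pdivlMr ?ell0_gt0//; have := ell_ode z0.
have : 0 <= (z ^+ 2 - 1) * ell2 z.
  by rewrite mulr_ge0 ?ell2_ge0// subr_ge0 exprn_ege1.
have -> : 3 / 4 * (1 - z ^+ 2) * ell2 z = - (3 / 4 * ((z ^+ 2 - 1) * ell2 z)) by ring.
by move: (_ * ell2 z) (z * ell1 z) (ell0 z) => A B C ? ?; lra.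
Qed.

Lemma slope_le z : 0 < z <= 1 -> slope z <= 1 / 4.
Proof.
move=> /andP[z0 z1].
rewrite ler_pdivrMr ?ell0_gt0//; have := ell_ode z0.
have : 0 <= (1 - z ^+ 2) * ell2 z.
  by rewrite mulr_ge0 ?ell2_ge0// subr_ge0 exprn_ile1// ltW.
rewrite -mulrA.
by move: (_ * ell2 z) (z * ell1 z) (ell0 z) => A B C ? ?; lra.
Qed.

Lemma slope_mono x z : 0 < x -> x <= 1 -> x <= z -> slope x <= slope z.
Proof.
move=> x0 x1 xz; have [z1|z1] := leP z 1; first exact: slope_nondecr.
by apply: le_trans (slope_le _) (slope_ge (ltW z1)); rewrite x0.
Qed.

(** By the Cauchy-Schwarz inequality between the moments, the derivative is a
    sum of nonnegative terms. *)
Lemma sq_slope_mono x z : 0 < x -> x <= z ->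
  x ^+ 2 * (1 - slope x) <= z ^+ 2 * (1 - slope z).
Proof.
move=> x0 xz.
have d s : x <= s <= z -> is_derive s 1 (fun s => s ^+ 2 * (1 - slope s))
   (s ^+ 2 * (0 - (ell1 s / ell0 s - 3 / 2 * s * (ell2 s / ell0 s) +
      1 / 2 * s * (ell1 s / ell0 s) ^+ 2)) + (1 - slope s) * (s * 1 + s * 1)).
  move=> /andP[xs _]; have s0 : 0 < s by exact: lt_le_trans xs.
  have dsq : is_derive s 1 (fun s : R => s ^+ 2) (s * 1 + s * 1).
    under eq_fun do rewrite expr2.
    exact: (is_deriveM_fun (is_derive_id s 1) (is_derive_id s 1)).
  exact: (is_deriveM_fun dsq
    (is_deriveB_fun (is_derive_cst (1 : R) s 1) (slope_deriv s0))).
apply: (nondecr_of_deriv xz d) => s /andP[xs _].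
have s0 : 0 < s by exact: lt_le_trans xs.
have p0 := ell0_gt0 s0; have /andP[e0 e1] := slope_bounds s0.
have cs : (ell1 s / ell0 s) ^+ 2 <= ell2 s / ell0 s.
  rewrite expr_div_n ler_pdivrMr ?exprn_gt0// expr2 mulrA divfK ?gt_eqF//.
  by rewrite -expr2 [leRHS]mulrC ell_cauchy_schwarz.
have es : slope s = s * (ell1 s / ell0 s) by rewrite /slope mulrA.
have -> : s ^+ 2 * (0 - (ell1 s / ell0 s - 3 / 2 * s * (ell2 s / ell0 s) +
      1 / 2 * s * (ell1 s / ell0 s) ^+ 2)) + (1 - slope s) * (s * 1 + s * 1) =
   s * ((1 - slope s) * (2 - slope s) +
     3 / 2 * s ^+ 2 * (ell2 s / ell0 s - (ell1 s / ell0 s) ^+ 2)).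
  by rewrite es; field; rewrite gt_eqF.
apply: mulr_ge0; first exact: ltW.
apply: addr_ge0; first by apply: mulr_ge0; lra.
apply: mulr_ge0; last by rewrite subr_ge0.
by apply: mulr_ge0; [lra|exact: sqr_ge0].
Qed.

(** The common shape of the periods of the two oscillators, as functions of a
    separation constant q; the parameter sigma distinguishes them. *)
Definition ell_period (sigma q : R) : R :=
  (Num.sqrt (Num.sqrt (4 * q + sigma)))^-1 * ell0 (q / Num.sqrt (4 * q + sigma)).

(** Minus the logarithmic derivative of ell_period with respect to q; at fixed
    q it depends on sigma through z only, and increases with z. *)
Let decay (sigma q : R) : R := let z := q / Num.sqrt (4 * q + sigma) in
  (z ^+ 2 * (1 - slope z) + q / 2 * slope z) / q ^+ 2.

Lemma ell_period_gt0 (sigma q : R) : 0 < q -> 0 < 4 * q + sigma ->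
  0 < ell_period sigma q.
Proof.
move=> q0 D0; have r0 : 0 < Num.sqrt (4 * q + sigma) by rewrite sqrtr_gt0.
by rewrite mulr_gt0 ?invr_gt0 ?sqrtr_gt0//; apply: ell0_gt0; rewrite divr_gt0.
Qed.

Lemma ell_period_deriv (sigma q : R) : 0 < q -> 0 < 4 * q + sigma ->
  is_derive q 1 (ell_period sigma) (- ell_period sigma q * decay sigma q).
Proof.
move=> q0 D0; pose r := Num.sqrt (4 * q + sigma); pose t := Num.sqrt r.
have r0 : 0 < r by rewrite sqrtr_gt0.
have t0 : 0 < t by rewrite sqrtr_gt0.
have t2 : t ^+ 2 = r by rewrite sqr_sqrtr// ltW.
have z0 : 0 < q / r by rewrite divr_gt0.
have dD : is_derive q 1 (fun q => 4 * q + sigma) 4.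
  apply: is_derive_eq (is_deriveD_fun (is_deriveZ_fun 4 (is_derive_id q 1))
    (is_derive_cst sigma q 1)) _; ring.
have dr : is_derive q 1 (fun q => Num.sqrt (4 * q + sigma)) ((2 * r)^-1 * 4).
  exact: (@is_derive_comp_fun _ Num.sqrt (fun q => 4 * q + sigma) _ _ _ (d_sqrt D0) dD).
have dt : is_derive q 1 (fun q => Num.sqrt (Num.sqrt (4 * q + sigma)))
    ((2 * t)^-1 * ((2 * r)^-1 * 4)).
  exact: (@is_derive_comp_fun _ Num.sqrt (fun q => Num.sqrt (4 * q + sigma)) _ _ _
    (d_sqrt r0) dr).
have rn : r != 0 by rewrite gt_eqF.
have tn : t != 0 by rewrite gt_eqF.
have dtV := is_deriveV_fun dt tn.
have dz := is_deriveM_fun (is_derive_id q 1) (is_deriveV_fun dr rn).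
have dE := @is_derive_comp_fun _ ell0 (fun q => q * (Num.sqrt (4 * q + sigma))^-1)
  _ _ _ (ell0_deriv z0) dz.
apply: is_derive_eq (is_deriveM_fun dtV dE) _.
have p0 : ell0 (q / r) != 0 by rewrite gt_eqF// ell0_gt0.
rewrite /ell_period /decay /slope -/r -/t /=.
move: (ell0 (q / r)) (ell1 (q / r)) p0 => A B A0.
rewrite -t2; field.
by rewrite A0 tn gt_eqF.
Qed.

(** Increasing sigma decreases z, and the logarithmic derivative - decay is
    decreasing in z; slope_mono applies because the smaller z is at most 1. *)
Lemma ell_period_ratio (s1 s2 q q' : R) : s1 <= s2 -> 0 < q -> q <= q' ->
  (forall x, q <= x <= q' -> 0 < 4 * x + s1) ->
  (forall x, q <= x <= q' -> x ^+ 2 <= 4 * x + s2) ->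
  ell_period s2 q * ell_period s1 q' <= ell_period s2 q' * ell_period s1 q.
Proof.
move=> s12 q0 qq D1 D2.
have X0 x : q <= x <= q' -> 0 < x by move=> /andP[qx _]; exact: lt_le_trans qx.
have D2' x : q <= x <= q' -> 0 < 4 * x + s2.
  by move=> h; apply: lt_le_trans (D1 x h) _; rewrite lerD2l.
have d x : q <= x <= q' ->
    is_derive x 1 (fun x => ell_period s2 x * (ell_period s1 x)^-1)
      (ell_period s2 x / ell_period s1 x * (decay s1 x - decay s2 x)).
  move=> h; have x0 := X0 x h.
  have p1 := ell_period_gt0 x0 (D1 x h).
  have n1 : ell_period s1 x != 0 by rewrite gt_eqF.
  apply: is_derive_eq (is_deriveM_fun (ell_period_deriv x0 (D2' x h))
    (is_deriveV_fun (ell_period_deriv x0 (D1 x h)) n1)) _.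
  suff key (A B a b : R) : B != 0 ->
      A * (- (- B * a) / B ^+ 2) + B^-1 * (- A * b) = A / B * (a - b).
    exact: key.
  by move=> B0; field.
have lq : q <= q <= q' by rewrite lexx.
have lq' : q <= q' <= q' by rewrite lexx qq.
have p1 : 0 < ell_period s1 q := ell_period_gt0 q0 (D1 q lq).
have p2 : 0 < ell_period s1 q' := ell_period_gt0 (X0 q' lq') (D1 q' lq').
suff mono : ell_period s2 q / ell_period s1 q <= ell_period s2 q' / ell_period s1 q'.
  by move: mono; rewrite (ler_pdivrMr _ _ p1) mulrAC (ler_pdivlMr _ _ p2).
apply: (nondecr_of_deriv qq d).
move=> x h; have x0 := X0 x h; have d1 := D1 x h; have d2 := D2' x h.
apply: mulr_ge0.
  exact: divr_ge0 (ltW (ell_period_gt0 x0 d2)) (ltW (ell_period_gt0 x0 d1)).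
rewrite subr_ge0; apply: ler_wpM2r; first by rewrite invr_ge0 sqr_ge0.
have r1 : 0 < Num.sqrt (4 * x + s1) by rewrite sqrtr_gt0.
have r2 : 0 < Num.sqrt (4 * x + s2) by rewrite sqrtr_gt0.
have z2 : 0 < x / Num.sqrt (4 * x + s2) by rewrite divr_gt0.
have zz : x / Num.sqrt (4 * x + s2) <= x / Num.sqrt (4 * x + s1).
  by apply: ler_wpM2l; [exact: ltW|rewrite lef_pV2 ?posrE//; apply: ler_wsqrtr; rewrite lerD2l].
have z21 : x / Num.sqrt (4 * x + s2) <= 1.
  rewrite ler_pdivrMr// mul1r -[leLHS](ger0_norm (ltW x0)) -sqrtr_sqr.
  by apply: ler_wsqrtr; exact: D2.
apply: lerD; first exact: sq_slope_mono.
apply: ler_wpM2l; last exact: slope_mono.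
by apply: divr_ge0; [exact: ltW|].
Qed.

Lemma ell0E z : ell0 z = segint 0 (2 * pi)
  (fun s => (Num.sqrt (z * sin (2 * s) ^+ 2 + (2 - sin (2 * s) ^+ 2)))^-1).
Proof. by apply: eq_segint => s _; rewrite mul1r. Qed.

Lemma ell0_continuous z s : 0 < z -> {for s, continuous
  (fun s => (Num.sqrt (z * sin (2 * s) ^+ 2 + (2 - sin (2 * s) ^+ 2)))^-1)}.
Proof.
move=> z0; apply: (@continuous_comp _ _ _ (modulus ^~ z) phi0); first exact: contm.
exact: (smooth_cont s_phi0 (mod_pos s z0)).
Qed.

End Elliptic.

(** * The two separated wells *)

Section Well.
Context {R : realType}.
Implicit Types (a b sg y q w S : R).

(** Both degrees of freedom have kinetic energy p ^ 2 / 2 and potential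
    w * (b + sg * a * w), up to constants, for a function w of the position whose
    derivative S satisfies S ^ 2 = w * (2 + sg * w): w is cosh mu - 1 for sg = 1
    and 1 + cos nu for sg = - 1. The coordinate X with X ^ 2 / 2 equal to the
    potential turns the energy into (X ^ 2 + p ^ 2) / 2, and
    b + 2 * sg * a * w = wellQ (X ^ 2). *)
Definition wellQ a b sg y : R := Num.sqrt (b ^+ 2 + 2 * a * sg * y).
(** The derivative of the position with respect to X, as a function of X ^ 2. *)
Definition wellrt a b sg y : R :=
  Num.sqrt (2 * a * ((wellQ a b sg y + b) / (wellQ a b sg y + 4 * a - b))) / wellQ a b sg y.

Lemma wellQ_sq a b sg y : 0 < b ^+ 2 + 2 * a * sg * y ->
  0 < wellQ a b sg y /\ wellQ a b sg y ^+ 2 = b ^+ 2 + 2 * a * sg * y.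
Proof. by move=> h; rewrite sqrtr_gt0 sqr_sqrtr// ltW. Qed.

Section Profile.
Variables (a b sg : R) (J : set R).
Hypotheses (a0 : 0 < a) (b0 : 0 < b) (oJ : open J).
Hypothesis JQ : forall y, J y -> 0 < b ^+ 2 + 2 * a * sg * y.
Hypothesis JQ' : forall y, J y -> 0 < wellQ a b sg y + 4 * a - b.

Let frac_gt0 y : J y ->
  0 < 2 * a * ((wellQ a b sg y + b) / (wellQ a b sg y + 4 * a - b)).
Proof.
move=> Jy; have [q0 _] := wellQ_sq (JQ Jy).
by rewrite mulr_gt0 ?divr_gt0 ?JQ' ?addr_gt0 ?mulr_gt0.
Qed.

Lemma wellrt_gt0 y : J y -> 0 < wellrt a b sg y.
Proof.
move=> Jy; have [q0 _] := wellQ_sq (JQ Jy).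
by rewrite /wellrt divr_gt0// sqrtr_gt0 frac_gt0.
Qed.

Lemma smooth_wellrt : smooth_on J (wellrt a b sg).
Proof.
have cst (k : R) : smooth_on J (fun=> k) by exact: smooth_cst.
have sid : smooth_on J (fun y : R => y) by exact: smooth_id.
have sQ : smooth_on J (wellQ a b sg).
  apply: smooth_sqrt_comp => //.
  exact: (smoothD oJ (cst _) (smoothM oJ (cst _) sid)).
have sD : smooth_on J (fun y => wellQ a b sg y + 4 * a - b).
  exact: (smoothB oJ (smoothD oJ sQ (cst _)) (cst _)).
have sF : smooth_on J (fun y => 2 * a * ((wellQ a b sg y + b) / (wellQ a b sg y + 4 * a - b))).
  apply: (smoothM oJ (cst _)); apply: (smoothM oJ (smoothD oJ sQ (cst _))).
  by apply: smoothV => // y Jy; rewrite gt_eqF// JQ'.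
apply: (smoothM oJ (smooth_sqrt_comp oJ frac_gt0 sF)).
by apply: smoothV => // y Jy; rewrite gt_eqF// (wellQ_sq (JQ Jy)).1.
Qed.

End Profile.

(** X is S times this factor; no square root of w is taken, so that X is smooth
    and changes sign at the bottom of the well. *)
Definition wellg a b sg w : R := Num.sqrt (2 * (b + sg * a * w) / (2 + sg * w)).

Lemma wellg_sq a b sg w : 0 < b + sg * a * w -> 0 < 2 + sg * w ->
  0 < wellg a b sg w /\ wellg a b sg w ^+ 2 = 2 * (b + sg * a * w) / (2 + sg * w).
Proof.
move=> h1 h2; have h : 0 < 2 * (b + sg * a * w) / (2 + sg * w).
  by rewrite divr_gt0// mulr_gt0.
by rewrite sqrtr_gt0 sqr_sqrtr// ltW.
Qed.

Lemma well_sq a b sg w S : 0 < b + sg * a * w -> 0 < 2 + sg * w ->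
  S ^+ 2 = w * (2 + sg * w) ->
  (S * wellg a b sg w) ^+ 2 = 2 * w * (b + sg * a * w).
Proof.
move=> h1 h2 hS; rewrite exprMn (wellg_sq h1 h2).2 hS; field.
by rewrite gt_eqF.
Qed.

Lemma wellQ_well a b sg w : sg ^+ 2 = 1 -> 0 < b + 2 * sg * a * w ->
  wellQ a b sg (2 * w * (b + sg * a * w)) = b + 2 * sg * a * w.
Proof.
move=> sg2 h; rewrite /wellQ -[RHS]ger0_norm ?ltW// -sqrtr_sqr; congr Num.sqrt.
transitivity (b ^+ 2 + 4 * sg * a * w * b + 4 * sg ^+ 2 * a ^+ 2 * w ^+ 2); last by ring.
ring.
Qed.

Lemma wellrt_well a b sg w : 0 < a -> sg ^+ 2 = 1 -> 0 < b + 2 * sg * a * w ->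
  0 < 2 + sg * w ->
  wellrt a b sg (2 * w * (b + sg * a * w)) = wellg a b sg w / (b + 2 * sg * a * w).
Proof.
move=> a0 sg2 h h2; rewrite /wellrt wellQ_well// /wellg; congr (Num.sqrt _ / _).
by field; rewrite !gt_eqF//; nra.
Qed.

Lemma well_deriv a b sg (w S : R -> R) (t : R) : sg ^+ 2 = 1 ->
  is_derive t 1 w (S t) -> is_derive t 1 S (1 + sg * w t) ->
  S t ^+ 2 = w t * (2 + sg * w t) ->
  0 < b + sg * a * w t -> 0 < 2 + sg * w t ->
  is_derive t 1 (fun t => S t * wellg a b sg (w t))
    ((b + 2 * sg * a * w t) / wellg a b sg (w t)).
Proof.
move=> sg2 dw dS hS h1 h2.
have [g0 g2] := wellg_sq h1 h2.
have dn : is_derive t 1 (fun t => 2 * (b + sg * a * w t)) (2 * (sg * a * S t)).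
  apply: is_derive_eq (is_deriveZ_fun 2 (is_deriveD_fun (is_derive_cst b t 1)
    (is_deriveZ_fun (sg * a) dw))) _; by rewrite add0r.
have dd : is_derive t 1 (fun t => 2 + sg * w t) (sg * S t).
  apply: is_derive_eq (is_deriveD_fun (is_derive_cst (2 : R) t 1)
    (is_deriveZ_fun sg dw)) _; by rewrite add0r.
have n2 : 2 + sg * w t != 0 by rewrite gt_eqF.
have r0 : 0 < 2 * (b + sg * a * w t) / (2 + sg * w t) by rewrite divr_gt0// mulr_gt0.
have dg := @is_derive_comp_fun _ Num.sqrt
  (fun t => 2 * (b + sg * a * w t) * (2 + sg * w t)^-1) _ _ _
  (is_derive1_sqrt r0) (is_deriveM_fun dn (is_deriveV_fun dd n2)).
apply: is_derive_eq (is_deriveM_fun dS dg) _.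
rewrite -/(wellg a b sg (w t)).
move: (wellg a b sg (w t)) g0 g2 => g g0 g2.
have gn : g != 0 by rewrite gt_eqF.
have eb : b = g ^+ 2 * (2 + sg * w t) / 2 - sg * a * w t by rewrite g2; field.
have ea : a * sg ^+ 2 = a by rewrite sg2 mulr1.
(* The last summand vanishes by the definition of g; with it the identity holds
   for every g. *)
suff key (u v : R) : v ^+ 2 = u * (2 + sg * u) -> 2 + sg * u != 0 ->
    v * ((2 * g)^-1 * (2 * (b + sg * a * u) * (- (sg * v) / (2 + sg * u) ^+ 2) +
       (2 + sg * u)^-1 * (2 * (sg * a * v)))) + g * (1 + sg * u) =
    (b + 2 * sg * a * u) / g + ((g ^+ 2 * (2 + sg * u) - 2 * (b + sg * a * u)) * (1 + sg * u)) / (g * (2 + sg * u)).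
  rewrite (key (w t) (S t) hS n2) (_ : g ^+ 2 * _ = 2 * (b + sg * a * w t)) ?g2 ?divfK//.
  by rewrite subrr !mul0r addr0.
move=> hv nu.
transitivity (v ^+ 2 * (sg * (sg * a * u - b + sg * a * u * (sg - 1)) + 0) * 0 +
  (v ^+ 2 * sg * (a * (2 + sg * u) - (b + sg * a * u)) / (g * (2 + sg * u) ^+ 2) + g * (1 + sg * u))).
  by field; rewrite nu gn.
rewrite mulr0 add0r hv.
transitivity (((u * sg * (2 * a - b + (sg - sg) * a * u)) + g ^+ 2 * (1 + sg * u) * (2 + sg * u)) / (g * (2 + sg * u))).
  by field; rewrite nu gn.
transitivity (((b + 2 * sg * a * u) * (2 + sg * u) + ((g ^+ 2 * (2 + sg * u) - 2 * (b + sg * a * u)) * (1 + sg * u))) / (g * (2 + sg * u))); last first.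
  by field; rewrite nu gn.
congr (_ / _); ring.
Qed.

End Well.

(** * Periods of the wells as elliptic integrals *)
Section Substitution.
Context {R : realType}.
Implicit Types (a b sg k z u w Q C c s : R).

(** The substitution below produces the square root of the quartic on the right
    as a function of C = cos th ^ 2; it is the square of a rational function
    of Q. *)
Lemma quartic_square a b u Q C : Q + 4 * a - b != 0 ->
  u = (Q + b) / (Q + 4 * a - b) ->
  (Q - (2 * a - b) * (Q - b) * (1 - C) / (Q + 4 * a - b)) ^+ 2 =
  b ^+ 2 * C ^+ 2 + (Q ^+ 2 - b ^+ 2) * C +
    u * (1 - C) * (4 * a * b * C + (Q ^+ 2 - b ^+ 2)) + 4 * a ^+ 2 * u ^+ 2 * (1 - C) ^+ 2.
Proof. by move=> n ->; field. Qed.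

(** The sign of the square root of the quartic, for the well of mu. *)
Lemma root_gt0_plus a b Q C : 0 < a -> 0 < b -> b <= 2 * a -> b <= Q -> 0 <= C <= 1 ->
  0 < Q - (2 * a - b) * (Q - b) * (1 - C) / (Q + 4 * a - b).
Proof.
move=> a0 b0 ba bQ /andP[C0 C1]; have n : 0 < Q + 4 * a - b by lra.
rewrite subr_gt0 ltr_pdivrMr//.
have h1 : (2 * a - b) * (Q - b) * (1 - C) <= (2 * a - b) * (Q - b).
  by rewrite ler_piMr ?mulr_ge0//; lra.
have h2 : (2 * a - b) * (Q - b) <= (2 * a - b) * Q by apply: ler_wpM2l; lra.
have h3 : 0 < Q * (Q + 2 * a) by rewrite mulr_gt0//; lra.
have -> : Q * (Q + 4 * a - b) = Q * (Q + 2 * a) + (2 * a - b) * Q by ring.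
lra.
Qed.

(** The sign of the square root of the quartic, for the well of nu. If
    b < 4 * a then 1 - C <= Q ^ 2 / b ^ 2 suffices; otherwise 1 - C is bounded
    by means of Qr > b - 4 * a, the condition that w stays below 2. *)
Lemma root_gt0_minus a b Q Qr C : 0 < a -> 0 < b -> 2 * a <= b -> 0 < Qr -> b - 4 * a < Qr ->
  Qr <= Q -> Q <= b -> Q ^+ 2 = b ^+ 2 * (1 - C) + C * Qr ^+ 2 -> 0 <= C <= 1 ->
  0 < Q - (2 * a - b) * (Q - b) * (1 - C) / (Q + 4 * a - b).
Proof.
move=> a0 b0 ba Qr0 gQ QrQ Qb eQ /andP[C0 C1].
have Q0 : 0 < Q by lra.
have n : 0 < Q + 4 * a - b by lra.
rewrite subr_gt0 ltr_pdivrMr//.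
have CQr : 0 <= C * Qr ^+ 2 by rewrite mulr_ge0// sqr_ge0.
have -> : (2 * a - b) * (Q - b) * (1 - C) = (b - Q) * ((b - 2 * a) * (1 - C)) by ring.
have [b4|b4] := leP (4 * a) b; last first.
  have h1 : b * ((b - 2 * a) * (1 - C)) <= b ^+ 2 * (1 - C) / 2.
    have -> : b ^+ 2 * (1 - C) / 2 = b * ((b / 2) * (1 - C)) by field.
    by apply: ler_wpM2l; [exact: ltW|apply: ler_wpM2r; lra].
  have h2 : (b - Q) * ((b - 2 * a) * (1 - C)) <= b * ((b - 2 * a) * (1 - C)).
    by apply: ler_wpM2r; [apply: mulr_ge0; lra|lra].
  have h3 : 0 < Q * (4 * a - b) by rewrite mulr_gt0//; lra.
  have h4 : 0 < Q ^+ 2 by rewrite exprn_gt0.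
  have -> : Q * (Q + 4 * a - b) = Q ^+ 2 + Q * (4 * a - b) by ring.
  lra.
have [g eb] : exists g, b = g + 4 * a by exists (b - 4 * a); ring.
have g0 : 0 <= g by lra.
have {}gQ : g < Qr by lra.
subst b.
have h1 : 8 * a * ((g + 4 * a - 2 * a) * (1 - C)) <= Q ^+ 2 - g ^+ 2.
  have : 0 <= C * (Qr ^+ 2 - g ^+ 2).
    by apply: mulr_ge0 => //; rewrite subr_sqr; apply: mulr_ge0; lra.
  have : Q ^+ 2 - g ^+ 2 - 8 * a * ((g + 4 * a - 2 * a) * (1 - C)) = C * (Qr ^+ 2 - g ^+ 2).
    by rewrite eQ; ring.
  by lra.
have h2 : 8 * a * ((g + 4 * a - Q) * ((g + 4 * a - 2 * a) * (1 - C))) <=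
    (g + 4 * a - Q) * (Q ^+ 2 - g ^+ 2).
  by rewrite mulrCA; apply: ler_wpM2l; lra.
have h3 : (g + 4 * a - Q) * (Q ^+ 2 - g ^+ 2) < 8 * a * (Q * (Q - g)).
  have -> : 8 * a * (Q * (Q - g)) = (Q - g) * (8 * a * Q) by ring.
  have -> : (g + 4 * a - Q) * (Q ^+ 2 - g ^+ 2) =
    (Q - g) * ((g + 4 * a - Q) * (Q + g)) by ring.
  rewrite ltr_pM2l; last by lra.
  have p1 : 0 < a * (Q - g) by rewrite mulr_gt0//; lra.
  have p2 : 0 < (Q - g) * (Q + g) by rewrite mulr_gt0//; lra.
  have p3 : 0 < a * Q by rewrite mulr_gt0.
  have -> : (g + 4 * a - Q) * (Q + g) = 8 * a * Q - ((Q - g) * (Q + g) + 4 * (a * (Q - g))).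
    ring.
  by lra.
have -> : Q * (Q + 4 * a - (g + 4 * a)) = Q * (Q - g) by ring.
have a8 : 0 < 8 * a by lra.
by rewrite -(ltr_pM2l a8); exact: le_lt_trans h2 h3.
Qed.

End Substitution.

Section EllipticSubstitution.
Context {R : realType}.
Implicit Types (a b sg z e th : R).

Lemma conic_gt0 (k th : R) : 0 < k -> 0 < cos th ^+ 2 + k * sin th ^+ 2.
Proof.
move=> k0; have cs : cos th ^+ 2 = 1 - sin th ^+ 2 by rewrite cos2sin2.
have [s0|s0] := eqVneq (sin th) 0; first by rewrite cs s0 expr0n/=; lra.
by rewrite ltr_wpDl ?sqr_ge0// mulr_gt0// exprn_even_gt0.
Qed.

(** The angle ph is the solution of tan ph = k * tan th with the same number of
    turns as th, written without poles. *)
Lemma angle_double_sq (k th : R) : 0 < k ->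
  let c := cos th in let s := sin th in
  let ph := th + atan ((k - 1) * (s * c) / (c ^+ 2 + k * s ^+ 2)) in
  sin (2 * ph) ^+ 2 * (c ^+ 2 + k ^+ 2 * s ^+ 2) ^+ 2 = 4 * k ^+ 2 * s ^+ 2 * c ^+ 2.
Proof.
move=> k0 c s; set t := (k - 1) * _ / _ => ph.
have D0 : 0 < c ^+ 2 + k * s ^+ 2 := conic_gt0 th k0.
have Dn : c ^+ 2 + k * s ^+ 2 != 0 by rewrite gt_eqF.
have w0 : 0 < c ^+ 2 + k ^+ 2 * s ^+ 2 := conic_gt0 th (exprn_gt0 2 k0).
have ca : cos (atan t) != 0 by rewrite cos_atan invr_eq0 gt_eqF// sqrtr_gt0 ltr_pwDl// sqr_ge0.
have ct : sin (atan t) = t * cos (atan t) by rewrite -{2}(atanK t) /tan divfK.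
have c2 : cos (atan t) ^+ 2 * (1 + t ^+ 2) = 1.
  by rewrite mulrDr mulr1 -exprMn [cos _ * t]mulrC -ct cos2Dsin2.
have e1 : c - s * t = c / (c ^+ 2 + k * s ^+ 2).
  rewrite /t; transitivity (c * (c ^+ 2 + s ^+ 2) / (c ^+ 2 + k * s ^+ 2)); first by field.
  by rewrite /c /s cos2Dsin2 mulr1.
have e2 : s + c * t = k * s / (c ^+ 2 + k * s ^+ 2).
  rewrite /t; transitivity (k * s * (c ^+ 2 + s ^+ 2) / (c ^+ 2 + k * s ^+ 2)); first by field.
  by rewrite /c /s cos2Dsin2 mulr1.
have e3 : (1 + t ^+ 2) * (c ^+ 2 + k * s ^+ 2) ^+ 2 = c ^+ 2 + k ^+ 2 * s ^+ 2.
  have : (c - s * t) ^+ 2 + (s + c * t) ^+ 2 = (1 + t ^+ 2) * (c ^+ 2 + s ^+ 2) by ring.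
  rewrite /c /s cos2Dsin2 mulr1 -/c -/s => <-.
  by rewrite e1 e2; field.
have -> : sin (2 * ph) = 2 * (s + c * t) * (c - s * t) * cos (atan t) ^+ 2.
  rewrite mulr_natl mulr2n sinD /ph cosD sinD ct -/c -/s; ring.
have ew : cos (atan t) ^+ 2 * (c ^+ 2 + k ^+ 2 * s ^+ 2) = (c ^+ 2 + k * s ^+ 2) ^+ 2.
  by rewrite -e3 mulrA c2 mul1r.
transitivity ((2 * (s + c * t) * (c - s * t) *
  (cos (atan t) ^+ 2 * (c ^+ 2 + k ^+ 2 * s ^+ 2))) ^+ 2); first by ring.
by rewrite ew e1 e2; field.
Qed.

Lemma angle_deriv (k : R -> R) (dk th : R) : 0 < k th -> is_derive th 1 k dk ->
  let c := cos th in let s := sin th in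
  is_derive th 1 (fun th => th + atan ((k th - 1) * (sin th * cos th) *
      (cos th ^+ 2 + k th * sin th ^+ 2)^-1))
   ((k th + dk * (s * c)) / (c ^+ 2 + k th ^+ 2 * s ^+ 2)).
Proof.
move=> k0 Dk c s.
have D0 : 0 < c ^+ 2 + k th * s ^+ 2 := conic_gt0 th k0.
have w0 : 0 < c ^+ 2 + k th ^+ 2 * s ^+ 2 := conic_gt0 th (exprn_gt0 2 k0).
have Dn : c ^+ 2 + k th * s ^+ 2 != 0 by rewrite gt_eqF.
have wn : c ^+ 2 + k th ^+ 2 * s ^+ 2 != 0 by rewrite gt_eqF.
have Dc := is_derive_cos th; have Ds := is_derive_sin th.
have Dcc : is_derive th 1 (fun t : R => cos t ^+ 2) (c * - s + c * - s).
  under eq_fun do rewrite expr2; exact: (is_deriveM_fun Dc Dc).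
have Dss : is_derive th 1 (fun t : R => sin t ^+ 2) (s * c + s * c).
  under eq_fun do rewrite expr2; exact: (is_deriveM_fun Ds Ds).
have Dsc := is_deriveM_fun (is_deriveB_fun Dk (is_derive_cst (1 : R) th 1))
  (is_deriveM_fun Ds Dc).
have DD := is_deriveD_fun Dcc (is_deriveM_fun Dk Dss).
have Dt := is_deriveM_fun Dsc (is_deriveV_fun DD Dn).
have := is_deriveD_fun (is_derive_id th 1) (@is_derive_comp_fun _ atan
  (fun th => (k th - 1) * (sin th * cos th) * (cos th ^+ 2 + k th * sin th ^+ 2)^-1)
  _ _ _ (is_derive1_atan _) Dt).
move/is_derive_eq; apply; rewrite -/c -/s /cst.
have tn : 1 + ((k th - 1) * (s * c) / (c ^+ 2 + k th * s ^+ 2)) ^+ 2 != 0.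
  by rewrite gt_eqF// ltr_pwDl// sqr_ge0.
have e3 : 1 + ((k th - 1) * (s * c) / (c ^+ 2 + k th * s ^+ 2)) ^+ 2 =
   (c ^+ 2 + k th ^+ 2 * s ^+ 2) / (c ^+ 2 + k th * s ^+ 2) ^+ 2.
  transitivity (((c ^+ 2 + k th ^+ 2 * s ^+ 2) * (c ^+ 2 + s ^+ 2)) / (c ^+ 2 + k th * s ^+ 2) ^+ 2).
    by field.
  by rewrite /c /s cos2Dsin2 mulr1.
rewrite e3 invf_div.
move: (k th) Dn wn => q Dn wn.
have cs1 : c ^+ 2 + s ^+ 2 = 1 by rewrite /c /s cos2Dsin2.
transitivity (1 + (dk * (s * c) * (c ^+ 2 + s ^+ 2) + (q - 1) * (c ^+ 2 - q * s ^+ 2) * (c ^+ 2 + s ^+ 2)) /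
   (c ^+ 2 + q ^+ 2 * s ^+ 2)).
  move: wn Dn; rewrite -[q ^+ 2]/(q * q) => wn Dn; field.
  by rewrite wn Dn.
rewrite cs1 !mulr1.
transitivity ((q * (c ^+ 2 + s ^+ 2) + dk * (s * c)) / (c ^+ 2 + q ^+ 2 * s ^+ 2)); last first.
  by rewrite cs1 mulr1.
by field; rewrite exprMn.
Qed.

Lemma shift_range (p x t : R) : 0 <= x -> x <= 2 * p -> - (p / 2) < t -> t < p / 2 ->
  - p < x + t < 3 * p.
Proof. by move=> *; apply/andP; split; lra. Qed.

(** Substitute tan ph = k * tan th in the elliptic integral, with k depending
    on th through Q. The derivative of ph and the square root of the quartic
    combine, and what remains is the density of the well at
    X ^ 2 = 2 * e * cos th ^ 2. *)
Theorem period_elliptic a b sg e : 0 < a -> 0 < b ->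
  (sg = 1 /\ b <= 2 * a) \/ (sg = -1 /\ 2 * a <= b) ->
  0 <= e -> 0 < b ^+ 2 + 2 * a * sg * (2 * e) -> b - 4 * a < wellQ a b sg (2 * e) ->
  0 < b + sg * e ->
  period (wellrt a b sg) (2 * e) = Num.sqrt 2 / Num.sqrt (wellQ a b sg (2 * e)) *
    ell0 ((b + sg * e) / wellQ a b sg (2 * e)).
Proof.
move=> a0 b0 sgn e0 Y0 gQ be.
have [Qr0 Qr2] := wellQ_sq Y0; move: Qr0 Qr2 gQ; set Qr := wellQ a b sg (2 * e) => Qr0 Qr2 gQ.
set z := _ / Qr; have z0 : 0 < z by rewrite divr_gt0.
pose rad (th : R) : R := b ^+ 2 + 2 * a * sg * (2 * e * cos th ^+ 2).
pose Q (th : R) : R := wellQ a b sg (2 * e * cos th ^+ 2).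
have ae : 0 <= a * e by rewrite mulr_ge0// ltW.
have rad_eq th : rad th = b ^+ 2 * (1 - cos th ^+ 2) + cos th ^+ 2 * Qr ^+ 2.
  by rewrite /rad Qr2; ring.
have c01 (th : R) : 0 <= cos th ^+ 2 <= 1 := cos2_itv th.
have rad_gt0 th : 0 < rad th.
  rewrite rad_eq; have /andP[h0 h1] := c01 th; have B : 0 < b ^+ 2 by rewrite exprn_gt0.
  have Q2 : 0 < Qr ^+ 2 by rewrite exprn_gt0.
  have [C0|C0] := eqVneq (cos th ^+ 2) 0; first by rewrite C0; lra.
  have : 0 < cos th ^+ 2 * Qr ^+ 2 by rewrite mulr_gt0// lt_def C0 h0.
  have : 0 <= b ^+ 2 * (1 - cos th ^+ 2) by rewrite mulr_ge0 ?sqr_ge0// subr_ge0.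
  by lra.
have Q0 th : 0 < Q th := (wellQ_sq (rad_gt0 th)).1.
have Q2 th : Q th ^+ 2 = b ^+ 2 * (1 - cos th ^+ 2) + cos th ^+ 2 * Qr ^+ 2.
  by rewrite -rad_eq; exact: (wellQ_sq (rad_gt0 th)).2.
have sqle (x y : R) : 0 < x -> 0 < y -> x ^+ 2 <= y ^+ 2 -> x <= y.
  by move=> x0 y0; rewrite ler_pXn2r// nnegrE ltW.
pose root th := Q th - (2 * a - b) * (Q th - b) * (1 - cos th ^+ 2) / (Q th + 4 * a - b).
have [Qd root0] : (forall th, 0 < Q th + 4 * a - b) /\ (forall th, 0 < root th).
  case: sgn => -[sg1 ba].
    have bQr : b ^+ 2 <= Qr ^+ 2 by rewrite Qr2 sg1; lra.
    have bQ th : b <= Q th.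
      apply: sqle => //; rewrite Q2; have /andP[h0 _] := c01 th.
      have : 0 <= cos th ^+ 2 * (Qr ^+ 2 - b ^+ 2) by rewrite mulr_ge0// subr_ge0.
      by lra.
    split=> th; first by have := bQ th; lra.
    exact: root_gt0_plus.
  have bQr : Qr ^+ 2 <= b ^+ 2 by rewrite Qr2 sg1; lra.
  have bQ th : Q th <= b.
    apply: sqle => //; rewrite Q2; have /andP[h0 _] := c01 th.
    have : 0 <= cos th ^+ 2 * (b ^+ 2 - Qr ^+ 2) by rewrite mulr_ge0// subr_ge0.
    by lra.
  have QrQ th : Qr <= Q th.
    apply: sqle => //; rewrite Q2; have /andP[_ h1] := c01 th.
    have : 0 <= (1 - cos th ^+ 2) * (b ^+ 2 - Qr ^+ 2) by rewrite mulr_ge0// subr_ge0.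
    by lra.
  split=> th; first by have := QrQ th; lra.
  by apply: (@root_gt0_minus _ a b (Q th) Qr).
pose u th := (Q th + b) / (Q th + 4 * a - b).
have u0 th : 0 < u th by rewrite divr_gt0// addr_gt0.
pose k th := Num.sqrt (2 * a / Qr * u th).
have ku0 th : 0 < 2 * a / Qr * u th by rewrite mulr_gt0// divr_gt0// mulr_gt0.
have k0 th : 0 < k th by rewrite sqrtr_gt0.
have k2 th : k th ^+ 2 = 2 * a / Qr * u th by rewrite sqr_sqrtr// ltW.
have Dcc (th : R) : is_derive th 1 (fun t : R => cos t ^+ 2) (- 2 * (sin th * cos th)).
  under eq_fun do rewrite expr2.
  by apply: is_derive_eq (is_deriveM_fun (is_derive_cos th) (is_derive_cos th)) _; ring.
have Drad th : is_derive th 1 rad (2 * a * sg * (2 * e * (- 2 * (sin th * cos th)))).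
  apply: is_derive_eq (is_deriveD_fun (is_derive_cst (b ^+ 2) th 1)
    (is_deriveZ_fun (2 * a * sg) (is_deriveZ_fun (2 * e) (Dcc th)))) _.
  by rewrite add0r.
have DQ th : is_derive th 1 Q (((2 * Q th)^-1) * (2 * a * sg * (2 * e * (- 2 * (sin th * cos th))))).
  exact: (@is_derive_comp_fun _ Num.sqrt rad _ _ _ (is_derive1_sqrt (rad_gt0 th)) (Drad th)).
pose dQ th := ((2 * Q th)^-1) * (2 * a * sg * (2 * e * (- 2 * (sin th * cos th)))).
have Qdn th : Q th + 4 * a - b != 0 by rewrite gt_eqF.
have Du th : is_derive th 1 u (dQ th * (4 * a - 2 * b) / (Q th + 4 * a - b) ^+ 2).
  have D1 := is_deriveD_fun (DQ th) (is_derive_cst b th 1).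
  have D2 := is_deriveB_fun (is_deriveD_fun (DQ th) (is_derive_cst (4 * a) th 1))
    (is_derive_cst b th 1).
  apply: is_derive_eq (is_deriveM_fun D1 (is_deriveV_fun D2 (Qdn th))) _.
  by rewrite /cst -/(dQ th); field.
have Dk th : is_derive th 1 k ((2 * k th)^-1 *
    (2 * a / Qr * (dQ th * (4 * a - 2 * b) / (Q th + 4 * a - b) ^+ 2))).
  exact: (@is_derive_comp_fun _ Num.sqrt (fun th => 2 * a / Qr * u th) _ _ _
     (is_derive1_sqrt (ku0 th)) (is_deriveZ_fun (2 * a / Qr) (Du th))).
pose dk th := (2 * k th)^-1 *
    (2 * a / Qr * (dQ th * (4 * a - 2 * b) / (Q th + 4 * a - b) ^+ 2)).
pose ph th := th + atan ((k th - 1) * (sin th * cos th) *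
      (cos th ^+ 2 + k th * sin th ^+ 2)^-1).
have Dph th : is_derive th 1 ph ((k th + dk th * (sin th * cos th)) /
    (cos th ^+ 2 + k th ^+ 2 * sin th ^+ 2)) := angle_deriv (k0 th) (Dk th).
pose h (s : R) : R := (Num.sqrt (z * sin (2 * s) ^+ 2 + (2 - sin (2 * s) ^+ 2)))^-1.
pose f (th : R) : R := k th / Q th * (Qr / Num.sqrt 2).
have s2 : 0 < Num.sqrt 2 :> R by rewrite sqrtr_gt0.
have s2n : Num.sqrt 2 != 0 :> R by rewrite gt_eqF.
have hf (th : R) : h (ph th) * ((k th + dk th * (sin th * cos th)) /
    (cos th ^+ 2 + k th ^+ 2 * sin th ^+ 2)) = f th.
  have w0 := conic_gt0 th (exprn_gt0 2 (k0 th)).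
  have e1 := angle_double_sq th (k0 th); rewrite /= -/(ph th) in e1.
  have s2c : sin th ^+ 2 = 1 - cos th ^+ 2 by rewrite sin2cos2.
  have Qrn : Qr != 0 by rewrite gt_eqF.
  have e2 := @quartic_square _ a b (u th) (Q th) (cos th ^+ 2) (Qdn th) erefl.
  rewrite -/(root th) in e2.
  have e3 : Q th ^+ 2 - b ^+ 2 = 4 * a * sg * e * cos th ^+ 2.
    by rewrite Q2 Qr2; ring.
  (* the numerator of the derivative of ph is a multiple of the root of the quartic *)
  have e4 : (k th + dk th * (sin th * cos th)) * Q th = k th * root th.
    have Qbn : Q th + b != 0 by rewrite gt_eqF// addr_gt0.
    have kn : k th != 0 by rewrite gt_eqF.
    have Qn : Q th != 0 by rewrite gt_eqF.
    have -> : dk th = k th * dQ th * (2 * a - b) / ((Q th + b) * (Q th + 4 * a - b)).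
      rewrite /dk (_ : 2 * a / Qr = k th ^+ 2 / u th); last by rewrite k2 mulfK// gt_eqF.
      by rewrite /u; field; rewrite Qdn Qbn kn.
    have e5 : dQ th * (sin th * cos th) * Q th = - (Q th ^+ 2 - b ^+ 2) * sin th ^+ 2.
      by rewrite e3 /dQ; field.
    transitivity (k th * (Q th + (dQ th * (sin th * cos th) * Q th) * (2 * a - b) /
      ((Q th + b) * (Q th + 4 * a - b)))); first by ring.
    rewrite e5 s2c /root; congr (_ * _); field.
    by rewrite Qdn Qbn.
  have e6 : z * sin (2 * ph th) ^+ 2 + (2 - sin (2 * ph th) ^+ 2) =
     (Num.sqrt 2 * root th / (Qr * (cos th ^+ 2 + k th ^+ 2 * sin th ^+ 2))) ^+ 2.
    have wn : cos th ^+ 2 + k th ^+ 2 * sin th ^+ 2 != 0 by rewrite gt_eqF.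
    rewrite expr_div_n exprMn sqr_sqrtr; last by rewrite ler0n.
    apply: (mulIf (expf_neq0 2 (mulf_neq0 Qrn wn))).
    rewrite divfK ?expf_neq0 ?mulf_neq0// e2 e3.
    have -> : (z * sin (2 * ph th) ^+ 2 + (2 - sin (2 * ph th) ^+ 2)) *
      (Qr * (cos th ^+ 2 + k th ^+ 2 * sin th ^+ 2)) ^+ 2 = Qr ^+ 2 *
      (2 * (cos th ^+ 2 + k th ^+ 2 * sin th ^+ 2) ^+ 2 -
      (1 - z) * (sin (2 * ph th) ^+ 2 * (cos th ^+ 2 + k th ^+ 2 * sin th ^+ 2) ^+ 2)).
      by ring.
    rewrite e1 s2c k2 /z.
    have eb : b ^+ 2 = Qr ^+ 2 - 2 * a * sg * (2 * e) by rewrite Qr2; ring.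
    move: (u th) (cos th ^+ 2) => U C.
    transitivity (2 * Qr ^+ 2 * C ^+ 2 + 8 * a * U * (1 - C) * C * (b + sg * e) +
      8 * a ^+ 2 * U ^+ 2 * (1 - C) ^+ 2); first by field.
    by rewrite Qr2; ring.
  rewrite /h e6 sqrtr_sqr ger0_norm; last first.
    by rewrite divr_ge0 ?mulr_ge0// ltW.
  rewrite /f; have := e4; move: (k th + _) (root0 th) (Q0 th) w0 => A r0 q0 w0 eA.
  have -> : A = k th * root th / Q th by rewrite -eA mulfK// gt_eqF.
  move: (cos th ^+ 2 + _) w0 => w w0; move: (k th) (root th) r0 (Q th) q0 => K r r0 q q0.
  by field; rewrite s2n Qrn !gt_eqF.
have contf : cont_on 0 (2 * pi) f.
  move=> s _.
  have Qn : Q s != 0 by rewrite gt_eqF.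
  exact: (is_derive_continuous (is_deriveM_fun
    (is_deriveM_fun (Dk s) (is_deriveV_fun (DQ s) Qn))
    (is_derive_cst (Qr / Num.sqrt 2) s 1))).
have hcont s : {for s, continuous h} := @ell0_continuous _ z s z0.
(* the margins around [0, 2 pi] leave room for atan *)
have [G DG] := @primitive _ h (- pi) (3 * pi) hcont.
have pi0 : 0 < pi :> R by exact: pi_gt0.
have pi2 : 0 < 2 * pi :> R by rewrite mulr_gt0.
have ell : ell0 z = G (2 * pi) - G 0.
  rewrite ell0E; apply: (segint_FTC pi2) => [s _|s /andP[s0 s1]]; first exact: hcont.
  by apply: DG; rewrite (lt_le_trans _ s0) ?oppr_lt0//= (le_lt_trans s1)// ltr_pM2r// ltr_nat.
have DF th : 0 <= th <= 2 * pi -> is_derive th 1 (fun th => G (ph th)) (f th).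
  move=> /andP[t0 t1]; rewrite -hf.
  apply: (@is_derive_comp_fun _ G ph _ _ _ _ (Dph th)).
  apply: DG; rewrite /ph; move: (_ * _^-1) => t.
  exact: (shift_range t0 t1 (atan_gtNpi2 t) (atan_ltpi2 t)).
have := segint_FTC pi2 contf DF.
have -> : ph (2 * pi) = 2 * pi.
  have : sin (2 * pi) = 0 :> R by rewrite mulr_natl sin2pi.
  by rewrite /ph => ->; rewrite mul0r mulr0 mul0r atan0 addr0.
have -> : ph 0 = 0 by rewrite /ph sin0 mul0r mulr0 mul0r atan0 addr0.
rewrite -ell => <-.
have sQr : 0 < Num.sqrt Qr by rewrite sqrtr_gt0.
rewrite -segintZ//; apply: eq_segint => th _.
rewrite mul1r /wellrt -/(Q th) -/(u th) /f /k.
have -> : 2 * a * u th = Qr * (2 * a / Qr * u th) by field; rewrite gt_eqF.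
rewrite sqrtrM; last exact: ltW.
have -> : Num.sqrt 2 / Num.sqrt Qr * (Num.sqrt (2 * a / Qr * u th) / Q th * (Qr / Num.sqrt 2)) =
  Qr / Num.sqrt Qr * Num.sqrt (2 * a / Qr * u th) / Q th.
  by field; rewrite s2n !gt_eqF.
by rewrite -{3}(sqr_sqrtr (ltW Qr0)) expr2 mulfK// gt_eqF.
Qed.

End EllipticSubstitution.

(** * Concave profiles and convex toric domains *)

Section ConcaveProfile.
Context {R : realType}.
Variables (m : R) (A1 A2 T1 T2 : R -> R).
Hypothesis m0 : 0 < m.
Hypothesis dA1 : forall e : R, 0 <= e <= m -> is_derive e 1 A1 (T1 e).
Hypothesis dA2 : forall e : R, 0 <= e <= m -> is_derive e 1 A2 (T2 e).
Hypothesis T1_gt0 : forall e, 0 <= e <= m -> 0 < T1 e.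
Hypothesis T2_gt0 : forall e, 0 <= e <= m -> 0 < T2 e.
Hypotheses (A10 : A1 0 = 0) (A20 : A2 0 = 0).
Hypothesis ratio : forall e e', 0 <= e -> e <= e' -> e' <= m ->
  T2 (m - e) * T1 e' <= T2 (m - e') * T1 e.

(** The union of the rectangles with corner (A1 e, A2 (m - e)) on the profile
    curve; when the slope condition ratio holds, the curve is concave. *)
Definition under_profile : set 'rV[R]_2 :=
  [set x | (forall i, 0 <= x 0 i) /\
     exists e, [/\ 0 <= e <= m, x 0 0 <= A1 e & x 0 1 <= A2 (m - e)]].

(** The support function of the region in the direction normal to the profile
    curve at e. *)
Let supp e := T2 (m - e) * A1 e + T1 e * A2 (m - e).

Let refl e : 0 <= e <= m -> 0 <= m - e <= m.
Proof. by move=> /andP[? ?]; apply/andP; split; lra. Qed.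

(** The linear form has derivative T2 (m - e) * T1 t - T1 e * T2 (m - t) along
    the curve, of the sign of e - t by the condition ratio. *)
Let supp_max e e' : 0 <= e <= m -> 0 <= e' <= m ->
  T2 (m - e) * A1 e' + T1 e * A2 (m - e') <= supp e.
Proof.
move=> he he'; have /andP[e0 em] := he; have /andP[e0' em'] := he'.
have D (t : R) : 0 <= t <= m -> is_derive t 1
    (fun t => T2 (m - e) * A1 t + T1 e * A2 (m - t))
    (T2 (m - e) * T1 t - T1 e * T2 (m - t)).
  move=> ht; have d1 : is_derive t 1 (fun t => m - t) (- 1).
    by apply: is_derive_eq (is_deriveB_fun (is_derive_cst m t 1) (is_derive_id t 1)) _; rewrite sub0r.
  have d2 := @is_derive_comp_fun _ A2 (fun t => m - t) _ _ _ (dA2 (refl ht)) d1.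
  apply: is_derive_eq (is_deriveD_fun (is_deriveZ_fun (T2 (m - e)) (dA1 ht))
    (is_deriveZ_fun (T1 e) d2)) _; ring.
have [ee|/ltW ee] := leP e e'.
  rewrite -lerN2.
  have DN (t : R) : e <= t <= e' -> is_derive t 1
    (fun t => - (T2 (m - e) * A1 t + T1 e * A2 (m - t)))
    (- (T2 (m - e) * T1 t - T1 e * T2 (m - t))).
    move=> /andP[t1 t2]; have ht : 0 <= t <= m by rewrite (le_trans e0)//= (le_trans t2).
    have := is_deriveZ_fun (- 1) (D t ht); under eq_fun do rewrite mulN1r.
    by rewrite mulN1r.
  apply: (nondecr_of_deriv ee DN) => t /andP[t1 t2].
  rewrite oppr_ge0 subr_le0 [leRHS]mulrC; apply: ratio => //; exact: le_trans em'.
have DP (t : R) : e' <= t <= e -> 0 <= t <= m.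
  by move=> /andP[t1 t2]; rewrite (le_trans e0')//= (le_trans t2).
apply: (nondecr_of_deriv ee (fun t ht => D t (DP t ht))).
move=> t /andP[t1 t2].
rewrite subr_ge0 mulrC; apply: ratio => //; exact: le_trans t1.
Qed.

Let half : set 'rV[R]_2 := [set x | forall e, 0 <= e <= m ->
  T2 (m - e) * x 0 0 + T1 e * x 0 1 <= supp e].

Let ord2 (P : 'I_2 -> Prop) : P 0 -> P 1 -> forall i, P i.
Proof.
move=> p0 p1 i; case: (unliftP 0 i) => [j ->|->//].
by rewrite (_ : lift 0 j = 1)//; apply/val_inj; rewrite (ord1 j).
Qed.

Let lemm : 0 <= m <= m. Proof. by rewrite lexx andbT ltW. Qed.

(** In the orthant the region is the intersection of the half-planes bounded by
    the tangents of the profile. A point of this intersection either lies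
    above a point of the curve with the same abscissa, or violates the last
    half-plane. *)
Let under_half x : under_profile x <-> (forall i, 0 <= x 0 i) /\ half x.
Proof.
split=> [[x0 [e [he xa xb]]]|[x0 hx]]; split=> //.
  move=> e' he'; apply: le_trans (supp_max he' he).
  apply: lerD; rewrite ler_pM2l//; [exact: (T2_gt0 (refl he'))|exact: T1_gt0].
have [xA|xA] := leP (x 0 0) (A1 m).
  have [||e] := @IVT R A1 0 m (x 0 0) (ltW m0).
  - apply: cont_on_within => t ht; exact: is_derive_continuous (dA1 ht).
  - by rewrite A10 ge_min x0/= le_max xA orbT.
  rewrite in_itv/= => he ee; exists e; split=> //; first by rewrite ee.
  have := hx e he; rewrite /supp ee lerD2l ler_pM2l//; exact: T1_gt0.
have := hx m lemm; rewrite /supp subrr A20 mulr0 addr0 leNgt => /negP[].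
apply: (@lt_le_trans _ _ (T2 0 * x 0 0)); first by rewrite ltr_pM2l// T2_gt0// lexx ltW.
by rewrite lerDl mulr_ge0// ltW// T1_gt0.
Qed.

Let zero_under : under_profile 0.
Proof.
split=> [i|]; first by rewrite mxE.
exists 0; rewrite !mxE A10 lexx subr0 ltW//; split=> //.
by rewrite -A20; apply: (@nondecr_of_deriv _ 0 m _ _ (ltW m0) dA2) => e /T2_gt0/ltW.
Qed.

Let mono_half (x y : 'rV[R]_2) : half y -> (forall i, x 0 i <= y 0 i) -> half x.
Proof.
move=> hy xy e he; apply: le_trans (hy e he).
by apply: lerD; rewrite ler_pM2l//; [exact: (T2_gt0 (refl he))|exact: T1_gt0].
Qed.

Let half_conv (t : R) (x y : 'rV[R]_2) : 0 <= t <= 1 -> half x -> half y ->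
  half (t *: x + (1 - t) *: y).
Proof.
move=> /andP[t0 t1] hx hy e he; rewrite !mxE.
have -> : T2 (m - e) * (t * x 0 0 + (1 - t) * y 0 0) + T1 e * (t * x 0 1 + (1 - t) * y 0 1) =
  t * (T2 (m - e) * x 0 0 + T1 e * x 0 1) + (1 - t) * (T2 (m - e) * y 0 0 + T1 e * y 0 1) by ring.
have -> : supp e = t * supp e + (1 - t) * supp e by ring.
by apply: lerD; apply: ler_wpM2l; rewrite ?subr_ge0//; [exact: hx|exact: hy].
Qed.

Let under_conv (t : R) (x y : 'rV[R]_2) : 0 <= t <= 1 ->
  under_profile x -> under_profile y -> under_profile (t *: x + (1 - t) *: y).
Proof.
move=> ht /under_half[x0 hx] /under_half[y0 hy]; apply/under_half; split.
  by move=> i; rewrite !mxE; case/andP: ht => t0 t1; rewrite addr_ge0// mulr_ge0// subr_ge0.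
exact: half_conv.
Qed.

Let coordC i : continuous (fun x : 'rV[R]_2 => x 0 i).
Proof. exact: coord_continuous. Qed.

Let closed_half : closed half.
Proof.
rewrite (_ : half = \bigcap_(e in [set e | 0 <= e <= m])
   [set x | T2 (m - e) * x 0 0 + T1 e * x 0 1 <= supp e])//.
apply: closed_bigI => e _.
apply: (@closed_comp _ _ (fun x : 'rV[R]_2 => T2 (m - e) * x 0 0 + T1 e * x 0 1)
  [set t | t <= supp e]); last exact: closed_le.
have C (k : R) i : continuous (fun x : 'rV[R]_2 => k * x 0 i).
  move=> x; apply: (@continuousM _ _ (fun=> k) (fun x : 'rV[R]_2 => x 0 i)).
    exact: cst_continuous.
  exact: coordC.
by move=> x _; exact: (@continuousD _ _ _ (fun x : 'rV[R]_2 => T2 (m - e) * x 0 0)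
  (fun x : 'rV[R]_2 => T1 e * x 0 1) x (C _ _ x) (C _ _ x)).
Qed.

Lemma closed_under_profile : closed under_profile.
Proof.
rewrite (_ : under_profile = \bigcap_(i in setT) [set x : 'rV[R]_2 | 0 <= x 0 i] `&` half).
  apply: closedI; last exact: closed_half.
  apply: closed_bigI => i _.
  apply: (@closed_comp _ _ (fun x : 'rV[R]_2 => x 0 i) [set t | 0 <= t]).
    by move=> x _; exact: coordC.
  exact: closed_ge.
apply/seteqP; split=> x; first by move=> /under_half[x0 hx]; split=> // i _; exact: x0.
by move=> [x0 hx]; apply/under_half; split=> // i; exact: x0.
Qed.

Let absv (x : 'rV[R]_2) : 'rV[R]_2 := \row_i `|x 0 i|.

Let absvC : continuous absv.
Proof.
move=> x; have := @Ck_row _ _ 0 setT 2 absv openT; apply => // i y _.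
rewrite (_ : (fun y => absv y 0 i) = fun y : 'rV[R]_2 => `|y 0 i|).
  by apply: (continuous_comp (@coordC i y)); exact: norm_continuous.
by apply/funext => z; rewrite mxE.
Qed.

(** Absolute values of convex combinations are bounded by the convex
    combinations of absolute values, and the half-planes have positive normals. *)
Lemma convex_hat_under : @convex_set R 'rV[R]_2 (hat under_profile).
Proof.
move=> x y l; rewrite !inE => hx hy.
have /andP[l0 l1] : 0 <= l%:num <= (1 : R) by rewrite ge0 le1.
have /under_half[_ h] := under_conv (introT andP (conj l0 l1)) hx hy.
apply/under_half; split=> [i|]; first by rewrite mxE.
apply: mono_half h _ => i; rewrite !mxE.
apply: le_trans (ler_normD _ _) _; rewrite !normrM.
by rewrite (ger0_norm l0) (@ger0_norm _ (1 - l%:num)) ?subr_ge0.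
Qed.

Lemma compact_hat_under : compact (hat under_profile).
Proof.
pose M := A1 m + A2 m.
have mono (A T : R -> R) : (forall e : R, 0 <= e <= m -> is_derive e 1 A (T e)) ->
    (forall e, 0 <= e <= m -> 0 < T e) -> A 0 = 0 ->
    forall e, 0 <= e <= m -> 0 <= A e <= A m.
  move=> dA T0 A0 e /andP[e0 em]; rewrite -{1}A0; apply/andP; split.
    have em' t : 0 <= t <= e -> 0 <= t <= m.
      by move=> /andP[-> te]; rewrite (le_trans te).
    apply: (nondecr_of_deriv e0 (fun t ht => dA t (em' t ht))) => t /andP[t0 te].
    by apply/ltW/T0; rewrite t0 (le_trans te).
  have em' t : e <= t <= m -> 0 <= t <= m.
    by move=> /andP[et ->]; rewrite (le_trans e0).
  apply: (nondecr_of_deriv em (fun t ht => dA t (em' t ht))) => t /andP[t0 te].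
  by apply/ltW/T0; rewrite te (le_trans e0).
have m1 := mono A1 T1 dA1 T1_gt0 A10; have m2 := mono A2 T2 dA2 T2_gt0 A20.
have cK := @rV_compact R 2 (fun=> `[- M, M]%classic) (fun=> @segment_compact R _ _).
apply: (subclosed_compact _ cK).
  apply: (@closed_comp _ _ absv under_profile) => [x _|]; first exact: absvC.
  exact: closed_under_profile.
move=> x [_ [e [he xa xb]]] /=.
have /andP[a1 a2] := m1 e he; have /andP[b1 b2] := m2 (m - e) (refl he).
have M1 := m1 m lemm; have M2 := m2 m lemm; rewrite !mxE in xa xb.
by apply: ord2; rewrite /= in_itv/= -ler_norml /M; lra.
Qed.

Let inner : set 'rV[R]_2 := [set x | [/\ 0 < x 0 0, 0 < x 0 1, x 0 0 < A1 (m / 2)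
  & x 0 1 < A2 (m / 2)]].

Let open_inner : open inner.
Proof.
rewrite (_ : inner = ([set x | 0 < x 0 0] `&` [set x | 0 < x 0 1]) `&`
  ([set x | x 0 0 < A1 (m / 2)] `&` [set x | x 0 1 < A2 (m / 2)])).
  have gt i (k : R) : open [set x : 'rV[R]_2 | k < x 0 i].
    apply: (@open_comp _ _ (fun x : 'rV[R]_2 => x 0 i) [set t | k < t]).
      by move=> x _; exact: coordC.
    exact: open_gt.
  have lt i (k : R) : open [set x : 'rV[R]_2 | x 0 i < k].
    apply: (@open_comp _ _ (fun x : 'rV[R]_2 => x 0 i) [set t | t < k]).
      by move=> x _; exact: coordC.
    exact: open_lt.
  exact: (openI (openI (gt 0 0) (gt 1 0)) (openI (lt 0 (A1 (m / 2))) (lt 1 (A2 (m / 2))))).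
by apply/seteqP; split=> x; [move=> [? ? ? ?]|move=> [[? ?] [? ?]]].
Qed.

Let hm : 0 <= m / 2 <= m.
Proof. by have h := m0; apply/andP; split; lra. Qed.

Let inner_under : inner `<=` under_profile.
Proof.
move=> x [x0 x1 xa xb]; split; first by apply: ord2; exact: ltW.
exists (m / 2); rewrite (_ : m - m / 2 = m / 2); last by field.
by rewrite hm !ltW.
Qed.

Let inner_mid : inner (row2 (A1 (m / 2) / 2) (A2 (m / 2) / 2)).
Proof.
have pos (A T : R -> R) : (forall e : R, 0 <= e <= m -> is_derive e 1 A (T e)) ->
    (forall e, 0 <= e <= m -> 0 < T e) -> A 0 = 0 -> 0 < A (m / 2).
  move=> dA T0 A0; rewrite -A0.
  have le e : 0 <= e <= m / 2 -> 0 <= e <= m.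
    by move=> /andP[-> em]; case/andP: hm => _ /(le_trans em).
  apply: (@incr_of_deriv _ 0 (m / 2) A T); first by rewrite divr_gt0.
    by move=> s /le /dA.
  by move=> s /le /T0.
have p1 := pos _ _ dA1 T1_gt0 A10; have p2 := pos _ _ dA2 T2_gt0 A20.
by rewrite /inner/= row2_0 row2_1; split; lra.
Qed.

(** Interior points are dense because the region is convex with nonempty
    interior: the segment from an interior point to x consists of interior
    points except perhaps x. *)
Lemma orthant_under : orthant_domain under_profile.
Proof.
split.
- by move=> x [].
- by exists 0; exact: zero_under.
- have -> : under_profile = \bigcup_(x in under_profile) ((fun t : R => t *: x) @` `[0, 1]).
    apply/seteqP; split=> [x hx|y [x hx [t]]] /=.
      by exists x => //; exists 1; rewrite ?scale1r//= in_itv/= lexx ler01.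
    rewrite in_itv/= => ht <-; have := under_conv ht hx zero_under.
    by rewrite scaler0 addr0.
  apply: bigcup_connected.
    by exists 0 => x _; exists 0; rewrite ?scale0r//= in_itv/= lexx ler01.
  move=> x _; apply: connected_continuous_connected; first exact: segment_connected.
  apply: continuous_subspaceT => t; exact: scalel_continuous.
- move=> x hx.
  set p := row2 (A1 (m / 2) / 2) (A2 (m / 2) / 2).
  have int t : 0 < t -> t <= 1 -> (under_profile°) (t *: p + (1 - t) *: x).
    move=> t0 t1.
    pose aff (y : 'rV[R]_2) := t^-1 *: (y - (1 - t) *: x).
    have affK y : t *: aff y + (1 - t) *: x = y.
      by rewrite /aff scalerA mulfV ?gt_eqF// scale1r subrK.
    have affC : continuous aff.
      move=> y; apply: (@continuous_comp _ _ _ (fun y : 'rV[R]_2 => y - (1 - t) *: x)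
        (fun y => t^-1 *: y)); last exact: scaler_continuous.
      by apply: continuousB; [exact: cvg_id|exact: cst_continuous].
    have oA : open (aff @^-1` inner) by apply: open_comp.
    apply: (@filterS _ (nbhs (t *: p + (1 - t) *: x)) _ (aff @^-1` inner)).
      move=> y /inner_under hy; rewrite -(affK y); apply: under_conv => //.
      by rewrite ltW.
    apply: open_nbhs_nbhs; split => //; rewrite /preimage/= /aff addrK scalerA mulVf ?gt_eqF//.
    by rewrite scale1r.
  move=> B nB.
  have c0 : {for (0 : R), continuous (fun t : R => t *: p + (1 - t) *: x)}.
    apply: continuousD; first exact: scalel_continuous.
    apply: (@continuous_comp _ _ _ (fun t : R => 1 - t) (fun s : R => s *: x)).
      by apply: continuousB; [exact: cst_continuous|exact: cvg_id].
    exact: scalel_continuous.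
  have : nbhs (0 : R) [set t : R | B (t *: p + (1 - t) *: x)].
    apply: c0; rewrite /= scale0r add0r subr0 scale1r. exact: nB.
  move=> /nbhs_ballP[/= eps eps0 heps].
  pose t := Num.min 1 (eps / 2).
  have t0 : 0 < t by rewrite lt_min ltr01 divr_gt0.
  exists (t *: p + (1 - t) *: x); split; first by apply: int => //; rewrite ge_min lexx.
  apply: heps; rewrite /ball/= sub0r normrN gtr0_norm//.
  by rewrite gt_min; apply/orP; right; lra.
Qed.

Theorem convex_toric_under : convex_toric_domain (toric_domain under_profile).
Proof.
exists under_profile; split=> //; [exact: orthant_under|exact: compact_hat_under|].
exact: convex_hat_under.
Qed.

End ConcaveProfile.

(** * The profile of the two-center problem is concave *)
Section TwoWells.
Context {R : realType}.
Variables (a b1 m : R).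
Hypotheses (a0 : 0 < a) (b10 : 0 < b1) (b1a : b1 <= 2 * a) (m0 : 0 < m).
Hypothesis bm : 4 * a <= 2 * b1 + m.
Let b2 := b1 + m.

(** Below the energy threshold the potential of nu exceeds m somewhere before
    reaching the other center w = 2, and before its maximum at
    w = b2 / (2 * a); its value at the first of these two points is already
    larger than m. *)
Lemma barrier : exists w, [/\ 0 < w, w < 2, 2 * a * w < b2 & m < w * (b2 - a * w)].
Proof.
pose f w := w * (b2 - a * w).
have b20 : 0 < b2 by rewrite addr_gt0.
suff [w0 [w00 w02 w0b fw0]] : exists w0, [/\ 0 < w0, w0 <= 2, 2 * a * w0 <= b2 & m < f w0].
  have f0 : 0 < f w0 by exact: lt_trans fw0.
  pose l := (m + f w0) / (2 * f w0).
  have lf : l * f w0 = (m + f w0) / 2 by rewrite /l; field; rewrite gt_eqF.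
  have l0 : 0 < l by apply: divr_gt0; [exact: addr_gt0|exact: mulr_gt0].
  have l1 : l < 1 by rewrite ltr_pdivrMr ?mulr_gt0//; lra.
  have lw : l * w0 < w0 by rewrite gtr_pMl.
  exists (l * w0); split; first by rewrite mulr_gt0.
  - exact: lt_le_trans lw w02.
  - by apply: lt_le_trans w0b; rewrite ltr_pM2l// mulr_gt0.
  - have -> : l * w0 * (b2 - a * (l * w0)) = l * f w0 + l * (1 - l) * (a * w0 ^+ 2).
      by rewrite /f; ring.
    have : 0 <= l * (1 - l) * (a * w0 ^+ 2).
      apply: mulr_ge0; first by apply: mulr_ge0; lra.
      by rewrite mulr_ge0 ?sqr_ge0// ltW.
    rewrite lf; lra.
have [b4|b4] := leP (4 * a) b2.
  exists 2; split=> //; first by rewrite mulrAC -natrM.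
  rewrite /f; have eb : b2 = b1 + m by []. by move: b10 b4 eb; lra.
exists (b2 / (2 * a)); split.
- by rewrite divr_gt0// mulr_gt0.
- by rewrite ler_pdivrMr ?mulr_gt0//; lra.
- by rewrite mulrC divfK// gt_eqF// mulr_gt0.
- have -> : f (b2 / (2 * a)) = (4 * a * m + 4 * a * (b2 - m) + (b2 - 4 * a) * (b2 - 4 * a)
      + 4 * a * (b2 - 4 * a)) / (4 * a).
    by rewrite /f; field; rewrite gt_eqF.
  rewrite ltr_pdivlMr ?mulr_gt0//.
  have h1 : 0 < (b2 - 4 * a) * (b2 - 4 * a) by rewrite -expr2 exprn_even_gt0//= subr_eq0 lt_eqF.
  have h2 : 0 <= a * (2 * b1 + m - 4 * a) by rewrite mulr_ge0 ?subr_ge0// ltW.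
  move: h1 h2; rewrite /b2; lra.
Qed.

Lemma well1_dom y : - (b1 ^+ 2 / (4 * a)) < y -> 0 < b1 ^+ 2 + 2 * a * 1 * y.
Proof.
move=> h; have : 0 < 2 * a * (y + b1 ^+ 2 / (4 * a)).
  by rewrite !mulr_gt0// -ltrBlDr sub0r.
have -> : 2 * a * (y + b1 ^+ 2 / (4 * a)) = 2 * a * 1 * y + b1 ^+ 2 / 2.
  by field; rewrite gt_eqF.
by have : 0 < b1 ^+ 2 by [rewrite exprn_gt0]; lra.
Qed.

Lemma well1_dom' y : - (b1 ^+ 2 / (4 * a)) < y -> 0 < wellQ a b1 1 y + 4 * a - b1.
Proof. by move=> /well1_dom/wellQ_sq[h _]; move: h a0 b1a; lra. Qed.

Lemma well2_domQ w y : w < 2 -> 2 * a * w < b2 -> y < 2 * (w * (b2 - a * w)) ->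
  b2 - 2 * a * w < wellQ a b2 (-1) y.
Proof.
move=> w2 wb hy; rewrite -[ltLHS]ger0_norm; last by rewrite subr_ge0 ltW.
rewrite -sqrtr_sqr ltr_sqrt; last first.
  have : 0 < 2 * a * (2 * (w * (b2 - a * w)) - y) by rewrite !mulr_gt0 ?subr_gt0.
  by have := sqr_ge0 (b2 - 2 * a * w); lra.
have : 0 < 2 * a * (2 * (w * (b2 - a * w)) - y) by rewrite !mulr_gt0 ?subr_gt0.
by lra.
Qed.

Lemma well2_dom w y : w < 2 -> 2 * a * w < b2 -> y < 2 * (w * (b2 - a * w)) ->
  0 < b2 ^+ 2 + 2 * a * (-1) * y.
Proof.
move=> w2 wb hy; have : 0 < 2 * a * (2 * (w * (b2 - a * w)) - y) by rewrite !mulr_gt0 ?subr_gt0.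
have := sqr_ge0 (b2 - 2 * a * w); lra.
Qed.

Lemma well2_dom' w y : w < 2 -> 2 * a * w < b2 -> y < 2 * (w * (b2 - a * w)) ->
  0 < wellQ a b2 (-1) y + 4 * a - b2.
Proof.
move=> w2 wb hy; have := well2_domQ w2 wb hy.
have : 2 * a * w < 2 * a * 2 by rewrite ltr_pM2l// mulr_gt0.
lra.
Qed.

Let T1 e := period (wellrt a b1 1) (2 * e).
Let T2 e := period (wellrt a b2 (-1)) (2 * e).

(** In units of a, the radicand of wellQ is affine in the separation constant
    q = (b + sg * e) / a, with slope 4. *)
Let shape sg b sigma (e : R) : sg ^+ 2 = 1 ->
  0 < b ^+ 2 + 2 * a * sg * (2 * e) ->
  a ^+ 2 * (4 * ((b + sg * e) / a) + sigma) = b ^+ 2 + 2 * a * sg * (2 * e) ->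
  Num.sqrt 2 / Num.sqrt (wellQ a b sg (2 * e)) *
    ell0 ((b + sg * e) / wellQ a b sg (2 * e)) =
  Num.sqrt 2 / Num.sqrt a * ell_period sigma ((b + sg * e) / a).
Proof.
move=> sg2 h es; have a2 : 0 < a ^+ 2 by rewrite exprn_gt0.
have D0 : 0 < 4 * ((b + sg * e) / a) + sigma by rewrite -(pmulr_rgt0 _ a2) es.
have -> : wellQ a b sg (2 * e) = a * Num.sqrt (4 * ((b + sg * e) / a) + sigma).
  by rewrite /wellQ -es sqrtrM ?sqr_ge0// sqrtr_sqr gtr0_norm.
rewrite /ell_period sqrtrM ?(ltW a0)//; move: (Num.sqrt _) (Num.sqrt a) => r sa.
by rewrite !invfM !mulrA; congr (_ * ell0 _); rewrite -?mulrA.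
Qed.

Let T1E e : 0 <= e <= m -> T1 e = Num.sqrt 2 / Num.sqrt a *
  ell_period ((b1 ^+ 2 - 4 * a * b1) / a ^+ 2) ((b1 + e) / a).
Proof.
move=> /andP[e0 em]; have pe : 0 < b1 ^+ 2 + 2 * a * 1 * (2 * e).
  by rewrite ltr_pwDl ?exprn_gt0// !mulr_ge0// ltW.
have [q0 _] := wellQ_sq pe.
rewrite /T1 period_elliptic//; first last.
- by rewrite mul1r ltr_pwDl.
- by move: q0 a0 b1a; lra.
- by left.
have := @shape 1 b1 ((b1 ^+ 2 - 4 * a * b1) / a ^+ 2) e; rewrite mul1r; apply=> //.
  by rewrite expr1n.
by field; rewrite gt_eqF.
Qed.

Let T2E e : 0 <= e <= m -> T2 (m - e) = Num.sqrt 2 / Num.sqrt a *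
  ell_period ((b2 ^+ 2 - 4 * a * m - 4 * a * b1) / a ^+ 2) ((b1 + e) / a).
Proof.
have [w [w0 w2 wb mw]] := barrier.
move=> /andP[e0 em]; have ye : 2 * (m - e) < 2 * (w * (b2 - a * w)) by lra.
have pe := well2_dom w2 wb ye; have q0 := well2_dom' w2 wb ye.
have be : b1 + e = b2 + -1 * (m - e) by rewrite /b2; ring.
rewrite /T2 period_elliptic//; first last.
- by rewrite -be ltr_pwDl.
- by move: q0; lra.
- by move: em; lra.
- by right; split=> //; rewrite /b2; move: bm m0; lra.
- by rewrite /b2 addr_gt0.
rewrite be; apply: shape => //; first by rewrite sqrrN expr1n.
by rewrite /b2; field; rewrite gt_eqF.
Qed.

Let scaled_le (k A B C D : R) : 0 <= k -> A * B <= C * D ->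
  k * A * (k * B) <= k * C * (k * D).
Proof. by move=> k0 AB; rewrite (mulrACA k A) (mulrACA k C); apply: ler_wpM2l => //; exact: mulr_ge0. Qed.

(** Energies e of mu and m - e of nu give the same separation constant
    (b1 + e) / a, so both periods are values of ell_period at the same point. *)
Lemma period_ratio e e' : 0 <= e -> e <= e' -> e' <= m ->
  T2 (m - e) * T1 e' <= T2 (m - e') * T1 e.
Proof.
move=> e0 ee em.
have he : 0 <= e <= m by rewrite e0 (le_trans ee).
have he' : 0 <= e' <= m by rewrite em (le_trans e0).
rewrite (T1E he) (T1E he') (T2E he) (T2E he').
apply: scaled_le; first by rewrite divr_ge0.
have a2 : 0 < a ^+ 2 by rewrite exprn_gt0.
have q_itv x : (b1 + e) / a <= x <= (b1 + e') / a -> exists t, x = (b1 + t) / a /\ 0 <= t <= m.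
  move=> /andP[x1 x2]; exists (x * a - b1); split.
    by rewrite addrC subrK mulfK// gt_eqF.
  rewrite ler_pdivrMr// in x1; rewrite ler_pdivlMr// in x2.
  by apply/andP; split; lra.
apply: ell_period_ratio.
- rewrite ler_pM2r ?invr_gt0//.
  have : 0 <= m * (2 * b1 + m - 4 * a) by rewrite mulr_ge0 ?subr_ge0// ltW.
  rewrite /b2; lra.
- by rewrite divr_gt0// ltr_pwDl.
- by rewrite ler_pM2r ?invr_gt0// lerD2l.
- move=> _ /q_itv[t [-> /andP[t0 tm]]]; rewrite -(pmulr_rgt0 _ a2).
  have -> : a ^+ 2 * (4 * ((b1 + t) / a) + (b1 ^+ 2 - 4 * a * b1) / a ^+ 2) = b1 ^+ 2 + 4 * (a * t).
    by field; rewrite gt_eqF.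
  by rewrite ltr_pwDl ?exprn_gt0// !mulr_ge0// ltW.
- move=> _ /q_itv[t [-> /andP[t0 tm]]]; rewrite -(ler_pM2l a2).
  have -> : a ^+ 2 * (4 * ((b1 + t) / a) + (b2 ^+ 2 - 4 * a * m - 4 * a * b1) / a ^+ 2) =
     ((b1 + t) ^+ 2 + (m - t) * (2 * b1 + m + t - 4 * a)).
    by rewrite /b2; field; rewrite gt_eqF.
  rewrite expr_div_n mulrC divfK ?gt_eqF// lerDl mulr_ge0//; move: bm t0 tm; lra.
Qed.

Let A1 e := pi * area (wellrt a b1 1) (2 * e).
Let A2 e := pi * area (wellrt a b2 (-1)) (2 * e).

Let d1 := b1 ^+ 2 / (4 * a).

Let d10 : 0 < d1. Proof. by rewrite divr_gt0 ?exprn_gt0 ?mulr_gt0. Qed.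

Let oJ (d y : R) : open [set t : R | - d < t < y].
Proof. by rewrite (_ : [set t : R | - d < t < y] = `]- d, y[%classic)//; exact: itv_open. Qed.

Lemma smooth_well1 y : smooth_on [set t | - d1 < t < y] (wellrt a b1 1).
Proof.
apply: smooth_wellrt => // t /andP[h _]; [exact: well1_dom|exact: well1_dom'].
Qed.

Lemma well1_gt0 t : - d1 < t -> 0 < wellrt a b1 1 t.
Proof.
move=> h; apply: (@wellrt_gt0 _ a b1 1 [set t]) => // _ ->;
  [exact: well1_dom|exact: well1_dom'].
Qed.

Lemma smooth_well2 w : w < 2 -> 2 * a * w < b2 ->
  smooth_on [set t | - 1 < t < 2 * (w * (b2 - a * w))] (wellrt a b2 (-1)).
Proof.
move=> w2 wb; apply: smooth_wellrt => // [|t /andP[_ h]|t /andP[_ h]].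
- by rewrite /b2 addr_gt0.
- exact: well2_dom h.
- exact: well2_dom' h.
Qed.

Lemma well2_gt0 w t : w < 2 -> 2 * a * w < b2 -> t < 2 * (w * (b2 - a * w)) ->
  0 < wellrt a b2 (-1) t.
Proof.
move=> w2 wb h; apply: (@wellrt_gt0 _ a b2 (-1) [set t]) => // [|_ ->|_ ->].
- by rewrite /b2 addr_gt0.
- exact: well2_dom h.
- exact: well2_dom' h.
Qed.

Let double_deriv (F T : R -> R) (e : R) :
  is_derive (2 * e) 1 F (T (2 * e) / (2 * pi)) ->
  is_derive e 1 (fun e => pi * F (2 * e)) (T (2 * e)).
Proof.
move=> h; have d2 : is_derive e 1 (fun e => 2 * e) 2.
  by apply: is_derive_eq (is_deriveZ_fun 2 (is_derive_id e 1)) _; rewrite mulr1.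
apply: is_derive_eq (is_deriveZ_fun pi (@is_derive_comp_fun _ F (fun e => 2 * e) _ _ _ h d2)) _.
have : pi != 0 :> R by rewrite gt_eqF// pi_gt0.
by move: (pi : R) (T _) => p t p0; field.
Qed.

Theorem convex_toric_wells : convex_toric_domain (toric_domain (under_profile m A1 A2)).
Proof.
have [w [w0 w2 wb mw]] := barrier.
have y10 : 0 < 2 * m + 2 by move: m0; lra.
have y20 : 0 < 2 * (w * (b2 - a * w)) by move: m0 mw; lra.
have J1 e : 0 <= e <= m -> - d1 < 2 * e < 2 * m + 2.
  move=> /andP[e0 em]; apply/andP; split; last by lra.
  by apply: (@lt_le_trans _ _ 0); rewrite ?oppr_lt0// mulr_ge0.
have J2 e : 0 <= e <= m -> - 1 < 2 * e < 2 * (w * (b2 - a * w)).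
  by move=> /andP[e0 em]; apply/andP; split; move: m0 mw; lra.
have s1 := @smooth_well1 (2 * m + 2); have s2 := smooth_well2 w2 wb.
have p1 t : - d1 < t < 2 * m + 2 -> 0 < wellrt a b1 1 t by move=> /andP[/well1_gt0].
have p2 t : - 1 < t < 2 * (w * (b2 - a * w)) -> 0 < wellrt a b2 (-1) t.
  by move=> /andP[_]; exact: well2_gt0.
apply: (@convex_toric_under _ m A1 A2 T1 T2 m0).
- move=> e /J1 je; apply: (@double_deriv (area (wellrt a b1 1)) (period (wellrt a b1 1))).
  exact: (area_deriv d10 y10 s1 je).
- move=> e /J2 je; apply: (@double_deriv (area (wellrt a b2 (-1))) (period (wellrt a b2 (-1)))).
  exact: (area_deriv ltr01 y20 s2 je).
- by move=> e /J1 je; exact: (period_gt0 d10 y10 s1 p1 je).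
- by move=> e /J2 je; exact: (period_gt0 ltr01 y20 s2 p2 je).
- by rewrite /A1 mulr0 area0 mulr0.
- by rewrite /A2 mulr0 area0 mulr0.
- exact: period_ratio.
Qed.

End TwoWells.

(** * Oscillator coordinates of the two wells *)

Section HyperbolicCoordinate.
Context {R : realType}.
Variables a b : R.
Hypotheses (a0 : 0 < a) (b0 : 0 < b).
Implicit Types t X : R.

Let W t : R := cosh t - 1.

Let W_ge0 t : 0 <= W t.
Proof. by rewrite /W subr_ge0 cosh_ge1. Qed.

Let S2 t : sinh t ^+ 2 = W t * (2 + 1 * W t).
Proof. have := cosh2_sinh2 t; rewrite /W; lra. Qed.

Let h1 x : 0 <= x -> 0 < b + 1 * a * x.
Proof. by move=> x0; rewrite mul1r ltr_pwDl// mulr_ge0// ltW. Qed.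

Let h2 (x : R) : 0 <= x -> 0 < 2 + 1 * x.
Proof. by move=> x0; rewrite mul1r ltr_pwDl. Qed.

Let h3 x : 0 <= x -> 0 < b + 2 * 1 * a * x.
Proof. by move=> x0; rewrite ltr_pwDl// !mulr_ge0// ltW. Qed.

Definition wellX1 t : R := sinh t * wellg a b 1 (W t).

Lemma wellX1_sq t : wellX1 t ^+ 2 = 2 * W t * (b + 1 * a * W t).
Proof. by rewrite /wellX1 well_sq//; [exact: h1|exact: h2]. Qed.

Lemma is_derive_expN t : is_derive t 1 (fun t : R => expR (- t)) (- expR (- t)).
Proof.
have dn : is_derive t 1 (fun t : R => - t) (- 1).
  by have := is_deriveZ_fun (- 1) (is_derive_id t 1); under eq_fun do rewrite mulN1r; rewrite mulr1.
apply: is_derive_eq (@is_derive_comp_fun _ expR (fun t : R => - t) _ _ _ (is_derive_expR _) dn) _.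
by rewrite mulrN1.
Qed.

Lemma is_derive_cosh t : is_derive t 1 (@cosh R) (sinh t).
Proof.
have := is_deriveM_fun (is_deriveD_fun (is_derive_expR t) (is_derive_expN t))
  (is_derive_cst (2^-1 : R) t 1).
by move/is_derive_eq; apply; rewrite /sinh /cst; ring.
Qed.

Lemma is_derive_sinh t : is_derive t 1 (@sinh R) (cosh t).
Proof.
have := is_deriveM_fun (is_deriveB_fun (is_derive_expR t) (is_derive_expN t))
  (is_derive_cst (2^-1 : R) t 1).
by move/is_derive_eq; apply; rewrite /cosh /cst; ring.
Qed.

Lemma wellX1_deriv t : exists2 D, is_derive t 1 wellX1 D &
  wellrt a b 1 (wellX1 t ^+ 2) * D = 1.
Proof.
have dW : is_derive t 1 W (sinh t).
  apply: is_derive_eq (is_deriveB_fun (is_derive_cosh t) (is_derive_cst (1 : R) t 1)) _.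
  by rewrite subr0.
have dS : is_derive t 1 (@sinh R) (1 + 1 * W t).
  by apply: is_derive_eq (is_derive_sinh t) _; rewrite /W; ring.
have H1 := h1 (W_ge0 t); have H2 := h2 (W_ge0 t); have H3 := h3 (W_ge0 t).
exists ((b + 2 * 1 * a * W t) / wellg a b 1 (W t)).
  exact: (@well_deriv _ a b 1 W (@sinh R) t (expr1n _ _) dW dS (S2 t)).
have [g0 _] := wellg_sq H1 H2.
rewrite wellX1_sq wellrt_well ?expr1n//.
by rewrite mulrA divfK ?mulfV// gt_eqF.
Qed.

Lemma smooth_wellX1 : smooth_on setT wellX1.
Proof.
have o := @openT R; have sid : smooth_on setT (fun t : R => t) by exact: smooth_id.
have cst (k : R) : smooth_on setT (fun _ : R => k) by exact: smooth_cst.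
have se : smooth_on setT (@expR R) := smooth_expR.
have seN : smooth_on setT (fun t : R => expR (- t)).
  by apply: (@smooth_comp _ _ setT setT expR (fun t : R => - t)) => //; exact: smoothN.
have sS : smooth_on setT (@sinh R) := smoothM o (smoothB o se seN) (cst _).
have sW : smooth_on setT W := smoothB o (smoothM o (smoothD o se seN) (cst _)) (cst _).
have sN : smooth_on setT (fun t => 2 * (b + 1 * a * W t)) :=
  smoothM o (cst _) (smoothD o (cst _) (smoothM o (cst _) sW)).
have sD : smooth_on setT (fun t => 2 + 1 * W t) :=
  smoothD o (cst _) (smoothM o (cst _) sW).
apply: (smoothM o sS); apply: smooth_sqrt_comp => //.
  by move=> t _; apply: divr_gt0; [apply: mulr_gt0 => //; exact: h1|exact: h2].
apply: (smoothM o sN); apply: smoothV => // t _.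
by rewrite gt_eqF// h2.
Qed.

(** X determines w through wellQ, and then sinh. *)
Lemma wellX1_inj t t' : wellX1 t = wellX1 t' -> t = t'.
Proof.
move=> e; have eQ u : b + 2 * 1 * a * W u = wellQ a b 1 (wellX1 u ^+ 2).
  by rewrite wellX1_sq wellQ_well ?expr1n//; exact: h3.
have eW : W t = W t'.
  have : b + 2 * 1 * a * W t = b + 2 * 1 * a * W t' by rewrite !eQ e.
  by move/addrI/mulfI; apply; rewrite mulr1 mulf_neq0// gt_eqF.
have [g0 _] := wellg_sq (h1 (W_ge0 t')) (h2 (W_ge0 t')).
have eS : sinh t = sinh t'.
  by move: e; rewrite /wellX1 eW; apply/mulIf; rewrite gt_eqF.
apply: expR_inj.
have E u : expR u = W u + 1 + sinh u :> R by rewrite /W /cosh /sinh; field.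
by rewrite !E eW eS.
Qed.

(** The value of w is read off wellQ, and the position is ln (1 + w + S). *)
Lemma wellX1_surj X : exists t, wellX1 t = X.
Proof.
have pX : 0 < b ^+ 2 + 2 * a * 1 * X ^+ 2.
  by rewrite ltr_pwDl ?exprn_gt0// mulr_ge0 ?sqr_ge0// !mulr_ge0// ltW.
have [q0 q2] := wellQ_sq pX; move: (wellQ _ _ _ _) q0 q2 => q q0 q2.
pose w := (q - b) / (2 * a).
have eq : q = b + 2 * a * w by rewrite /w; field; rewrite gt_eqF.
have w0 : 0 <= w.
  rewrite divr_ge0//; last by rewrite mulr_ge0// ltW.
  rewrite subr_ge0 -ler_sqr ?nnegrE; [|exact: ltW..].
  by rewrite q2 lerDl mulr_ge0 ?sqr_ge0// !mulr_ge0// ltW.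
have X2 : X ^+ 2 = 2 * w * (b + 1 * a * w).
  have : 2 * a * X ^+ 2 = 2 * a * (2 * w * (b + 1 * a * w)).
    by move: q2; rewrite eq; lra.
  by apply/mulfI; rewrite mulf_neq0// gt_eqF.
have [g0 g2] := wellg_sq (h1 w0) (h2 w0).
pose S := X / wellg a b 1 w.
have S2' : S ^+ 2 = (1 + w) ^+ 2 - 1.
  rewrite /S expr_div_n g2 X2; have := h1 w0; have := h2 w0.
  by rewrite !mul1r => p1 p2; field; rewrite !gt_eqF.
have S1 : 0 < 1 + w + S.
  have : `|S| < `|1 + w| by rewrite -ltr_sqr ?nnegrE// !real_normK ?num_real// S2'; lra.
  by rewrite (@ger0_norm _ (1 + w)) ?addr_ge0// ltr_norml => /andP[+ _]; lra.
have Sm : (1 + w + S) * (1 + w - S) = 1 by rewrite mulrC -subr_sqr S2'; ring.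
exists (ln (1 + w + S)).
have e1 : expR (ln (1 + w + S)) = 1 + w + S by rewrite lnK.
have e2 : expR (- ln (1 + w + S)) = 1 + w - S.
  rewrite expRN e1; apply: (mulfI (lt0r_neq0 S1)).
  by rewrite Sm mulfV// gt_eqF.
rewrite /wellX1; have -> : W (ln (1 + w + S)) = w by rewrite /W /cosh e1 e2; field.
have -> : sinh (ln (1 + w + S)) = S by rewrite /sinh e1 e2; field.
by rewrite /S divfK// gt_eqF.
Qed.

End HyperbolicCoordinate.

Section CircularCoordinate.
Context {R : realType}.
Variables a b w : R.
Hypotheses (a0 : 0 < a) (b0 : 0 < b) (w2 : w < 2) (wb : 2 * a * w < b).
Implicit Types t X x : R.

Let W t : R := 1 + cos t.

Let W_ge0 t : 0 <= W t.
Proof. by have := cos_geN1 t; rewrite /W; lra. Qed.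

Let S2 t : (- sin t) ^+ 2 = W t * (2 + -1 * W t).
Proof. by rewrite sqrrN sin2cos2 /W; ring. Qed.

Let h3 x : 0 <= x -> x <= w -> 0 < b + 2 * -1 * a * x.
Proof.
move=> x0 xw; have : 2 * a * x <= 2 * a * w by rewrite ler_pM2l// mulr_gt0.
by move: wb; lra.
Qed.

Let h1 x : 0 <= x -> x <= w -> 0 < b + -1 * a * x.
Proof. by move=> x0 xw; have := h3 x0 xw; move: b0; lra. Qed.

Let h2 (x : R) : x <= w -> 0 < 2 + -1 * x.
Proof. by move=> xw; move: w2; lra. Qed.

Let sgn2 : (-1) ^+ 2 = 1 :> R. Proof. by rewrite sqrrN expr1n. Qed.

Definition wellX2 t : R := - sin t * wellg a b (-1) (W t).

Lemma wellX2_sq t : W t <= w -> wellX2 t ^+ 2 = 2 * W t * (b + -1 * a * W t).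
Proof. by move=> tw; rewrite /wellX2 well_sq//; [exact: h1|exact: h2]. Qed.

Lemma wellX2_deriv t : W t <= w -> exists2 D, is_derive t 1 wellX2 D &
  wellrt a b (-1) (wellX2 t ^+ 2) * D = 1.
Proof.
move=> tw; have dW : is_derive t 1 W (- sin t).
  apply: is_derive_eq (is_deriveD_fun (is_derive_cst (1 : R) t 1) (is_derive_cos t)) _.
  by rewrite add0r.
have dS : is_derive t 1 (fun t : R => - sin t) (1 + -1 * W t).
  have := is_deriveZ_fun (- 1) (is_derive_sin t); under eq_fun do rewrite mulN1r.
  by move/is_derive_eq; apply; rewrite /W; ring.
have H1 := h1 (W_ge0 t) tw; have H2 := h2 tw; have H3 := h3 (W_ge0 t) tw.
exists ((b + 2 * -1 * a * W t) / wellg a b (-1) (W t)).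
  exact: (@well_deriv _ a b (-1) W (fun t : R => - sin t) t sgn2 dW dS (S2 t)).
have [g0 _] := wellg_sq H1 H2.
rewrite wellX2_sq// wellrt_well//.
by rewrite mulrA divfK ?mulfV// gt_eqF.
Qed.

Lemma smooth_wellX2 (U : set R) : open U -> (forall t, U t -> W t <= w) ->
  smooth_on U wellX2.
Proof.
move=> o UW; have sid : smooth_on U (fun t : R => t) by exact: smooth_id.
have cst (k : R) : smooth_on U (fun _ : R => k) by exact: smooth_cst.
have sS : smooth_on U (fun t : R => - sin t) := smoothN o (smooth_sin o sid).
have sW : smooth_on U W := smoothD o (cst _) (smooth_cos o sid).
have sN : smooth_on U (fun t => 2 * (b + -1 * a * W t)) :=
  smoothM o (cst _) (smoothD o (cst _) (smoothM o (cst _) sW)).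
have sD : smooth_on U (fun t => 2 + -1 * W t) :=
  smoothD o (cst _) (smoothM o (cst _) sW).
apply: (smoothM o sS); apply: smooth_sqrt_comp => //.
  by move=> t /UW tw; apply: divr_gt0; [apply: mulr_gt0 => //; exact: h1|exact: h2].
apply: (smoothM o sN); apply: smoothV => // t /UW tw.
by rewrite gt_eqF// h2.
Qed.

Lemma wellX2_inj t t' : W t <= w -> W t' <= w -> wellX2 t = wellX2 t' ->
  cos t = cos t' /\ sin t = sin t'.
Proof.
move=> tw tw' e.
have eQ u : W u <= w -> b + 2 * -1 * a * W u = wellQ a b (-1) (wellX2 u ^+ 2).
  by move=> uw; rewrite wellX2_sq// wellQ_well//; exact: h3.
have eW : W t = W t'.
  have : b + 2 * -1 * a * W t = b + 2 * -1 * a * W t' by rewrite !eQ// e.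
  by move/addrI/mulfI; apply; rewrite !mulf_neq0// ?oppr_eq0 ?oner_eq0// gt_eqF.
split; first by move: eW => /addrI.
have [g0 _] := wellg_sq (h1 (W_ge0 t') tw') (h2 tw').
by apply: oppr_inj; move: e; rewrite /wellX2 eW; apply/mulIf; rewrite gt_eqF.
Qed.

Lemma wellX2_surj X : X ^+ 2 < 2 * (w * (b - a * w)) ->
  exists t, [/\ 0 <= t <= 2 * pi, W t <= w & wellX2 t = X].
Proof.
move=> Xy.
have p0 : 0 < 2 * a by rewrite mulr_gt0.
have pX : (b - 2 * a * w) ^+ 2 < b ^+ 2 + 2 * a * -1 * X ^+ 2.
  have : 0 < 2 * a * (2 * (w * (b - a * w)) - X ^+ 2) by rewrite mulr_gt0// subr_gt0.
  lra.
have [q0 q2] := wellQ_sq (le_lt_trans (sqr_ge0 _) pX).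
move: (wellQ _ _ _ _) q0 q2 pX => q q0 q2; rewrite -q2 => pX.
have bq : b - 2 * a * w < q.
  by rewrite -(@ltr_pXn2r _ 2) ?nnegrE ?subr_ge0 ?ltW.
pose x := (b - q) / (2 * a).
have eq : q = b - 2 * a * x by rewrite /x; field; rewrite gt_eqF.
have x0 : 0 <= x.
  rewrite divr_ge0 ?(ltW p0)// subr_ge0 -ler_sqr ?nnegrE; [|exact: ltW..].
  rewrite q2.
  have : 0 <= 2 * a * X ^+ 2 by rewrite mulr_ge0 ?sqr_ge0// ltW.
  lra.
have xw : x <= w by rewrite ler_pdivrMr//; move: bq; lra.
have X2 : X ^+ 2 = 2 * x * (b + -1 * a * x).
  have : 2 * a * X ^+ 2 = 2 * a * (2 * x * (b + -1 * a * x)).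
    by move: q2; rewrite eq; lra.
  by apply/mulfI; rewrite gt_eqF.
have [g0 g2] := wellg_sq (h1 x0 xw) (h2 xw).
pose S := X / wellg a b (-1) x.
have S2' : S ^+ 2 = 1 - (x - 1) ^+ 2.
  rewrite /S expr_div_n g2 X2; have := h1 x0 xw; have := h2 xw => p1 p2.
  by field; rewrite !gt_eqF.
have [r [t [r0 /andP[t0 t2] ec es]]] := polar (x - 1) (- S).
have r1 : r = 1.
  have : r ^+ 2 = 1 ^+ 2.
    rewrite expr1n; transitivity (r ^+ 2 * (cos t ^+ 2 + sin t ^+ 2)).
      by rewrite cos2Dsin2 mulr1.
    by rewrite mulrDr -!exprMn -ec -es sqrrN S2'; ring.
  by move/eqP; rewrite eqrXn2// => /eqP.
rewrite r1 !mul1r in ec es.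
have Wt : W t = x by rewrite /W -ec; ring.
exists t; rewrite t0 ltW//; split=> //; first by rewrite Wt.
by rewrite /wellX2 Wt -es opprK /S divfK// gt_eqF.
Qed.

End CircularCoordinate.

(** * Topology of the phase space *)

Section PhaseTopology.
Context {R : realType}.
Implicit Types (z : phase R) (u : 'rV[R]_(2 + 2)).

Lemma repr_angle (x : R) : exists k : int, repr (angle x) = x + k%:~R * (2 * pi).
Proof.
have /eqmodP/intrP[k Hk] :
  (repr (angle x) = x %[mod {eq_quot angle_equivRel R}])%qT by exact: reprK.
have pi2 : 2 * pi != 0 :> R by rewrite mulf_neq0 // gt_eqF // pi_gt0.
by exists k; rewrite -Hk divfK// addrC subrK.
Qed.

Lemma angleD (x : R) (k : int) : angle (x + k%:~R * (2 * pi)) = angle x.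
Proof.
apply/eqmodP; rewrite /= /angle_equiv addrAC subrr add0r mulfK ?intr_int//.
by rewrite mulf_neq0 // gt_eqF // pi_gt0.
Qed.

Lemma circle_inj (x y : R) : 0 <= x <= 2 * pi -> 0 <= y <= 2 * pi ->
  cos x != 1 -> cos y != 1 -> cos x = cos y -> sin x = sin y -> x = y.
Proof.
wlog yx : x y / y <= x => [wl|] x02 y02 x1 y1 ec es.
  by have [/wl|/ltW/wl h] := leP y x; [exact|apply/esym/h].
have c1 : cos (x - y) = 1 by rewrite cosB ec es -!expr2 cos2Dsin2.
apply/eqP; rewrite -subr_eq0; apply/eqP/(cos_eq1_lt2pi _ c1).
rewrite subr_ge0 yx/=; case/andP: x02 => _ x2; case/andP: y02 => y0 _.
apply: (@lt_le_trans _ _ x) => //.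
  rewrite gtrBl lt_neqAle y0 andbT eq_sym; apply: contraNneq y1 => ->.
  by rewrite cos0.
Qed.

Lemma circle_cos_continuous : continuous (@circle_cos R).
Proof.
apply/quotient_continuous => x.
rewrite (_ : _ \o _ = cos); first exact: continuous_cos.
by apply/funext => y; exact: circle_cosE.
Qed.

Lemma angle_continuous : continuous (@angle R).
Proof. exact: pi_continuous. Qed.

Lemma xcoord_continuous i : continuous (fun u => xcoord u i).
Proof. exact: coord_continuous. Qed.

Lemma ycoord_continuous i : continuous (fun u => ycoord u i).
Proof. exact: coord_continuous. Qed.

Let pair_continuous (S T U : topologicalType) (f : S -> T) (g : S -> U) :
  continuous f -> continuous g -> continuous (fun s => (f s, g s)).
Proof. by move=> cf cg s; exact: (cvg_pair (cf s) (cg s)). Qed.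

Lemma phase_cover_continuous : continuous (@phase_cover R).
Proof.
have cn : continuous (fun u => angle (xcoord u 1)).
  by move=> u; exact: (continuous_comp (@xcoord_continuous 1 u) (@angle_continuous _)).
exact: (pair_continuous (pair_continuous (@xcoord_continuous 0) cn)
  (pair_continuous (@ycoord_continuous 0) (@ycoord_continuous 1))).
Qed.

Lemma phase_mu_continuous : continuous (fun z => z.1.1).
Proof. by move=> z; apply: continuous_comp; exact: cvg_fst. Qed.

Lemma phase_nu_continuous : continuous (fun z => z.1.2).
Proof. by move=> z; apply: continuous_comp; [exact: cvg_fst|exact: cvg_snd]. Qed.

Lemma phase_pmu_continuous : continuous (fun z => z.2.1).
Proof. by move=> z; apply: continuous_comp; [exact: cvg_snd|exact: cvg_fst]. Qed.

Lemma phase_pnu_continuous : continuous (fun z => z.2.2).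
Proof. by move=> z; apply: continuous_comp; exact: cvg_snd. Qed.

Lemma phase_cover_surj z : exists u,
  [/\ phase_cover u = z, 0 <= xcoord u 1 & xcoord u 1 < 2 * pi].
Proof.
have [k /andP[k0 k2]] := angle_shift (repr z.1.2) 0.
pose u : 'rV[R]_(2 + 2) := row_mx (row2 z.1.1 (repr z.1.2 + k%:~R * (2 * pi))) (row2 z.2.1 z.2.2).
have ux i : xcoord u i = row2 z.1.1 (repr z.1.2 + k%:~R * (2 * pi)) 0 i.
  by rewrite /xcoord row_mxEl.
have uy i : ycoord u i = row2 z.2.1 z.2.2 0 i by rewrite /ycoord row_mxEr.
exists u; rewrite /phase_cover !ux !uy !row2_0 !row2_1; split=> //; last by rewrite add0r in k2.
by rewrite angleD /angle reprK; case: z {u ux uy k k0 k2} => [[? ?] [? ?]].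
Qed.

Lemma star_connected (T : topologicalType) (A : set T) (x : T) : A x ->
  (forall y, A y -> exists g : R -> T, [/\ g 0 = x, g 1 = y,
     forall t : R, 0 <= t <= 1 -> {for t, continuous g} &
     forall t : R, 0 <= t <= 1 -> A (g t)]) ->
  connected A.
Proof.
move=> Ax paths.
pose I := {y | A y}; pose g (i : I) := projT1 (cid (paths _ (projT2 i))).
have gP (i : I) := projT2 (cid (paths _ (projT2 i))).
have -> : A = \bigcup_(i in [set: I]) (g i @` `[0, 1]).
  apply/seteqP; split=> [y Ay|y [i _ [t]]].
    exists (exist _ y Ay) => //; exists 1; first by rewrite /= in_itv/= lexx ler01.
    by have [_ h _ _] := gP (exist _ y Ay).
  by rewrite /= in_itv/= => ht <-; have [_ _ _ h] := gP i; exact: h.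
apply: bigcup_connected.
  exists x => i _; exists 0; first by rewrite /= in_itv/= lexx ler01.
  by have [h _ _ _] := gP i.
move=> i _; apply: connected_continuous_connected; first exact: segment_connected.
apply: continuous_in_subspaceT => t; rewrite inE/= in_itv/= => ht.
by have [_ _ h _] := gP i; exact: h.
Qed.

Lemma connected_below (T : topologicalType) (C : set T) (h : T -> R) (w : R) x :
  connected C -> continuous h -> (forall y, C y -> h y != w) -> C x -> h x < w ->
  forall y, C y -> h y < w.
Proof.
move=> cC ch hw Cx hx y Cy; have [//|hy] := ltP (h y) w.
have cI : connected (h @` C).
  by apply: connected_continuous_connected => //; exact: continuous_subspaceT.
move/connected_intervalP : cI => /(_ (h x) (h y) (imageP _ Cx) (imageP _ Cy) w).
rewrite (ltW hx) hy => /(_ isT)[z Cz e].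
by have := hw z Cz; rewrite e eqxx.
Qed.

End PhaseTopology.

(** * Action coordinates *)

Section ActionMap.
Context {R : realType}.
Variables (a b1 m w : R).
Hypotheses (a0 : 0 < a) (b10 : 0 < b1) (b1a : b1 <= 2 * a) (m0 : 0 < m).
Local Notation b2 := (b1 + m).
Hypotheses (w0 : 0 < w) (w2 : w < 2) (wb : 2 * a * w < b2) (mw : m < w * (b2 - a * w)).
Local Notation E := 'rV[R]_(2 + 2).
Local Notation rt1 := (wellrt a b1 1).
Local Notation rt2 := (wellrt a b2 (-1)).
Let y1 : R := 2 * m + 2.
Let y2 : R := 2 * (w * (b2 - a * w)).
Let d1 : R := b1 ^+ 2 / (4 * a).

Let b20 : 0 < b2. Proof. exact: addr_gt0. Qed.
Let d10 : 0 < d1. Proof. by rewrite divr_gt0 ?exprn_gt0 ?mulr_gt0. Qed.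
Let y10 : 0 < y1. Proof. by rewrite addr_gt0// mulr_gt0. Qed.
Let my2 : 2 * m < y2. Proof. by rewrite ltr_pM2l. Qed.
Let y20 : 0 < y2. Proof. by apply: lt_trans my2; rewrite mulr_gt0. Qed.
Let s1 : smooth_on [set t | - d1 < t < y1] rt1. Proof. exact: smooth_well1. Qed.
Let s2 : smooth_on [set t | - 1 < t < y2] rt2. Proof. exact: smooth_well2. Qed.
Let p1 t : - d1 < t < y1 -> 0 < rt1 t. Proof. by move=> /andP[h _]; exact: well1_gt0. Qed.
Let p2 t : - 1 < t < y2 -> 0 < rt2 t.
Proof. by move=> /andP[_]; apply: well2_gt0. Qed.

(** Twice the energies of the two oscillators, as functions of mu and of
    c = cos nu; their sum is affine in the regularized Hamiltonian. *)
Definition energy1 (t p : R) : R :=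
  2 * (cosh t - 1) * (b1 + 1 * a * (cosh t - 1)) + p ^+ 2.
Definition energy2 (c p : R) : R := 2 * (1 + c) * (b2 + -1 * a * (1 + c)) + p ^+ 2.

Lemma energy1_ge0 t p : 0 <= energy1 t p.
Proof. by rewrite /energy1 -(wellX1_sq a0 b10) addr_ge0 ?sqr_ge0. Qed.

Lemma energy2_ge0 t p : 1 + cos t <= w -> 0 <= energy2 (cos t) p.
Proof. by move=> tw; rewrite /energy2 -(wellX2_sq a0 b20 w2 wb tw) addr_ge0 ?sqr_ge0. Qed.

(** The planar maps of the two degrees of freedom side by side. The first
    argument of each is an oscillator coordinate, which straightens the energy;
    the planar map restores the symplectic form. *)
Definition action_map (t nu p q : R) : E :=
  row_mx (row2 (actX rt1 (wellX1 a b1 t) p) (actX rt2 (wellX2 a b2 nu) q))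
         (row2 (actP rt1 (wellX1 a b1 t) p) (actP rt2 (wellX2 a b2 nu) q)).

Definition lifted_map (u : E) : E :=
  action_map (xcoord u 0) (xcoord u 1) (ycoord u 0) (ycoord u 1).

(** Periodic in nu; the bounds on the energies are larger than 2 * m, so that
    its image in the phase space is a neighbourhood of the component. *)
Definition lifted_domain : set E := [set u | [/\ 1 + cos (xcoord u 1) < w,
  energy1 (xcoord u 0) (ycoord u 0) < y1 & energy2 (cos (xcoord u 1)) (ycoord u 1) < y2]].
Local Notation L := lifted_domain.

Lemma cosh_continuous : continuous (@cosh R).
Proof. by move=> t; exact: is_derive_continuous (is_derive_cosh t). Qed.

Lemma energy_continuous (T : topologicalType) (h p : T -> R) (k c s : R) :
  continuous h -> continuous p ->
  continuous (fun x => 2 * (h x + c) * (k + s * a * (h x + c)) + p x ^+ 2).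
Proof.
move=> ch cp x.
have C (r : R) : {for x, continuous (fun=> r)} by exact: cst_continuous.
have D (f g : T -> R) : {for x, continuous f} -> {for x, continuous g} ->
    {for x, continuous (fun x => f x + g x)} by exact: continuousD.
have M (f g : T -> R) : {for x, continuous f} -> {for x, continuous g} ->
    {for x, continuous (fun x => f x * g x)} by exact: continuousM.
have hc := D _ _ (ch x) (C c).
exact: (D _ _ (M _ _ (M _ _ (C 2) hc) (D _ _ (C k) (M _ _ (C (s * a)) hc))) (M _ _ (cp x) (cp x))).
Qed.

Lemma energy1_continuous (T : topologicalType) (t p : T -> R) :
  continuous t -> continuous p -> continuous (fun x => energy1 (t x) (p x)).
Proof.
move=> ct cp; apply: (@energy_continuous _ (fun x => cosh (t x))) => //.
by move=> x; exact: (continuous_comp (ct x) (@cosh_continuous _)).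
Qed.

Lemma energy2_continuous (T : topologicalType) (c p : T -> R) :
  continuous c -> continuous p -> continuous (fun x => energy2 (c x) (p x)).
Proof.
move=> cc cp; rewrite /energy2; under eq_fun do rewrite [1 + c _]addrC.
exact: energy_continuous.
Qed.

Let cosnuC : continuous (fun u : E => cos (xcoord u 1)).
Proof. by move=> u; exact: (continuous_comp (@xcoord_continuous _ 1 u) (@continuous_cos _ _)). Qed.

Let cW : continuous (fun u : E => 1 + cos (xcoord u 1)).
Proof. by move=> u; apply: continuousD; [exact: cst_continuous|exact: cosnuC]. Qed.

Let cE1 : continuous (fun u : E => energy1 (xcoord u 0) (ycoord u 0)).
Proof. by apply: energy1_continuous; [exact: xcoord_continuous|exact: ycoord_continuous]. Qed.

Let cE2 : continuous (fun u : E => energy2 (cos (xcoord u 1)) (ycoord u 1)).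
Proof. by apply: energy2_continuous; [exact: cosnuC|exact: ycoord_continuous]. Qed.

Lemma open_below (T : topologicalType) (h : T -> R) (k : R) :
  continuous h -> open [set x | h x < k].
Proof.
by move=> ch; apply: (@open_comp _ _ h [set t | t < k]) => //; exact: open_lt.
Qed.

Lemma closed_below (T : topologicalType) (h : T -> R) (k : R) :
  continuous h -> closed [set x | h x <= k].
Proof.
by move=> ch; apply: (@closed_comp _ _ h [set t | t <= k]) => //; exact: closed_le.
Qed.

Lemma open_lifted_domain : open L.
Proof.
rewrite (_ : L = [set u | 1 + cos (xcoord u 1) < w] `&`
  ([set u | energy1 (xcoord u 0) (ycoord u 0) < y1] `&`
   [set u | energy2 (cos (xcoord u 1)) (ycoord u 1) < y2])).
  by apply: openI; [exact: open_below|apply: openI; exact: open_below].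
by apply/seteqP; split=> u; [move=> []|move=> [? []]].
Qed.
Local Notation oL := open_lifted_domain.

Let X1 (u : E) := wellX1 a b1 (xcoord u 0).
Let X2 (u : E) := wellX2 a b2 (xcoord u 1).

Let sx i : smooth_on L (fun u : E => xcoord u i). Proof. exact: (smooth_coord _ oL). Qed.
Let sy i : smooth_on L (fun u : E => ycoord u i). Proof. exact: (smooth_coord _ oL). Qed.

Let sX1 : smooth_on L X1.
Proof. exact: (smooth_comp oL (fun u _ => I) (smooth_wellX1 a0 b10) (sx 0)). Qed.

Let U' : set R := [set t | 1 + cos t < w].
Let oU' : open U'.
Proof.
apply: open_below => t; apply: continuousD; first exact: cst_continuous.
exact: continuous_cos.
Qed.

Let sX2' : smooth_on U' (wellX2 a b2).
Proof. by apply: (smooth_wellX2 a0 b20 w2 wb oU') => t /ltW. Qed.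

Let LU' u : L u -> U' (xcoord u 1). Proof. by case. Qed.

Let sX2 : smooth_on L X2. Proof. exact: (smooth_comp oL LU' sX2' (sx 1)). Qed.

Let X1y u : L u -> X1 u ^+ 2 + ycoord u 0 ^+ 2 < y1.
Proof. by move=> [_ h _]; rewrite /X1 (wellX1_sq a0 b10). Qed.

Let X2y u : L u -> X2 u ^+ 2 + ycoord u 1 ^+ 2 < y2.
Proof. by move=> [/ltW h _ h']; rewrite /X2 (wellX2_sq a0 b20 w2 wb h). Qed.

Let Fx0 u : xcoord (lifted_map u) 0 = actX rt1 (X1 u) (ycoord u 0).
Proof. by rewrite /xcoord row_mxEl row2_0. Qed.
Let Fx1 u : xcoord (lifted_map u) 1 = actX rt2 (X2 u) (ycoord u 1).
Proof. by rewrite /xcoord row_mxEl row2_1. Qed.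
Let Fy0 u : ycoord (lifted_map u) 0 = actP rt1 (X1 u) (ycoord u 0).
Proof. by rewrite /ycoord row_mxEr row2_0. Qed.
Let Fy1 u : ycoord (lifted_map u) 1 = actP rt2 (X2 u) (ycoord u 1).
Proof. by rewrite /ycoord row_mxEr row2_1. Qed.

Let ord2P (i : 'I_2) : i = 0 \/ i = 1.
Proof.
case: (unliftP 0 i) => [j ->|->]; last by left.
by right; apply/val_inj; rewrite (ord1 j).
Qed.

Lemma smooth_lifted_map : smooth_on L lifted_map.
Proof.
apply: (smooth_row oL) => i; case: (split_ordP i) => j ->; case: (ord2P j) => ->.
- apply: (smooth_ext oL (fun u _ => esym (Fx0 u))).
  exact: (smooth_actX d10 y10 s1 p1 oL sX1 (sy 0) X1y).
- apply: (smooth_ext oL (fun u _ => esym (Fx1 u))).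
  exact: (smooth_actX ltr01 y20 s2 p2 oL sX2 (sy 1) X2y).
- apply: (smooth_ext oL (fun u _ => esym (Fy0 u))).
  exact: (smooth_actP d10 y10 s1 p1 oL sX1 (sy 0) X1y).
- apply: (smooth_ext oL (fun u _ => esym (Fy1 u))).
  exact: (smooth_actP ltr01 y20 s2 p2 oL sX2 (sy 1) X2y).
Qed.

Lemma omega2 (u v : E) : omega u v =
  (xcoord u 0 * ycoord v 0 - ycoord u 0 * xcoord v 0) +
  (xcoord u 1 * ycoord v 1 - ycoord u 1 * xcoord v 1).
Proof. by rewrite /omega !big_ord_recl big_ord0 addr0 lift01. Qed.

Lemma derive_coordinate n (z v : 'rV[R]_n) i : 'D_v (fun z : 'rV[R]_n => z 0 i) z = v 0 i.
Proof.
by rewrite -derive_coord ?derive_id//; exact: ex_diff.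
Qed.

(** The density of each planar form is the inverse of the derivative of the
    oscillator coordinate. *)
Lemma lifted_map_symplectic u : L u -> forall v v',
  omega ('D_v lifted_map u) ('D_v' lifted_map u) = omega v v'.
Proof.
move=> Lu v v'; have df := smooth_differentiable smooth_lifted_map Lu.
have Dx i q : xcoord ('D_q lifted_map u) i = 'D_q (fun u => xcoord (lifted_map u) i) u.
  exact: derive_coord.
have Dy i q : ycoord ('D_q lifted_map u) i = 'D_q (fun u => ycoord (lifted_map u) i) u.
  exact: derive_coord.
have D1 := act_symplectic d10 y10 s1 p1 oL sX1 (sy 0) X1y v v' Lu.
have D2 := act_symplectic ltr01 y20 s2 p2 oL sX2 (sy 1) X2y v v' Lu.
have cx i q : 'D_q (fun u : E => xcoord u i) u = xcoord q i by exact: derive_coordinate.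
have cy i q : 'D_q (fun u : E => ycoord u i) u = ycoord q i by exact: derive_coordinate.
have dx i : differentiable (fun u : E => xcoord u i) u := smooth_differentiable (sx i) Lu.
have [r1 dr1 er1] := wellX1_deriv a0 b10 (xcoord u 0).
have [|r2 dr2 er2] := @wellX2_deriv _ a b2 w a0 b20 w2 wb (xcoord u 1).
  by case: Lu => /ltW.
have e1 q : 'D_q X1 u = xcoord q 0 * r1.
  rewrite /X1 (derive_comp_scalar (F := wellX1 a b1) (g := fun u : E => xcoord u 0))//.
    by rewrite cx; case: dr1 => _ ->.
  exact: derivable_differentiable dr1.
have e2 q : 'D_q X2 u = xcoord q 1 * r2.
  rewrite /X2 (derive_comp_scalar (F := wellX2 a b2) (g := fun u : E => xcoord u 1))//.
    by rewrite cx; case: dr2 => _ ->.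
  exact: derivable_differentiable dr2.
have ex0 q : xcoord ('D_q lifted_map u) 0 = 'D_q (fun u => actX rt1 (X1 u) (ycoord u 0)) u.
  exact: etrans (Dx 0 q) (congr1 (fun G : E -> R => 'D_q G u) (funext Fx0)).
have ex1 q : xcoord ('D_q lifted_map u) 1 = 'D_q (fun u => actX rt2 (X2 u) (ycoord u 1)) u.
  exact: etrans (Dx 1 q) (congr1 (fun G : E -> R => 'D_q G u) (funext Fx1)).
have ey0 q : ycoord ('D_q lifted_map u) 0 = 'D_q (fun u => actP rt1 (X1 u) (ycoord u 0)) u.
  exact: etrans (Dy 0 q) (congr1 (fun G : E -> R => 'D_q G u) (funext Fy0)).
have ey1 q : ycoord ('D_q lifted_map u) 1 = 'D_q (fun u => actP rt2 (X2 u) (ycoord u 1)) u.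
  exact: etrans (Dy 1 q) (congr1 (fun G : E -> R => 'D_q G u) (funext Fy1)).
have sub2 (x x' y y' : R) : x = x' -> y = y' -> x - y = x' - y' by move=> -> ->.
have mul2 (x x' y y' : R) : x = x' -> y = y' -> x * y = x' * y' by move=> -> ->.
have swap (A B C D F : R) : A * B - C * D = F -> A * B - D * C = F by rewrite (mulrC D).
have key (k r A B C D : R) : k * r = 1 -> k * (A * r * B - C * r * D) = A * B - D * C.
  by move=> kr; transitivity (k * r * (A * B - D * C)); [ring|rewrite kr mul1r].
apply: (etrans (omega2 _ _)); apply: (etrans _ (esym (omega2 v v'))).
apply: congr2.
  apply: (etrans (sub2 _ _ _ _ (mul2 _ _ _ _ (ex0 v) (ey0 v')) (mul2 _ _ _ _ (ey0 v) (ex0 v')))).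
  apply: (etrans (swap _ _ _ _ _ D1)).
  apply: (etrans (mul2 _ _ _ _ erefl (sub2 _ _ _ _
    (mul2 _ _ _ _ (e1 v) (cy 0 v')) (mul2 _ _ _ _ (e1 v') (cy 0 v))))).
  exact: key er1.
apply: (etrans (sub2 _ _ _ _ (mul2 _ _ _ _ (ex1 v) (ey1 v')) (mul2 _ _ _ _ (ey1 v) (ex1 v')))).
apply: (etrans (swap _ _ _ _ _ D2)).
apply: (etrans (mul2 _ _ _ _ erefl (sub2 _ _ _ _
  (mul2 _ _ _ _ (e2 v) (cy 1 v')) (mul2 _ _ _ _ (e2 v') (cy 1 v))))).
exact: key er2.
Qed.

(* strictly between 2 * m and the bounds y1 and y2 *)
Let c1 : R := 2 * m + 1.
Let c2 : R := m + w * (b2 - a * w).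

Let c1y : c1 < y1. Proof. by rewrite /c1 /y1; lra. Qed.
Let c2y : c2 < y2. Proof. by rewrite /c2 /y2; move: mw; lra. Qed.
Let mc1 : 2 * m < c1. Proof. by rewrite /c1; lra. Qed.
Let mc2 : 2 * m < c2. Proof. by rewrite /c2; move: mw; lra. Qed.
Let c10 : 0 <= c1. Proof. by rewrite /c1; move: m0; lra. Qed.
Let c20 : 0 <= c2. Proof. by rewrite /c2; move: m0 mw; lra. Qed.

(** A compact fundamental domain on which the lifted map is injective; its
    image contains a neighbourhood of the toric domain. *)
Definition lift_compact : set E := [set u | [/\ 0 <= xcoord u 1 <= 2 * pi,
  1 + cos (xcoord u 1) <= w, energy1 (xcoord u 0) (ycoord u 0) <= c1 &
  energy2 (cos (xcoord u 1)) (ycoord u 1) <= c2]].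
Local Notation K := lift_compact.

Let N1 (z : E) : R := xcoord z 0 ^+ 2 + ycoord z 0 ^+ 2.
Let N2 (z : E) : R := xcoord z 1 ^+ 2 + ycoord z 1 ^+ 2.
Let A1 : R -> R := area rt1.
Let A2 : R -> R := area rt2.

Definition action_nbhs : set E := [set z | N1 z < A1 c1 /\ N2 z < A2 c2].
Local Notation V := action_nbhs.

(** On the wall 1 + cos nu = w the potential alone is above the bound y2. *)
Lemma energy2_barrier c p : 1 + c = w -> y2 <= energy2 c p.
Proof.
move=> e; rewrite /energy2 e /y2; have := sqr_ge0 p; lra.
Qed.

Lemma lift_compact_sub : K `<=` L.
Proof.
move=> u [_ h1 h2 h3]; split; [|exact: le_lt_trans c1y|exact: le_lt_trans c2y].
rewrite lt_neqAle h1 andbT; apply/eqP => e.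
by have := le_trans (energy2_barrier (ycoord u 1) e) h3; rewrite leNgt c2y.
Qed.

Lemma lifted_norm1 u : L u -> N1 (lifted_map u) = A1 (energy1 (xcoord u 0) (ycoord u 0)).
Proof.
move=> Lu; rewrite /N1 Fx0 Fy0 (act_norm d10 y10 s1 p1 (X1y Lu)).
by rewrite /X1 (wellX1_sq a0 b10).
Qed.

Lemma lifted_norm2 u : L u -> N2 (lifted_map u) = A2 (energy2 (cos (xcoord u 1)) (ycoord u 1)).
Proof.
move=> Lu; rewrite /N2 Fx1 Fy1 (act_norm ltr01 y20 s2 p2 (X2y Lu)).
by case: Lu => /ltW h _ _; rewrite /X2 (wellX2_sq a0 b20 w2 wb h).
Qed.

Let area1_lt x y : 0 <= x -> x < y -> y <= c1 -> A1 x < A1 y.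
Proof.
move=> x0 xy yc; apply: (area_lt d10 y10 s1 p1) => //; last exact: le_lt_trans c1y.
by apply: lt_le_trans x0; rewrite oppr_lt0.
Qed.

Let area2_lt x y : 0 <= x -> x < y -> y <= c2 -> A2 x < A2 y.
Proof.
move=> x0 xy yc; apply: (area_lt ltr01 y20 s2 p2) => //; last exact: le_lt_trans c2y.
by apply: lt_le_trans x0; rewrite oppr_lt0.
Qed.

Let area1_le x y : 0 <= x -> 0 <= y -> x <= c1 -> y <= c1 -> (A1 x <= A1 y) = (x <= y).
Proof.
move=> x0 y0 xc yc; have [xy|yx] := leP x y.
  move: xy; rewrite le_eqVlt => /predU1P[->|xy]; first exact: lexx.
  exact/ltW/area1_lt.
by apply/negbTE; rewrite -ltNge; exact: area1_lt.
Qed.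

Let area2_le x y : 0 <= x -> 0 <= y -> x <= c2 -> y <= c2 -> (A2 x <= A2 y) = (x <= y).
Proof.
move=> x0 y0 xc yc; have [xy|yx] := leP x y.
  move: xy; rewrite le_eqVlt => /predU1P[->|xy]; first exact: lexx.
  exact/ltW/area2_lt.
by apply/negbTE; rewrite -ltNge; exact: area2_lt.
Qed.

Let rowE (u u' : E) : xcoord u 0 = xcoord u' 0 -> xcoord u 1 = xcoord u' 1 ->
  ycoord u 0 = ycoord u' 0 -> ycoord u 1 = ycoord u' 1 -> u = u'.
Proof.
by move=> ? ? ? ?; apply/rowP => i; case: (split_ordP i) => j ->; case: (ord2P j) => ->.
Qed.

Lemma lifted_map_inj u u' : K u -> K u' -> lifted_map u = lifted_map u' -> u = u'.
Proof.
move=> Ku Ku' e; have Lu := lift_compact_sub Ku; have Lu' := lift_compact_sub Ku'.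
have [eX1 eP1] : X1 u = X1 u' /\ ycoord u 0 = ycoord u' 0.
  apply: (act_inj d10 y10 s1 p1 (X1y Lu) (X1y Lu')).
    by rewrite -!Fx0 e.
  by rewrite -!Fy0 e.
have [eX2 eP2] : X2 u = X2 u' /\ ycoord u 1 = ycoord u' 1.
  apply: (act_inj ltr01 y20 s2 p2 (X2y Lu) (X2y Lu')).
    by rewrite -!Fx1 e.
  by rewrite -!Fy1 e.
case: Ku => /andP[n0 n2] nw _ _; case: Ku' => /andP[n0' n2'] nw' _ _.
have [ec es] := wellX2_inj a0 b20 w2 wb nw nw' eX2.
apply: rowE; [exact: (wellX1_inj a0 b10 eX1)| |exact: eP1|exact: eP2].
have c1' (x : R) : 1 + cos x <= w -> cos x != 1.
  by move=> h; apply/eqP => cx1; move: h w2; rewrite cx1; lra.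
exact: (circle_inj (introT andP (conj n0 n2)) (introT andP (conj n0' n2'))
  (c1' _ nw) (c1' _ nw') ec es).
Qed.

Lemma lifted_map_surj z : V z -> exists u, K u /\ lifted_map u = z.
Proof.
move=> [/ltW v1 /ltW v2].
have c1b : 0 <= c1 < y1 by rewrite c10 c1y.
have c2b : 0 <= c2 < y2 by rewrite c20 c2y.
have [x1 [q1 [le1 ex1 eq1]]] := act_surj d10 y10 s1 p1 c1b v1.
have [x2 [q2 [le2 ex2 eq2]]] := act_surj ltr01 y20 s2 p2 c2b v2.
have [t1 et1] := wellX1_surj a0 b10 x1.
have [|t2 [t2b t2w et2]] := @wellX2_surj _ a b2 w a0 b20 w2 wb x2.
  by apply: le_lt_trans c2y; apply: le_trans le2; rewrite lerDl sqr_ge0.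
pose u : E := row_mx (row2 t1 t2) (row2 q1 q2).
have u0 : xcoord u 0 = t1 by rewrite /xcoord row_mxEl row2_0.
have u1 : xcoord u 1 = t2 by rewrite /xcoord row_mxEl row2_1.
have u2 : ycoord u 0 = q1 by rewrite /ycoord row_mxEr row2_0.
have u3 : ycoord u 1 = q2 by rewrite /ycoord row_mxEr row2_1.
exists u; split.
  split; rewrite ?u0 ?u1 ?u2 ?u3//.
    by rewrite /energy1 -(wellX1_sq a0 b10) et1.
  by rewrite /energy2 -(wellX2_sq a0 b20 w2 wb t2w) et2.
apply: rowE; rewrite ?Fx0 ?Fx1 ?Fy0 ?Fy1 /X1 /X2 ?u0 ?u1 ?u2 ?u3 ?et1 ?et2//.
Qed.

Lemma sq_bound (p c : R) : p ^+ 2 <= c -> `|p| <= 1 + c.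
Proof.
move=> pc; have : 0 <= (`|p| - 1) ^+ 2 by exact: sqr_ge0.
have := real_normK (num_real p); have := normr_ge0 p; have := sqr_ge0 p; nra.
Qed.

Lemma energy1_bound t p c : energy1 t p <= c -> `|t| <= c / b1 + 1 /\ p ^+ 2 <= c.
Proof.
move=> h; have W0 : 0 <= cosh t - 1 by rewrite subr_ge0 cosh_ge1.
have h' : energy1 t p = 2 * b1 * (cosh t - 1) + 2 * a * (cosh t - 1) ^+ 2 + p ^+ 2.
  by rewrite /energy1; ring.
have k1 : 0 <= 2 * a * (cosh t - 1) ^+ 2 by rewrite mulr_ge0 ?sqr_ge0// mulr_ge0// ltW.
have k2 : 0 <= 2 * b1 * (cosh t - 1) by rewrite mulr_ge0// mulr_ge0// ltW.
have k3 := sqr_ge0 p.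
split; last by lra.
have : `|t| <= 2 * (cosh t - 1) + 1.
  rewrite /cosh; have := expR_ge1Dx t; have := expR_ge1Dx (- t).
  have := expR_ge0 t; have := expR_ge0 (- t); rewrite ler_norml => *.
  by apply/andP; split; lra.
move/le_trans; apply; rewrite lerD2r ler_pdivlMr//; lra.
Qed.

Lemma energy2_bound c p k : 0 <= 1 + c <= w -> energy2 c p <= k -> p ^+ 2 <= k.
Proof.
move=> /andP[c0 cw] h; have : 0 <= 2 * (1 + c) * (b2 + -1 * a * (1 + c)).
  apply: mulr_ge0; first by rewrite mulr_ge0.
  have : 2 * a * (1 + c) <= 2 * a * w by rewrite ler_pM2l// mulr_gt0.
  by move: wb b20; lra.
by move: h; rewrite /energy2; lra.
Qed.

Let W0 t : 0 <= 1 + cos t :> R. Proof. by have := cos_geN1 t; lra. Qed.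

Lemma compact_lift_compact : compact K.
Proof.
pose M := c1 / b1 + 1 + (1 + c1) + (1 + c2) + 2 * pi.
have pi0 : 0 < pi :> R := pi_gt0 R.
have cb : 0 <= c1 / b1 by rewrite divr_ge0// ltW.
have cK := @rV_compact R (2 + 2) (fun=> `[- M, M]%classic) (fun=> @segment_compact R _ _).
apply: (subclosed_compact _ cK).
  rewrite (_ : K = ([set u | - xcoord u 1 <= 0] `&` [set u | xcoord u 1 <= 2 * pi]) `&`
    ([set u | 1 + cos (xcoord u 1) <= w] `&`
    ([set u | energy1 (xcoord u 0) (ycoord u 0) <= c1] `&`
     [set u | energy2 (cos (xcoord u 1)) (ycoord u 1) <= c2]))).
    have cN : continuous (fun u : E => - xcoord u 1).
      by move=> u; apply: continuousN; exact: xcoord_continuous.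
    have k1 : closed [set u : E | - xcoord u 1 <= 0] by exact: closed_below.
    have k2 : closed [set u : E | xcoord u 1 <= 2 * pi].
      by apply: closed_below; exact: xcoord_continuous.
    have k3 : closed [set u : E | 1 + cos (xcoord u 1) <= w] by exact: closed_below.
    have k4 : closed [set u : E | energy1 (xcoord u 0) (ycoord u 0) <= c1].
      exact: closed_below.
    have k5 : closed [set u : E | energy2 (cos (xcoord u 1)) (ycoord u 1) <= c2].
      exact: closed_below.
    exact: (closedI (closedI k1 k2) (closedI k3 (closedI k4 k5))).
  apply/seteqP; split=> u /=.
    by move=> [/andP[? ?] ? ? ?]; rewrite oppr_le0.
  by move=> [[+ ?] [? [? ?]]]; rewrite oppr_le0 => ?; split=> //; apply/andP.
move=> u [/andP[n0 n2] nw k1 k2] i /=; rewrite in_itv/= -ler_norml.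
have [t1 /sq_bound q1] := energy1_bound k1.
have /sq_bound q2 : ycoord u 1 ^+ 2 <= c2 by apply: (energy2_bound _ k2); rewrite W0.
have n1 : `|xcoord u 1| <= 2 * pi by rewrite ger0_norm.
case: (split_ordP i) => j ->; case: (ord2P j) => ->; rewrite -/(xcoord _ _) -/(ycoord _ _) /M;
  move: c10 c20 t1 q1 q2 n1; lra.
Qed.

Let oV : open V.
Proof.
have cN (i : 'I_2) : continuous (fun z : E => xcoord z i ^+ 2 + ycoord z i ^+ 2).
  move=> z; have cx := @xcoord_continuous R i z; have cy := @ycoord_continuous R i z.
  exact: (@continuousD _ _ _ (fun z : E => xcoord z i * xcoord z i) (fun z : E => ycoord z i * ycoord z i)
    z (continuousM cx cx) (continuousM cy cy)).
rewrite (_ : V = [set z | N1 z < A1 c1] `&` [set z | N2 z < A2 c2])//.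
by apply: openI; apply: open_below; exact: cN.
Qed.

Definition lifted_inverse (z : E) : E := xget 0 [set u | K u /\ lifted_map u = z].
Local Notation H := lifted_inverse.

Lemma lifted_inverseP z : V z -> K (H z) /\ lifted_map (H z) = z.
Proof.
move=> /lifted_map_surj[u hu].
by apply: (@xgetPex _ 0 [set u | K u /\ lifted_map u = z]); exists u.
Qed.

Lemma smooth_lifted_inverse : smooth_on V H.
Proof.
apply: (inverse_smooth open_lifted_domain smooth_lifted_map lifted_map_symplectic
  lift_compact_sub compact_lift_compact oV lifted_map_inj) => z /lifted_inverseP[]//.
Qed.


(** * The ball around e and its boundary *)
Implicit Types z : phase R.

Definition phase_energy1 z : R := energy1 z.1.1 z.2.1.
Definition phase_energy2 z : R := energy2 (circle_cos z.1.2) z.2.2.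
Local Notation E1 := phase_energy1.
Local Notation E2 := phase_energy2.

Let cE1' : continuous E1.
Proof. by apply: energy1_continuous; [exact: phase_mu_continuous|exact: phase_pmu_continuous]. Qed.

Let ccos : continuous (fun z : phase R => circle_cos z.1.2).
Proof. by move=> z; exact: (continuous_comp (@phase_nu_continuous R z) (@circle_cos_continuous R _)). Qed.

Let cE2' : continuous E2.
Proof. by apply: energy2_continuous; [exact: ccos|exact: phase_pnu_continuous]. Qed.

Lemma shift_continuous (T : topologicalType) (h : T -> R) :
  continuous h -> continuous (fun x => 1 + h x).
Proof. by move=> ch x; apply: continuousD; [exact: cst_continuous|exact: ch]. Qed.

Let cW' : continuous (fun z : phase R => 1 + circle_cos z.1.2).
Proof.
exact: shift_continuous ccos.
Qed.

Lemma phase_energy_cover u : E1 (phase_cover u) = energy1 (xcoord u 0) (ycoord u 0) /\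
  E2 (phase_cover u) = energy2 (cos (xcoord u 1)) (ycoord u 1).
Proof. by rewrite /phase_energy2 /= circle_cosE. Qed.

Definition phase_map z : E := action_map z.1.1 (repr z.1.2) z.2.1 z.2.2.

Lemma phase_map_cover : phase_map \o phase_cover = lifted_map.
Proof.
apply/funext => u; rewrite /phase_map /lifted_map /= /action_map.
have -> : wellX2 a b2 (repr (angle (xcoord u 1))) = wellX2 a b2 (xcoord u 1) => //.
by have [k ->] := repr_angle (xcoord u 1); rewrite /wellX2 sinDint cosDint.
Qed.

Let phase_map_coverE u : phase_map (phase_cover u) = lifted_map u.
Proof. exact: (congr1 (fun g => g u) phase_map_cover). Qed.

Definition ball_at_e : set (phase R) :=
  [set z | E1 z + E2 z <= 2 * m /\ 1 + circle_cos z.1.2 <= w].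
Definition sphere_at_e : set (phase R) :=
  [set z | E1 z + E2 z = 2 * m /\ 1 + circle_cos z.1.2 <= w].
Local Notation D := ball_at_e.
Local Notation S := sphere_at_e.

Lemma barrier_energy z : 1 + circle_cos z.1.2 = w -> 2 * m < E1 z + E2 z.
Proof.
move=> zw; have := energy2_barrier z.2.2 zw; rewrite -/(E2 z) => h.
by have := energy1_ge0 z.1.1 z.2.1; rewrite -/(E1 z); move: my2 h; lra.
Qed.

Lemma ball_strict z : D z -> 1 + circle_cos z.1.2 < w.
Proof.
move=> [h]; rewrite le_eqVlt => /predU1P[/barrier_energy|//].
by rewrite ltNge h.
Qed.

Lemma sphere_sub_ball : S `<=` D.
Proof. by move=> z [h1 h2]; split=> //; rewrite h1. Qed.

Let E1_ge0 z : 0 <= E1 z. Proof. exact: energy1_ge0. Qed.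
Let E2_ge0 z : 1 + circle_cos z.1.2 <= w -> 0 <= E2 z.
Proof. exact: energy2_ge0. Qed.

Lemma ball_lift z : D z -> exists2 u, phase_cover u = z & K u.
Proof.
move=> Dz; have [u [uz u0 u2]] := phase_cover_surj z; exists u => //.
case: Dz => eD zw; have e1 := E1_ge0 z; have e2 := E2_ge0 zw.
have [h1 h2] := phase_energy_cover u; rewrite uz in h1 h2.
split; first by rewrite u0 ltW.
- by move: zw; rewrite -uz /= circle_cosE.
- by rewrite -h1; apply: ltW; move: mc1 e2 eD; lra.
- by rewrite -h2; apply: ltW; move: mc2 e1 eD; lra.
Qed.

Let X := toric_domain (under_profile m (fun e => pi * A1 (2 * e)) (fun e => pi * A2 (2 * e))).

Lemma toricP (v : E) : X v <->
  exists e, [/\ 0 <= e <= m, N1 v <= A1 (2 * e) & N2 v <= A2 (2 * (m - e))].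
Proof.
have pi0 : 0 < pi :> R := pi_gt0 R.
rewrite /X /toric_domain /=; set r : 'rV[R]_2 := \row_i _.
have r0 : r 0 0 = pi * N1 v by rewrite mxE.
have r1 : r 0 1 = pi * N2 v by rewrite mxE.
split=> [[_ [e [he]]]|[e [he h1 h2]]].
  rewrite r0 r1 (ler_pM2l pi0 (N1 v)) (ler_pM2l pi0 (N2 v)) => h1 h2.
  exact: (ex_intro _ e (And3 he h1 h2)).
split; last first.
  exists e; rewrite r0 r1 (ler_pM2l pi0 (N1 v)) (ler_pM2l pi0 (N2 v)).
  exact: (And3 he h1 h2).
move=> i; rewrite /r mxE; apply: mulr_ge0; first exact: ltW.
by apply: addr_ge0; exact: sqr_ge0.
Qed.

Lemma toric_sub : X `<=` V.
Proof.
move=> v /toricP[e [/andP[e0 em] h1 h2]]; split.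
  by apply: le_lt_trans h1 _; apply: area1_lt => //; [rewrite mulr_ge0|move: mc1; lra].
by apply: le_lt_trans h2 _; apply: area2_lt => //; [rewrite mulr_ge0 ?subr_ge0|move: mc2; lra].
Qed.

Definition phase_inverse (v : E) : phase R := phase_cover (H v).

Lemma phase_inverseK v : V v -> phase_map (phase_inverse v) = v.
Proof.
by move=> /lifted_inverseP[_ e]; rewrite /phase_inverse phase_map_coverE.
Qed.

Lemma phase_map_norms z : D z ->
  N1 (phase_map z) = A1 (E1 z) /\ N2 (phase_map z) = A2 (E2 z).
Proof.
move=> /ball_lift[u <- /lift_compact_sub Lu]; have [-> ->] := phase_energy_cover u.
rewrite phase_map_coverE.
by split; [exact: lifted_norm1|exact: lifted_norm2].
Qed.

Lemma phase_inverse_energies v : V v -> [/\ 1 + circle_cos (phase_inverse v).1.2 <= w,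
  E1 (phase_inverse v) <= c1, E2 (phase_inverse v) <= c2,
  N1 v = A1 (E1 (phase_inverse v)) & N2 v = A2 (E2 (phase_inverse v))].
Proof.
move=> /lifted_inverseP[Kv e]; have Lv := lift_compact_sub Kv.
have [h1 h2] := phase_energy_cover (H v).
rewrite /phase_inverse h1 h2 -(lifted_norm1 Lv) -(lifted_norm2 Lv) e.
by case: Kv => _ k1 k2 k3; split=> //; rewrite /= circle_cosE.
Qed.

Lemma phase_map_toric z : D z -> X (phase_map z).
Proof.
move=> Dz; have [n1 n2] := phase_map_norms Dz; case: Dz => eD zw.
have e1 := E1_ge0 z; have e2 := E2_ge0 zw.
apply/toricP; exists (E1 z / 2); rewrite n1 n2.
have -> : 2 * (E1 z / 2) = E1 z by field.
split; [by apply/andP; split; move: e1 e2 eD; lra|exact: lexx|].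
by rewrite (area2_le e2); move: mc2 e1 e2 eD; lra.
Qed.

Let le_c1 (e : R) : e <= m -> 2 * e <= c1. Proof. by move: mc1; lra. Qed.
Let le_c2 (e : R) : 0 <= e -> 2 * (m - e) <= c2. Proof. by move: mc2; lra. Qed.
Let sum_le (x y e : R) : x <= 2 * e -> y <= 2 * (m - e) -> x + y <= 2 * m.
Proof. lra. Qed.

Lemma phase_inverse_ball v : X v -> D (phase_inverse v).
Proof.
move=> Xv; have [zw k1 k2 n1 n2] := phase_inverse_energies (toric_sub Xv).
case/toricP: Xv => e [/andP[e0 em] h1 h2].
have e1 := E1_ge0 (phase_inverse v); have e2 := E2_ge0 zw.
have e3 : 0 <= 2 * e by rewrite mulr_ge0.
have e4 : 0 <= 2 * (m - e) by rewrite mulr_ge0// subr_ge0.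
have k3 := le_c1 em; have k4 := le_c2 e0.
have l1 : E1 (phase_inverse v) <= 2 * e.
  by rewrite -(area1_le e1 e3 k1 k3); exact: (eq_ind _ (fun x => x <= _) h1 _ n1).
have l2 : E2 (phase_inverse v) <= 2 * (m - e).
  by rewrite -(area2_le e2 e4 k2 k4); exact: (eq_ind _ (fun x => x <= _) h2 _ n2).
by split; [exact: sum_le l1 l2|exact: zw].
Qed.

Lemma phase_mapK z : D z -> phase_inverse (phase_map z) = z.
Proof.
move=> Dz; have Vz := toric_sub (phase_map_toric Dz).
have [u uz Ku] := ball_lift Dz; have [Kv e] := lifted_inverseP Vz.
have e' : phase_map z = lifted_map u := etrans (congr1 phase_map (esym uz)) (phase_map_coverE u).
exact: etrans (congr1 phase_cover (lifted_map_inj Kv Ku (etrans e e'))) uz.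
Qed.

(** The lifted map is smooth on a neighbourhood of the ball, and its inverse on
    the compact fundamental domain is smooth by the symplectic inverse
    theorem. *)
Lemma phase_map_symplectomorphism : symplectomorphism D X phase_map.
Proof.
split.
- split.
  + exact: phase_map_toric.
  + by move=> z z' /set_mem Dz /set_mem Dz' e; rewrite -(phase_mapK Dz) e phase_mapK.
  + move=> v Xv; exists (phase_inverse v); first exact: phase_inverse_ball.
    exact: phase_inverseK (toric_sub Xv).
- exists [set z | [/\ 1 + circle_cos z.1.2 < w, E1 z < y1 & E2 z < y2]]; split.
  + rewrite (_ : mkset _ = [set z | 1 + circle_cos z.1.2 < w] `&`
      ([set z | E1 z < y1] `&` [set z | E2 z < y2])).
      exact: (openI (open_below w cW') (openI (open_below y1 cE1') (open_below y2 cE2'))).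
    by apply/seteqP; split=> z; [move=> []|move=> [? []]].
  + move=> z Dz; split; first exact: ball_strict.
      have [u uz /lift_compact_sub[_ h _]] := ball_lift Dz.
      by have [e1 _] := phase_energy_cover u; rewrite -uz e1.
    have [u uz /lift_compact_sub[_ _ h]] := ball_lift Dz.
    by have [_ e2] := phase_energy_cover u; rewrite -uz e2.
  + rewrite /smooth_from_phase phase_map_cover.
    apply: (@smooth_sub _ _ _ L) smooth_lifted_map => u [].
    have [-> ->] := phase_energy_cover u.
    by rewrite /= circle_cosE.
- exists phase_inverse, V; split; [exact: oV|exact: toric_sub| |exact: phase_mapK].
  move=> v Vv; exists V, H; split; [exact: oV|exact: Vv|exact: smooth_lifted_inverse|by []].
- move=> u Du v v'; rewrite phase_map_cover.
  have Lu : L u.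
    have [u' uu' /lift_compact_sub[h1 h2 h3]] := ball_lift Du.
    have [e1 e2] := phase_energy_cover u; have [e1' e2'] := phase_energy_cover u'.
    rewrite uu' e1 in e1'; rewrite uu' e2 in e2'.
    split; rewrite ?e1' ?e2'//.
    by have := ball_strict Du; rewrite /= circle_cosE.
  have du := smooth_differentiable smooth_lifted_map Lu.
  by rewrite -!(deriveE _ du); exact: lifted_map_symplectic.
Qed.

Lemma sum_continuous (T : topologicalType) (g h : T -> R) :
  continuous g -> continuous h -> continuous (fun x => g x + h x).
Proof. by move=> cg ch x; exact: (continuousD (cg x) (ch x)). Qed.

Lemma closed_ball_at_e : closed D.
Proof.
have cE : continuous (fun z => E1 z + E2 z).
  exact: sum_continuous cE1' cE2'.
rewrite (_ : D = [set z | E1 z + E2 z <= 2 * m] `&` [set z | 1 + circle_cos z.1.2 <= w])//.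
have k1 : closed [set z | E1 z + E2 z <= 2 * m] by exact: closed_below.
have k2 : closed [set z : phase R | 1 + circle_cos z.1.2 <= w] by exact: closed_below.
exact: closedI k1 k2.
Qed.

Lemma compact_ball_at_e : compact D.
Proof.
apply: (subclosed_compact closed_ball_at_e (B := phase_cover @` K)).
  apply: continuous_compact; last exact: compact_lift_compact.
  by apply: continuous_subspaceT; exact: phase_cover_continuous.
by move=> z /ball_lift[u uz Ku]; exists u.
Qed.

Let interior_ball z : E1 z + E2 z < 2 * m -> 1 + circle_cos z.1.2 < w -> D° z.
Proof.
move=> hE hW; have cE : continuous (fun z => E1 z + E2 z).
  exact: sum_continuous cE1' cE2'.
have o := openI (open_below (2 * m) cE) (open_below w cW').
apply: filterS (open_nbhs_nbhs (conj o (conj hE hW))) => z' [h1 h2].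
by split; exact: ltW.
Qed.

(* Raising the absolute value of p_mu raises the energy. *)
Let kick z (t : R) : phase R := (z.1, (z.2.1 + t * (if 0 <= z.2.1 then 1 else - 1), z.2.2)).

Let kick_energy z t : 0 < t -> E1 z + E2 z < E1 (kick z t) + E2 (kick z t).
Proof.
move=> t0; rewrite ltrD2r /phase_energy1 /energy1 /= ltrD2l.
have [p0|p0] := leP 0 z.2.1.
  by rewrite mulr1 sqrrD -addrA ltrDl ltr_wpDl ?exprn_gt0// mulrn_wge0// mulr_ge0// ltW.
suff key (p s : R) : 0 < s -> p < 0 -> p ^+ 2 < (p + s * -1) ^+ 2 by exact: key.
move=> s0 pn; have sp : 0 < s * - p by rewrite mulr_gt0 ?oppr_gt0.
have ss : 0 < s ^+ 2 by rewrite exprn_gt0.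
have -> : (p + s * -1) ^+ 2 = p ^+ 2 + 2 * (s * - p) + s ^+ 2 by ring.
by move: ss sp; move: (s ^+ 2) (s * - p) => *; lra.
Qed.

Let kick_continuous z : {for (0 : R), continuous (kick z)}.
Proof.
have k1 : {for (0 : R), continuous (fun=> z.1 : (R * circle R)%type)} by exact: cst_continuous.
have k2 : {for (0 : R), continuous
    (fun t : R => z.2.1 + t * (if 0 <= z.2.1 then 1 else - 1))}.
  apply: continuousD; first exact: cst_continuous.
  by apply: continuousM; [exact: cvg_id|exact: cst_continuous].
have k3 : {for (0 : R), continuous (fun=> z.2.2 : R)} by exact: cst_continuous.
exact: (cvg_pair k1 (cvg_pair k2 k3)).
Qed.

Let kick0 z : kick z 0 = z.
Proof. by rewrite /kick mul0r addr0; case: z => [[? ?] [? ?]]. Qed.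

Lemma boundary_ball_at_e : boundary D = S.
Proof.
rewrite /boundary -(closure_id _).1; last exact: closed_ball_at_e.
apply/seteqP; split=> z.
  move=> [Dz nz]; have [hE hW] := Dz; split=> //; apply/eqP; rewrite eq_le hE/= leNgt.
  by apply/negP => h; apply: nz; exact: interior_ball (ball_strict Dz).
move=> Sz; split; first exact: sphere_sub_ball.
move=> iz; have : nbhs (0 : R) [set t | D (kick z t)].
  by apply: kick_continuous; rewrite kick0.
move=> /nbhs_ballP[/= e e0 he]; have e2 : 0 < e / 2 by rewrite divr_gt0.
have [|h _] := he (e / 2).
  by rewrite /ball/= sub0r normrN gtr0_norm// ltr_pdivrMr// mulr_natr mulr2n ltrDr.
by have := kick_energy z e2; case: Sz => -> _; rewrite ltNge h.
Qed.

Let phase_inverse_continuous v : V v -> {for v, continuous phase_inverse}.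
Proof.
move=> Vv; have cH := smooth_cont smooth_lifted_inverse Vv.
exact: (continuous_comp cH (@phase_cover_continuous R _)).
Qed.

Let N1Z (t : R) v : N1 (t *: v) = t ^+ 2 * N1 v.
Proof. by rewrite /N1 /xcoord /ycoord !mxE; ring. Qed.
Let N2Z (t : R) v : N2 (t *: v) = t ^+ 2 * N2 v.
Proof. by rewrite /N2 /xcoord /ycoord !mxE; ring. Qed.
Let N1_ge0 v : 0 <= N1 v. Proof. by apply: addr_ge0; exact: sqr_ge0. Qed.
Let N2_ge0 v : 0 <= N2 v. Proof. by apply: addr_ge0; exact: sqr_ge0. Qed.

Let toricZ (t : R) v : 0 <= t <= 1 -> X v -> X (t *: v).
Proof.
move=> /andP[t0 t1] /toricP[e [he h1 h2]]; apply/toricP; exists e.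
have tt : t ^+ 2 <= 1 by rewrite exprn_ile1.
split; [exact: he| |].
  by rewrite N1Z; apply: le_trans h1; exact: ler_piMl.
by rewrite N2Z; apply: le_trans h2; exact: ler_piMl.
Qed.

(** The toric domain is star-shaped, and the ball is its continuous image. *)
Lemma connected_ball_at_e : connected D.
Proof.
have scale1 (t : R) (v : E) : {for t, continuous (fun t : R => t *: v)}.
  exact: scalel_continuous.
have X0 : X 0.
  apply/toricP; exists 0; rewrite /N1 /N2 /xcoord /ycoord !mxE expr0n/= addr0.
  split; first by rewrite lexx ltW.
    by rewrite mulr0 /A1 area0.
  have m2 : 0 <= 2 * (m - 0) by rewrite subr0 mulr_ge0// ltW.
  have : A2 0 <= A2 (2 * (m - 0)) by rewrite (area2_le (lexx 0) m2 c20 (le_c2 (lexx 0))).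
  by rewrite {1}/A2 area0.
apply: (@star_connected _ _ _ (phase_inverse 0)); first exact: phase_inverse_ball.
move=> z Dz; exists (fun t => phase_inverse (t *: phase_map z)).
split; [by rewrite scale0r|by rewrite scale1r phase_mapK| |] => t ht;
  have Xt := toricZ ht (phase_map_toric Dz); last exact: phase_inverse_ball.
exact: (continuous_comp (scale1 t (phase_map z)) (phase_inverse_continuous (toric_sub Xt))).
Qed.


Let split_eq (x y e : R) : x <= 2 * e -> y <= 2 * (m - e) -> x + y = 2 * m ->
  2 * e = x /\ 2 * (m - e) = y.
Proof. by move=> *; split; lra. Qed.
Let part1_le (x y : R) : 0 <= y -> x + y = 2 * m -> x <= c1. Proof. by move: mc1; lra. Qed.
Let part2_le (x y : R) : 0 <= x -> x + y = 2 * m -> y <= c2. Proof. by move: mc2; lra. Qed.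
Let half_itv (x y : R) : 0 <= x -> 0 <= y -> x + y = 2 * m -> 0 <= x / 2 <= m.
Proof. by move=> *; apply/andP; split; lra. Qed.
Let half_eq (x y : R) : x + y = 2 * m -> y = 2 * (m - x / 2). Proof. lra. Qed.

Let toric_image : X = lifted_map @` (K `&` [set u | energy1 (xcoord u 0) (ycoord u 0) +
  energy2 (cos (xcoord u 1)) (ycoord u 1) <= 2 * m]).
Proof.
apply/seteqP; split=> [v Xv|_ [u [Ku uE] <-]].
  have [Kv e] := lifted_inverseP (toric_sub Xv); exists (H v); last exact: e.
  split; first exact: Kv.
  have [h1 h2] := phase_energy_cover (H v); rewrite /= -h1 -h2.
  by have [] := phase_inverse_ball Xv.
rewrite -phase_map_coverE; apply: phase_map_toric.
have [h1 h2] := phase_energy_cover u; split; first by rewrite h1 h2.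
by case: Ku => _ h _ _; rewrite /= circle_cosE.
Qed.

Lemma closed_toric : closed X.
Proof.
apply: compact_closed; first exact: norm_hausdorff.
rewrite toric_image; apply: continuous_compact.
  apply: continuous_in_subspaceT => u; rewrite inE => -[/lift_compact_sub Lu _].
  exact: (smooth_cont smooth_lifted_map Lu).
apply: compact_closedI; first exact: compact_lift_compact.
exact: closed_below (sum_continuous cE1 cE2).
Qed.

Let A1_ge0 x : 0 <= x -> x <= c1 -> 0 <= A1 x.
Proof.
move=> x0 xc; have : A1 0 <= A1 x by rewrite (area1_le (lexx 0) x0 c10 xc).
by rewrite {1}/A1 area0.
Qed.
Let A2_ge0 x : 0 <= x -> x <= c2 -> 0 <= A2 x.
Proof.
move=> x0 xc; have : A2 0 <= A2 x by rewrite (area2_le (lexx 0) x0 c20 xc).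
by rewrite {1}/A2 area0.
Qed.

Let A1_le0 x : 0 <= x -> x <= c1 -> A1 x <= 0 -> x = 0.
Proof.
move=> x0 xc h; apply/eqP; rewrite eq_le x0 andbT.
rewrite -(area1_le x0 (lexx 0) xc c10); apply: le_trans h _.
by rewrite /A1 area0.
Qed.
Let A2_le0 x : 0 <= x -> x <= c2 -> A2 x <= 0 -> x = 0.
Proof.
move=> x0 xc h; apply/eqP; rewrite eq_le x0 andbT.
rewrite -(area2_le x0 (lexx 0) xc c20); apply: le_trans h _.
by rewrite /A2 area0.
Qed.

Let ball_le z : D z -> [/\ 0 <= E1 z, E1 z <= c1, 0 <= E2 z & E2 z <= c2].
Proof.
move=> [eD zw]; have e1 := E1_ge0 z; have e2 := E2_ge0 zw.
by split; move: mc1 mc2 eD e1 e2; lra.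
Qed.

(** Dilating a boundary point increases both areas, and areas bound energies
    whose sum is already maximal. *)
Let expand_out (s : R) z : S z -> 1 < s -> ~ X (s *: phase_map z).
Proof.
move=> Sz s1' /toricP[e [/andP[e0 em] h1 h2]].
have Dz := sphere_sub_ball Sz; have [e1 k1 e2 k2] := ball_le Dz.
have [n1 n2] := phase_map_norms Dz.
have s2' : 1 < s ^+ 2 by rewrite exprn_egt1.
have e3 : 0 <= 2 * e by rewrite mulr_ge0.
have e4 : 0 <= 2 * (m - e) by rewrite mulr_ge0// subr_ge0.
have k3 := le_c1 em; have k4 := le_c2 e0.
have g1 : s ^+ 2 * A1 (E1 z) <= A1 (2 * e) by rewrite -n1 -N1Z.
have g2 : s ^+ 2 * A2 (E2 z) <= A2 (2 * (m - e)) by rewrite -n2 -N2Z.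
have a1 := A1_ge0 e1 k1; have a2 := A2_ge0 e2 k2.
have l1 : E1 z <= 2 * e.
  rewrite -(area1_le e1 e3 k1 k3); apply: le_trans g1.
  exact: (ler_peMl a1 (ltW s2')).
have l2 : E2 z <= 2 * (m - e).
  rewrite -(area2_le e2 e4 k2 k4); apply: le_trans g2.
  exact: (ler_peMl a2 (ltW s2')).
have sm : E1 z + E2 z = 2 * m by case: Sz.
have [q1 q2] := split_eq l1 l2 sm.
have le0 (x : R) : s ^+ 2 * x <= x -> x <= 0.
  move=> h; have : (s ^+ 2 - 1) * x <= 0 by rewrite mulrBl mul1r subr_le0.
  by rewrite pmulr_rle0// subr_gt0.
have z1 : E1 z = 0.
  apply: (A1_le0 e1 k1); apply: le0; apply: le_trans g1 _.
  exact: (eq_ind _ (fun x => x <= _) (lexx (A1 (E1 z))) _ (congr1 A1 (esym q1))).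
have z2 : E2 z = 0.
  apply: (A2_le0 e2 k2); apply: le0; apply: le_trans g2 _.
  exact: (eq_ind _ (fun x => x <= _) (lexx (A2 (E2 z))) _ (congr1 A2 (esym q2))).
by move: sm; rewrite z1 z2 addr0 => /esym/eqP; rewrite mulf_eq0 pnatr_eq0/= gt_eqF.
Qed.

Let interior_toric v : X v -> E1 (phase_inverse v) + E2 (phase_inverse v) < 2 * m ->
  X° v.
Proof.
move=> Xv; have Dz := phase_inverse_ball Xv; have [e1 k1 e2 k2] := ball_le Dz.
have [_ _ _ n1 n2] := phase_inverse_energies (toric_sub Xv).
move: (E1 _) (E2 _) e1 e2 k1 k2 n1 n2 {Dz} => x y x0 y0' xc yc n1 n2 xy.
pose dl := (2 * m - x - y) / 2.
have dl0 : 0 < dl by rewrite divr_gt0// -addrA -opprD subr_gt0.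
have edl : x + dl + (y + dl) = 2 * m by rewrite /dl; field.
have xd0 : 0 <= x + dl by rewrite addr_ge0// ltW.
have yd0 : 0 <= y + dl by rewrite addr_ge0// ltW.
have xd := part1_le yd0 edl; have yd := part2_le xd0 edl.
have cN (i : 'I_2) : continuous (fun z : E => xcoord z i ^+ 2 + ycoord z i ^+ 2).
  move=> z; have cx := @xcoord_continuous R i z; have cy := @ycoord_continuous R i z.
  exact: (@continuousD _ _ _ (fun z : E => xcoord z i * xcoord z i) (fun z : E => ycoord z i * ycoord z i)
    z (continuousM cx cx) (continuousM cy cy)).
have o1 : open [set z : E | N1 z < A1 (x + dl)] by apply: open_below; exact: cN.
have o2 : open [set z : E | N2 z < A2 (y + dl)] by apply: open_below; exact: cN.
have b1' : N1 v < A1 (x + dl) by rewrite n1; apply: (area1_lt x0 _ xd); rewrite ltrDl.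
have b2' : N2 v < A2 (y + dl) by rewrite n2; apply: (area2_lt y0' _ yd); rewrite ltrDl.
apply: filterS (open_nbhs_nbhs (conj (openI o1 o2) (conj b1' b2'))) => v' [/ltW h1 /ltW h2].
apply/toricP; exists ((x + dl) / 2).
have -> : 2 * ((x + dl) / 2) = x + dl by field.
rewrite -(half_eq edl).
by split; [exact: half_itv edl|exact: h1|exact: h2].
Qed.

(** Boundary points are those that dilations throw out of the toric domain, or
    equivalently those where the sum of the energies is maximal. *)
Lemma phase_map_boundary : phase_map @` S = boundary X.
Proof.
rewrite /boundary -(closure_id _).1; last exact: closed_toric.
apply/seteqP; split=> [_ [z Sz <-]|v [Xv nX]].
  have Dz := sphere_sub_ball Sz; split; first exact: phase_map_toric.
  move=> iX; have cs : {for (0 : R), continuous (fun t : R => (1 + t) *: phase_map z)}.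
    apply: (@continuous_comp _ _ _ (fun t : R => 1 + t) (fun s : R => s *: phase_map z)).
      by apply: continuousD; [exact: cst_continuous|exact: cvg_id].
    exact: scalel_continuous.
  have : nbhs (0 : R) [set t : R | X ((1 + t) *: phase_map z)].
    by apply: cs; rewrite addr0 scale1r.
  move=> /nbhs_ballP[/= e e0 he]; have e2 : 0 < e / 2 by rewrite divr_gt0.
  have h : X ((1 + e / 2) *: phase_map z).
    apply: he; rewrite /ball/= sub0r normrN gtr0_norm//.
    by rewrite ltr_pdivrMr// mulr_natr mulr2n ltrDr.
  by apply: (expand_out Sz _ h); rewrite ltrDl.
exists (phase_inverse v); last exact: phase_inverseK (toric_sub Xv).
have [hE hW] := phase_inverse_ball Xv; split; last exact: hW.
apply/eqP; rewrite eq_le hE/= leNgt; apply/negP => h; apply: nX.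
exact: interior_toric.
Qed.

(* A point of the torus over the energies x and y. *)
Let torus_point (x t1 y t2 : R) : E :=
  row_mx (row2 (Num.sqrt (A1 x) * cos t1) (Num.sqrt (A2 y) * cos t2))
         (row2 (Num.sqrt (A1 x) * sin t1) (Num.sqrt (A2 y) * sin t2)).

Let tp_coord x t1 y t2 :
  [/\ xcoord (torus_point x t1 y t2) 0 = Num.sqrt (A1 x) * cos t1,
      xcoord (torus_point x t1 y t2) 1 = Num.sqrt (A2 y) * cos t2,
      ycoord (torus_point x t1 y t2) 0 = Num.sqrt (A1 x) * sin t1 &
      ycoord (torus_point x t1 y t2) 1 = Num.sqrt (A2 y) * sin t2].
Proof. by rewrite /xcoord /ycoord !row_mxEl !row_mxEr !row2_0 !row2_1. Qed.

Let tp_norms x t1 y t2 : 0 <= x -> x <= c1 -> 0 <= y -> y <= c2 ->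
  N1 (torus_point x t1 y t2) = A1 x /\ N2 (torus_point x t1 y t2) = A2 y.
Proof.
move=> x0 xc y0' yc; have [h1 h2 h3 h4] := tp_coord x t1 y t2.
have sq (k t : R) : 0 <= k -> (Num.sqrt k * cos t) ^+ 2 + (Num.sqrt k * sin t) ^+ 2 = k.
  by move=> k0; rewrite !exprMn -mulrDr cos2Dsin2 mulr1 sqr_sqrtr.
rewrite /N1 /N2 h1 h2 h3 h4; split; apply: sq; [exact: A1_ge0|exact: A2_ge0].
Qed.

Let tp_toric x t1 y t2 : 0 <= x -> 0 <= y -> x + y = 2 * m -> X (torus_point x t1 y t2).
Proof.
move=> x0 y0' xy; have xc := part1_le y0' xy; have yc := part2_le x0 xy.
have [n1 n2] := tp_norms t1 t2 x0 xc y0' yc; apply/toricP; exists (x / 2).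
have e1 : x = 2 * (x / 2) by field.
have e2 := half_eq xy.
split; first exact: half_itv xy.
  by rewrite n1 -e1 lexx.
by rewrite n2 -e2 lexx.
Qed.

Let tp_sphere x t1 y t2 : 0 <= x -> 0 <= y -> x + y = 2 * m ->
  S (phase_inverse (torus_point x t1 y t2)).
Proof.
move=> x0 y0' xy; have Xv := tp_toric t1 t2 x0 y0' xy; have Dz := phase_inverse_ball Xv.
have [zw _ _ n1 n2] := phase_inverse_energies (toric_sub Xv).
have [e1 k1 e2 k2] := ball_le Dz; split; last exact: zw.
have xc := part1_le y0' xy; have yc := part2_le x0 xy.
have [m1' m2'] := tp_norms t1 t2 x0 xc y0' yc; rewrite -xy; congr (_ + _); apply/eqP; rewrite eq_le.
  by rewrite -(area1_le e1 x0 k1 xc) -(area1_le x0 e1 xc k1) -(etrans (esym m1') n1) lexx.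
by rewrite -(area2_le e2 y0' k2 yc) -(area2_le y0' e2 yc k2) -(etrans (esym m2') n2) lexx.
Qed.

Let polar_sq (x y k : R) : x ^+ 2 + y ^+ 2 = k -> exists t, 
  x = Num.sqrt k * cos t /\ y = Num.sqrt k * sin t.
Proof.
move=> e; have [r [t [r0 _ ex ey]]] := polar x y; exists t.
suff -> : Num.sqrt k = r by split.
rewrite -e ex ey !exprMn -mulrDr cos2Dsin2 mulr1 sqrtr_sqr.
exact: ger0_norm.
Qed.

Let sweep_continuous (x t1 t2 t : R) : 0 <= x <= 2 * m -> 0 <= t <= 1 ->
  {for t, continuous (fun t : R => torus_point (t * x) (t * t1) (2 * m - t * x) (t * t2))}.
Proof.
move=> /andP[x0 xm] /andP[t0 t1'].
pose U := [set s : R | - d1 < s * x < y1] `&` [set s : R | - 1 < 2 * m - s * x < y2].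
have cM (k : R) : continuous (fun s : R => s * k).
  by move=> s; apply: continuousM; [exact: cvg_id|exact: cst_continuous].
have cB : continuous (fun s : R => 2 * m - s * x).
  move=> s; apply: (@continuousB _ _ _ (fun=> 2 * m) (fun s : R => s * x) s).
    exact: cst_continuous.
  exact: cM.
have oI (p q : R) : open [set s : R | p < s < q].
  by rewrite (_ : [set s : R | p < s < q] = `]p, q[%classic)//; exact: itv_open.
have oU : open U.
  apply: openI.
    apply: (@open_comp _ _ (fun s : R => s * x) [set s | - d1 < s < y1]); last exact: oI.
    by move=> s _; exact: cM.
  apply: (@open_comp _ _ (fun s : R => 2 * m - s * x) [set s | - 1 < s < y2]); last exact: oI.
  by move=> s _; exact: cB.
have Ut : U t.
  have h0 : 0 <= t * x by rewrite mulr_ge0.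
  have h1 : t * x <= 2 * m by apply: le_trans xm; exact: ler_piMl.
  split; apply/andP; split.
  - by apply: lt_le_trans h0; rewrite oppr_lt0.
  - by move: h1; rewrite /y1; lra.
  - by move: h1; lra.
  - by move: h0 my2; lra.
have cA1 s : U s -> {for s, continuous (fun s : R => Num.sqrt (A1 (s * x)))}.
  move=> [h _]; have cA := is_derive_continuous (area_deriv d10 y10 s1 h).
  exact: (continuous_comp (continuous_comp (@cM x s) cA) (@sqrt_continuous R _)).
have cA2 s : U s -> {for s, continuous (fun s : R => Num.sqrt (A2 (2 * m - s * x)))}.
  move=> [_ h]; have cA := is_derive_continuous (area_deriv ltr01 y20 s2 h).
  exact: (continuous_comp (continuous_comp (cB s) cA) (@sqrt_continuous R _)).
have cc (k s : R) : {for s, continuous (fun s : R => cos (s * k))}.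
  exact: (continuous_comp (@cM k s) (@continuous_cos R _)).
have csn (k s : R) : {for s, continuous (fun s : R => sin (s * k))}.
  exact: (continuous_comp (@cM k s) (@continuous_sin R _)).
suff : Ck 0 U (fun t : R => torus_point (t * x) (t * t1) (2 * m - t * x) (t * t2)) by move=> h; exact: (h t Ut).
apply: (Ck_row oU) => i s Us; have cz := fun s => tp_coord (s * x) (s * t1) (2 * m - s * x) (s * t2).
case: (split_ordP i) => j ->; case: (ord2P j) => ->.
- rewrite (_ : (fun _ => _) = fun s : R => Num.sqrt (A1 (s * x)) * cos (s * t1)).
    exact: continuousM (cA1 s Us) (cc t1 s).
  by apply/funext => s'; have [] := cz s'.
- rewrite (_ : (fun _ => _) = fun s : R => Num.sqrt (A2 (2 * m - s * x)) * cos (s * t2)).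
    exact: continuousM (cA2 s Us) (cc t2 s).
  by apply/funext => s'; have [] := cz s'.
- rewrite (_ : (fun _ => _) = fun s : R => Num.sqrt (A1 (s * x)) * sin (s * t1)).
    exact: continuousM (cA1 s Us) (csn t1 s).
  by apply/funext => s'; have [] := cz s'.
- rewrite (_ : (fun _ => _) = fun s : R => Num.sqrt (A2 (2 * m - s * x)) * sin (s * t2)).
    exact: continuousM (cA2 s Us) (csn t2 s).
  by apply/funext => s'; have [] := cz s'.
Qed.

(** The sphere is a family of tori over the segment of energies; scaling the
    energy of mu and both angles to 0 is a path to a fixed point. *)
Lemma connected_sphere_at_e : connected S.
Proof.
have m20 : 0 <= 2 * m by rewrite mulr_ge0// ltW.
apply: (@star_connected _ _ _ (phase_inverse (torus_point 0 0 (2 * m) 0))).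
  by apply: tp_sphere => //; rewrite add0r.
move=> z Sz; have Dz := sphere_sub_ball Sz; have [e1 k1 e2 k2] := ball_le Dz.
have [n1 n2] := phase_map_norms Dz.
have [t1 [x1 y1']] := polar_sq n1; have [t2 [x2 y2']] := polar_sq n2.
have sm : E1 z + E2 z = 2 * m by case: Sz.
have em : E1 z <= 2 * m by rewrite -sm lerDl.
exists (fun t => phase_inverse (torus_point (t * E1 z) (t * t1) (2 * m - t * E1 z) (t * t2))).
have bd (t : R) : 0 <= t <= 1 -> 0 <= t * E1 z /\ 0 <= 2 * m - t * E1 z.
  move=> /andP[t0 t1']; split; first exact: mulr_ge0.
  by rewrite subr_ge0; apply: le_trans em; exact: ler_piMl.
have sumE (t : R) : t * E1 z + (2 * m - t * E1 z) = 2 * m by rewrite addrC subrK.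
split.
- by rewrite !mul0r subr0.
- rewrite !mul1r -sm addrAC subrr add0r -[RHS](phase_mapK Dz); congr phase_inverse.
  have [h1 h2 h3 h4] := tp_coord (E1 z) t1 (E2 z) t2.
  apply: rowE; [rewrite h1|rewrite h2|rewrite h3|rewrite h4]; exact/esym.
- move=> t ht; have [b1' b2'] := bd t ht.
  have Xt := tp_toric (t * t1) (t * t2) b1' b2' (sumE t).
  have sc := @sweep_continuous (E1 z) t1 t2 t (introT andP (conj e1 em)) ht.
  exact: (continuous_comp sc (phase_inverse_continuous (toric_sub Xt))).
- by move=> t /bd[b1' b2']; exact: tp_sphere (sumE t).
Qed.

Let sub_energy : set (phase R) := [set z | E1 z + E2 z <= 2 * m].
Let eq_energy : set (phase R) := [set z | E1 z + E2 z = 2 * m].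

(** A connected set of points below the barrier energy cannot cross the wall
    1 + cos nu = w, on which the energy is too high. *)
Let component_of (A C : set (phase R)) z : A `<=` sub_energy -> connected C -> C z ->
  C = A `&` [set z | 1 + circle_cos z.1.2 <= w] -> C = connected_component A z.
Proof.
move=> AE cC Cz eC; have CA : C `<=` A by rewrite eC => z' [].
apply/seteqP; split; first exact: connected_component_max.
have DE z' : C z' -> D z' by rewrite eC => -[/AE h1 h2]; split.
move=> z' z'C; have Az' : A z' := connected_component_sub z'C.
have cc := connected.component_connected (A := A) (x := z).
have nw y : connected_component A z y -> 1 + circle_cos y.1.2 != w.
  move=> /connected_component_sub/AE yE; apply/eqP => /barrier_energy.
  by rewrite ltNge yE.
have zz : connected_component A z z by apply: connected_component_refl; exact: CA.
rewrite eC; split; first exact: Az'.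
exact: ltW (connected_below cc cW' nw zz (ball_strict (DE z Cz)) z'C).
Qed.

Lemma ball_component z : D z -> D = connected_component sub_energy z.
Proof. by move=> Dz; apply: component_of => //; exact: connected_ball_at_e. Qed.

Lemma sphere_component z : S z -> S = connected_component eq_energy z.
Proof.
move=> Sz; apply: component_of => //; last exact: connected_sphere_at_e.
by move=> z' h; rewrite /sub_energy /= h.
Qed.

Lemma sphere_bounded : phase_bounded S.
Proof.
exists (2 * m / b1 + 1 + (1 + 2 * m)) => z Sz; have Dz := sphere_sub_ball Sz.
have m20 : 0 <= 2 * m by rewrite mulr_ge0// ltW.
have mb : 0 <= 2 * m / b1 by rewrite divr_ge0// ltW.
have e1 := E1_ge0 z; case: Sz => sm zw; have e2 := E2_ge0 zw.
have E1m : E1 z <= 2 * m by rewrite -sm lerDl.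
have E2m : E2 z <= 2 * m by rewrite -sm lerDr.
have [h1 /sq_bound h2] := energy1_bound E1m.
have /sq_bound h3 : z.2.2 ^+ 2 <= 2 * m.
  by apply: (energy2_bound _ E2m); rewrite W0.
split.
- by apply: le_trans h1 _; rewrite lerDl addr_ge0.
- by apply: le_trans h2 _; rewrite lerDr addr_ge0.
- by apply: le_trans h3 _; rewrite lerDr addr_ge0.
Qed.

Lemma sphere_meets_fibre : S `&` fibre_e !=set0.
Proof.
exists ((0, angle pi), (Num.sqrt (2 * m), 0)); split=> //.
have c0 : cosh 0 = 1 :> R by rewrite /cosh oppr0 expR0; field.
have m20 : 0 <= 2 * m by rewrite mulr_ge0// ltW.
split; last by rewrite /= circle_cosE cospi subrr ltW.
rewrite /phase_energy1 /phase_energy2 /energy1 /energy2 /= circle_cosE cospi c0.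
by rewrite !subrr mulr0 !mul0r sqr_sqrtr// expr0n/= !addr0 add0r.
Qed.

Lemma fibre_sphere z : fibre_e z -> eq_energy z -> S z.
Proof.
by move=> fz h; split; first exact: h; rewrite fz /= circle_cosE cospi subrr ltW.
Qed.

End ActionMap.

(** * Return to the masses *)

Section Masses.
Context {R : realType}.
Variables (m1 m2 c a b1 : R).
Hypotheses (ca : c = - 4 * a) (mb : m2 = 4 * a - 2 * b1 - m1).

(** The substitutions w = cosh mu - 1 and w = 1 + cos nu put the two parts of
    the Hamiltonian in the form w * (b + sg * a * w) up to constants, whose sum
    is - m1. *)
Lemma regK_energy z : regK m1 m2 c z =
  (phase_energy1 a b1 z + phase_energy2 a b1 m1 z - 2 * m1) / 2.
Proof.
rewrite /regK /regK1 /regK2 /phase_energy1 /phase_energy2 /energy1 /energy2 ca mb.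
by move: (cosh _) (circle_cos _) z.2.1 z.2.2 => *; field.
Qed.

Lemma sublevel_energy : sublevel m1 m2 c =
  [set z | phase_energy1 a b1 z + phase_energy2 a b1 m1 z <= 2 * m1].
Proof.
by apply/seteqP; split=> z; rewrite /sublevel /= regK_energy pmulr_lle0 ?invr_gt0// subr_le0.
Qed.

Lemma surface_energy : energy_surface m1 m2 c =
  [set z | phase_energy1 a b1 z + phase_energy2 a b1 m1 z = 2 * m1].
Proof.
apply/seteqP; split=> z; rewrite /energy_surface /= regK_energy.
  by move=> /eqP; rewrite mulf_eq0 invr_eq0 pnatr_eq0 orbF subr_eq0 => /eqP.
by move=> ->; rewrite subrr mul0r.
Qed.

End Masses.

Theorem theoremB (R : realType) (m1 m2 c : R)
    (hm1 : 0 < m1) (hm2 : m2 <= 0) (hm : `|m2| <= m1) (hc : c < - m1 - m2) :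
  (exists! S : set (phase R), bounded_component_at_e m1 m2 c S) /\
  (forall S : set (phase R), bounded_component_at_e m1 m2 c S ->
     exists X : set 'rV[R]_(2 + 2),
       convex_toric_domain X /\ arises_as_boundary m1 m2 c S X).
Proof.
pose a : R := - c / 4; pose b1 : R := 2 * a - (m1 + m2) / 2.
have m12 : 0 <= m1 + m2 by move: hm; rewrite ler0_norm//; lra.
have a0 : 0 < a by rewrite /a; lra.
have b10 : 0 < b1 by rewrite /b1 /a; lra.
have b1a : b1 <= 2 * a by rewrite /b1; lra.
have bm : 4 * a <= 2 * b1 + m1 by rewrite /b1; lra.
have ca : c = - 4 * a by rewrite /a; field.
have mb : m2 = 4 * a - 2 * b1 - m1 by rewrite /b1; field.
have sublevelE := sublevel_energy ca mb; have surfaceE := surface_energy ca mb.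
have [w [w0 w2 wb mw]] := barrier a0 b10 hm1 bm.
pose S0 := sphere_at_e a b1 m1 w.
have [z0 [S0z fz0]] := sphere_meets_fibre a b1 hm1 w0.
have S0b : bounded_component_at_e m1 m2 c S0.
  split; [|exact: (sphere_bounded a0 b10 hm1 w2 wb)|by exists z0].
  rewrite surfaceE; exists z0; first by case: S0z.
  exact: (sphere_component a0 b10 b1a hm1 w2 wb mw S0z).
have uniq S : bounded_component_at_e m1 m2 c S -> S = S0.
  move=> [[x _ ->] _ [y [xy fy]]].
  have Ey := connected_component_sub xy; rewrite surfaceE in Ey.
  have Sy := @fibre_sphere _ a b1 m1 w w0 y fy Ey.
  rewrite (same_connected_component xy) surfaceE; apply/esym.
  exact: (sphere_component a0 b10 b1a hm1 w2 wb mw Sy).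
split; first by exists S0; split=> // S /uniq.
move=> S /uniq ->; exists (toric_domain (under_profile m1
  (fun e => pi * area (wellrt a b1 1) (2 * e))
  (fun e => pi * area (wellrt a (b1 + m1) (-1)) (2 * e)))).
split; first exact: (convex_toric_wells a0 b10 b1a hm1 bm).
have D0z := sphere_sub_ball S0z.
exists (ball_at_e a b1 m1 w); split.
- rewrite sublevelE; exists z0; first by case: D0z.
  exact: (ball_component a0 b10 b1a hm1 w2 wb mw D0z).
- exact: (compact_ball_at_e a0 b10 hm1 w2 wb mw).
- exact: (boundary_ball_at_e a0 b10 mw).
- exists (@phase_map R a b1 m1); last exact: (phase_map_boundary a0 b10 b1a hm1 w2 wb mw).
  exact: (phase_map_symplectomorphism a0 b10 b1a hm1 w2 wb mw).
Qed.
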